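(* Let $n\ge3$ and let $\mu$ be an $\mathrm{SO}(n-1)$ invariant probability measure on $\mathbb{S}^{n-1}$ with center of mass at the origin. If $f\in \mathrm{LC_c}(\mathbb{R}^n)$, then $$\frac{2}{n} \int_{\mathbb{R}^n} h(f,x)\,d\gamma_n(x) \geq 1 - \frac{2}{n} \log\left( \frac{1}{(2\pi)^{n/2}} \int_{\mathbb{R}^n} (\Psi_\mu f)^\circ(x)\,dx \right)$$ with equality if and only if $\Psi_\mu f$ is a (positive constant) multiple of the standard Gaussian.
   Context: Fix a pole $\bar e\in\mathbb{S}^{n-1}$; $\mathrm{SO}(n-1)$ is the subgroup of $\mathrm{SO}(n)$ fixing $\bar e$. Center of mass at the origin means $\int_{\mathbb{S}^{n-1}}v\,d\mu(v)=o$. $\gamma_n$ is the standard Gaussian measure on $\mathbb{R}^n$, with density the standard Gaussian $\psi_n(x)=(2\pi)^{-n/2}e^{-\|x\|^2/2}$. $\mathrm{Cvx}(\mathbb{R}^n)$ is the set of convex, lower semi-continuous functions $\varphi:\mathbb{R}^n\to(-\infty,\infty]$ not identically $+\infty$; $\mathrm{Cvx}_{(o)}(\mathbb{R}^n)$ consists of those with the origin $o$ in the interior of $\mathrm{dom}\,\varphi=\{\varphi<\infty\}$. $\mathrm{LC_c}(\mathbb{R}^n)$ is the set of functions $f=e^{-\varphi}$ with $\varphi\in\mathrm{Cvx}(\mathbb{R}^n)$ and $\lim_{\|x\|\to\infty}\varphi(x)=+\infty$. The Legendre transform is $(\mathcal{L}\varphi)(x)=\sup_y\,(x\cdot y-\varphi(y))$.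 The support function of $f$ is $h(f,\cdot)=\mathcal{L}(-\log f)$ and the polar function is $f^\circ=e^{-h(f,\cdot)}$. One has $f\in\mathrm{LC_c}(\mathbb{R}^n)$ iff $h(f,\cdot)\in\mathrm{Cvx}_{(o)}(\mathbb{R}^n)$. For $\varphi\in\mathrm{Cvx}_{(o)}(\mathbb{R}^n)$, $(\varphi\circledast\mu)(x)=\int_{\mathbb{S}^{n-1}}\varphi(\|x\|\vartheta_xv)\,d\mu(v)$ for $x\ne o$, where $\vartheta_x\in\mathrm{SO}(n)$ is any rotation with $\vartheta_x\bar e=x/\|x\|$, and $(\varphi\circledast\mu)(o)=\liminf_{\|x\|\to0}(\varphi\circledast\mu)(x)$; this is again in $\mathrm{Cvx}_{(o)}(\mathbb{R}^n)$. $\Psi_\mu f$ is the unique element of $\mathrm{LC_c}(\mathbb{R}^n)$ with $h(\Psi_\mu f,\cdot)=h(f,\cdot)\circledast\mu$. Conventions: the integral on the left takes values in $(-\infty,\infty]$ (support functions are bounded below by affine functions), the integral on the right takes values in $(0,\infty]$, and $\log(+\infty)=+\infty$. *)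

(* Defs.v *)
From HB Require Import structures.
From mathcomp Require Import all_boot all_order all_algebra.
From mathcomp Require Import all_classical all_reals all_analysis.
From mathcomp Require Import measurable_realfun.

Set Implicit Arguments.
Unset Strict Implicit.
Unset Printing Implicit Defensive.

Import Order.TTheory GRing.Theory Num.Theory.
Import numFieldTopology.Exports numFieldNormedType.Exports.

Local Open Scope classical_set_scope.
Local Open Scope ring_scope.

Fact cV_display : measure_display.
Proof. exact: default_measure_display. Qed.

(* R^n is the type 'cV[R]_n of column vectors, with the topology of the
   library (the product topology) and the sigma-algebra generated by the
   coordinates, which is the Borel sigma-algebra by [measurable_cVE]. *)
Section measurable_cV.
Context (R : realType) (n : nat).

Definition coord_cV (i : 'I_n) (x : 'cV[R]_n) : measurableTypeR R := x i ord0.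

Let cV_set0 : g_sigma_preimage coord_cV set0.
Proof. exact: sigma_algebra0. Qed.

Let cV_setC A : g_sigma_preimage coord_cV A -> g_sigma_preimage coord_cV (~` A).
Proof. exact: sigma_algebraC. Qed.

Let cV_bigcup (F : _^nat) : (forall i, g_sigma_preimage coord_cV (F i)) ->
  g_sigma_preimage coord_cV (\bigcup_i (F i)).
Proof. exact: sigma_algebra_bigcup. Qed.

HB.instance Definition _ := @isMeasurable.Build cV_display
  'cV[R]_n (g_sigma_preimage coord_cV) cV_set0 cV_setC cV_bigcup.

Lemma measurable_coord_cV (i : 'I_n) : measurable_fun [set: 'cV[R]_n] (coord_cV i).
Proof.
move=> _ Y mY; rewrite setTI; apply: sub_sigma_algebra => /=.
rewrite -bigcup_seq/=; exists i => /=; first by rewrite mem_index_enum.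
by exists Y => //; rewrite setTI.
Qed.

Lemma measurable_fun_cVP d (T : measurableType d) (f : T -> 'cV[R]_n) :
  (forall i, measurable_fun [set: T] (coord_cV i \o f)) ->
  measurable_fun [set: T] f.
Proof.
move=> mf _ A mA; rewrite setTI.
suff : g_sigma_preimage coord_cV `<=` [set B | measurable (f @^-1` B)] by exact.
apply: smallest_sub => /=.
  split => /=; first by rewrite preimage_set0.
    by move=> B mB; rewrite setTD preimage_setC; exact: measurableC.
  by move=> F mF; rewrite preimage_bigcup; exact: bigcupT_measurable.
rewrite -bigcup_seq => B [i _ [C mC <-]] /=.
by rewrite setTI -[X in measurable X]setTI; exact: mf.
Qed.

End measurable_cV.

Section borel_cV.
Context (R : realType) (n : nat).

Let box (p : {ffun 'I_n -> rat} * nat) : set 'cV[R]_n :=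
  \bigcap_(i in [set: 'I_n])
    (coord_cV i @^-1` ball (ratr (p.1 i) : R) p.2.+1%:R^-1).

Let measurable_box p : measurable (box p).
Proof.
apply: fin_bigcap_measurable; first exact: finite_finset.
move=> i _; rewrite -[X in measurable X]setTI; apply: measurable_coord_cV => //.
by apply: open_measurable; exact: ball_open.
Qed.

Let open_box (U : set 'cV[R]_n) (x : 'cV[R]_n) : open U -> U x ->
  exists2 p, box p `<=` U & box p x.
Proof.
rewrite openE => /(_ x) /[apply] -[P xP PU].
have /choice[e eP] : forall i, exists e : R,
    0 < e /\ ball (x i ord0) e `<=` P i ord0.
  by move=> i; have /nbhs_ballP[e /= e0 ?] := xP i ord0; exists e.
have [k ke] : exists k : nat, forall i, k.+1%:R^-1 < e i / 2.
  have [k kP] : exists k : nat, forall i, (e i / 2)^-1 < k.+1%:R.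
    exists (\max_i (Num.trunc (e i / 2)^-1)) => i.
    have := truncnS_gt ((e i / 2)^-1); move/lt_le_trans; apply.
    by rewrite ler_nat ltnS; exact: (leq_bigmax i).
  exists k => i; have [e0 _] := eP i.
  by rewrite -[ltRHS]invrK ltf_pV2 ?posrE ?invr_gt0 ?divr_gt0.
have /choice[q qP] : forall i, exists q : rat,
    `|ratr q - x i ord0| < k.+1%:R^-1.
  move=> i; have k0 : 0 < k.+1%:R^-1 :> R by [].
  have /rat_in_itvoo[q] : x i ord0 < x i ord0 + k.+1%:R^-1 by rewrite ltrDl.
  rewrite in_itv/= => /andP[xq qx]; exists q.
  by rewrite gtr0_norm ?subr_gt0// ltrBlDl.
exists ([ffun i => q i], k); last first.
  by move=> i _; rewrite /ball/= ffunE; exact: qP.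
move=> y yq; apply: PU => i j; rewrite (ord1 j); apply: (eP i).2.
have := yq i I; rewrite /ball/= ffunE => qy.
rewrite (le_lt_trans (ler_distD (ratr (q i)) _ _))// (splitr (e i)) ltrD//.
  by rewrite distrC (lt_trans (qP i)).
by rewrite (lt_trans qy).
Qed.

Lemma measurable_cVE :
  (@measurable _ 'cV[R]_n) = <<s (@open 'cV[R]_n) >>.
Proof.
apply/seteqP; split.
- apply: smallest_sub; first exact: smallest_sigma_algebra.
  rewrite -bigcup_seq => _ [i _ [C mC <-]]; rewrite setTI.
  have : (@measurable _ (measurableTypeR R)) `<=`
      [set B | <<s (@open 'cV[R]_n) >> (coord_cV i @^-1` B)].
    rewrite [X in X `<=` _](RGenOpens.measurableE R).
    apply: smallest_sub => [|_ [a [b ->]]] /=.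
      split => /=; first by rewrite preimage_set0; exact: sigma_algebra0.
        by move=> B mB; rewrite setTD preimage_setC; exact: sigma_algebraC.
      by move=> F mF; rewrite preimage_bigcup; exact: sigma_algebra_bigcup.
    apply: sub_sigma_algebra; apply: open_comp; last exact: interval_open.
    by move=> x _; exact: coord_continuous.
  exact.
- apply: smallest_sub; first exact: sigma_algebra_measurable.
  move=> U oU; pose V p := if pselect (box p `<=` U) then box p else set0.
  suff -> : U = \bigcup_p V p.
    apply: countable_bigcupT_measurable => // p; rewrite /V.
    by case: pselect => pU /=; [exact: measurable_box|exact: measurable0].
  apply/seteqP; split => [x /(open_box oU)[p pU px]|x [p _]].
    by exists p => //; rewrite /V; case: pselect.
  by rewrite /V; case: pselect => //= pU; exact: pU.
Qed.

End borel_cV.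

Section lebesgue_cV.
Context (R : realType).
Local Open Scope ereal_scope.

Definition cons_cV n (p : measurableTypeR R * 'cV[R]_n) : 'cV[R]_n.+1 :=
  \col_i (if unlift ord0 i is Some j then p.2 j ord0 else p.1).

Definition tail_cV n (x : 'cV[R]_n.+1) : 'cV[R]_n :=
  \col_i x (lift ord0 i) ord0.

Lemma measurable_cons_cV n : measurable_fun setT (@cons_cV n).
Proof.
apply: measurable_fun_cVP => i.
case: (unliftP ord0 i) => [j ->|->].
- rewrite (_ : _ \o _ = coord_cV j \o snd).
    by apply: measurableT_comp; [exact: measurable_coord_cV|exact: measurable_snd].
  by apply/funext => p; rewrite /coord_cV /= mxE liftK.
- rewrite (_ : _ \o _ = fst); first exact: measurable_fst.
  by apply/funext => p; rewrite /coord_cV /= mxE unlift_none.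
Qed.

Lemma measurable_tail_cV n : measurable_fun setT (@tail_cV n).
Proof.
apply: measurable_fun_cVP => i.
rewrite (_ : _ \o _ = coord_cV (lift ord0 i)); first exact: measurable_coord_cV.
by apply/funext => x; rewrite /coord_cV /= mxE.
Qed.

Lemma cons_cVK n (p : measurableTypeR R * 'cV[R]_n) :
  (coord_cV ord0 (cons_cV p), tail_cV (cons_cV p)) = p.
Proof.
case: p => a x; congr pair; first by rewrite /coord_cV mxE unlift_none.
by apply/matrixP => i j; rewrite !mxE liftK (ord1 j).
Qed.


Section lebesgue_cV_succ.
Context (n : nat) (m : {sigma_finite_measure set 'cV[R]_n -> \bar R}).

Definition lebesgue_cV_succ : set 'cV[R]_n.+1 -> \bar R :=
  pushforward (@lebesgue_measure R \x m) (@cons_cV n).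

Let measurable_pre A : measurable A -> measurable (@cons_cV n @^-1` A).
Proof.
by move=> mA; rewrite -[X in measurable X]setTI; exact: measurable_cons_cV.
Qed.

Let lebesgue_cV_succ0 : lebesgue_cV_succ set0 = 0.
Proof. by rewrite /lebesgue_cV_succ /pushforward preimage_set0 measure0. Qed.

Let lebesgue_cV_succ_ge0 A : 0 <= lebesgue_cV_succ A.
Proof. exact: (measure_ge0 (@lebesgue_measure R \x m)). Qed.

Let lebesgue_cV_succ_additive : semi_sigma_additive lebesgue_cV_succ.
Proof.
move=> F mF tF mUF; rewrite /lebesgue_cV_succ /pushforward preimage_bigcup.
apply: measure_semi_sigma_additive.
- by move=> k; exact: measurable_pre.
- apply/trivIsetP => /= i j _ _ ij; rewrite -preimage_setI.
  by move/trivIsetP : tF => /(_ _ _ _ _ ij) ->//; rewrite preimage_set0.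
- by rewrite -preimage_bigcup; exact: measurable_pre.
Qed.

HB.instance Definition _ := isMeasure.Build _ _ _ lebesgue_cV_succ
  lebesgue_cV_succ0 lebesgue_cV_succ_ge0 lebesgue_cV_succ_additive.

Let lebesgue_cV_succ_sigma_finite : sigma_finite setT lebesgue_cV_succ.
Proof.
have /sigma_finiteP[F [FT ndF Foo]] := sigma_finiteT (@lebesgue_measure R).
have /sigma_finiteP[G [GT ndG Goo]] := sigma_finiteT m.
have mH k : measurable (coord_cV ord0 @^-1` F k `&` @tail_cV n @^-1` G k).
  apply: measurableI; rewrite -[X in measurable X]setTI.
    by apply: measurable_coord_cV => //; case: (Foo k).
  by apply: measurable_tail_cV => //; case: (Goo k).
exists (fun k => coord_cV ord0 @^-1` F k `&` @tail_cV n @^-1` G k).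
  apply/esym/seteqP; split => // x _.
  have [i _ Fi] : (\bigcup_i F i) (coord_cV ord0 x) by rewrite -FT.
  have [j _ Gj] : (\bigcup_i G i) (tail_cV x) by rewrite -GT.
  exists (maxn i j) => //; split.
    by apply: (subsetPset _ _ (ndF _ _ (leq_maxl i j))).
  by apply: (subsetPset _ _ (ndG _ _ (leq_maxr i j))).
move=> k; have [mF Fk] := Foo k; have [mG Gk] := Goo k; split => //.
rewrite /lebesgue_cV_succ /pushforward (_ : _ @^-1` _ = F k `*` G k).
  by rewrite product_measure1E// lte_mul_pinfty// ge0_fin_numE.
by apply/funext => p; rewrite /setX /preimage/= -[in RHS](cons_cVK p).
Qed.

HB.instance Definition _ := Measure_isSigmaFinite.Build _ _ _
  lebesgue_cV_succ lebesgue_cV_succ_sigma_finite.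

End lebesgue_cV_succ.

(* Lebesgue measure on R^n as the n-fold product of Lebesgue measure on R. *)
Fixpoint lebesgue_cV n : {sigma_finite_measure set 'cV[R]_n -> \bar R} :=
  match n return {sigma_finite_measure set 'cV[R]_n -> \bar R} with
  | 0 => dirac (0%R : 'cV[R]_0)
  | k.+1 => lebesgue_cV_succ (lebesgue_cV k)
  end.

Lemma lebesgue_cV_box n (a b : 'I_n -> R) : (forall i, (a i <= b i)%R) ->
  lebesgue_cV n [set x | forall i, x i ord0 \in `[a i, b i]%R] =
  (\prod_(i < n) (b i - a i))%:E.
Proof.
elim: n a b => [|n ih] a b ab.
  rewrite big_ord0 /= diracE mem_set//=; by case.
rewrite big_ord_recl /= /lebesgue_cV_succ /pushforward.
rewrite (_ : _ @^-1` _ = `[a ord0, b ord0]%classic `*`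
    [set x : 'cV[R]_n | forall i, x i ord0 \in
       `[a (lift ord0 i), b (lift ord0 i)]%R]); last first.
  apply/seteqP; split => [[t x]/= H|[t x]/= [H0 H] i].
    split; first by have := H ord0; rewrite mxE unlift_none.
    by move=> i; have := H (lift ord0 i); rewrite mxE liftK.
  by case: (unliftP ord0 i) => [j|] ->; rewrite mxE ?liftK ?unlift_none.
rewrite product_measure1E//=.
  rewrite ih => [|i]; last exact: ab.
  rewrite lebesgue_measure_itv/= lte_fin; case: ltP => // ba.
  have -> : b ord0 = a ord0 by apply/eqP; rewrite eq_le ba ab.
  by rewrite subrr mul0r mul0e.
rewrite (_ : mkset _ = \bigcap_(i in [set: 'I_n]) (coord_cV i @^-1`
    `[a (lift ord0 i), b (lift ord0 i)]%classic)); last first.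
  by apply/seteqP; split => [x H i _|x H i]; [exact: H|exact: (H i I)].
apply: fin_bigcap_measurable; first exact: finite_finset.
move=> i _; rewrite -[X in measurable X]setTI.
by apply: measurable_coord_cV => //; exact: measurable_itv.
Qed.

End lebesgue_cV.

Section euclidean.
Context (R : realType) (n : nat).
Implicit Types x y : 'cV[R]_n.

Definition dotp x y : R := \sum_(i < n) x i ord0 * y i ord0.

Definition enorm x : R := Num.sqrt (dotp x x).

Definition sphere : set 'cV[R]_n := [set x | enorm x = 1].

Definition special_orthogonal : set 'M[R]_n :=
  [set A | A^T *m A = 1%:M /\ \det A = 1].

Definition gauss_pdf x : R :=
  ((2 * pi) `^ (n%:R / 2))^-1 * expR (- (enorm x ^+ 2 / 2)).

Lemma measurable_gauss_pdf : measurable_fun setT gauss_pdf.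
Proof.
apply: measurable_funM => //; apply: measurableT_comp => //.
apply: measurable_funN; apply: measurable_funM => //.
apply: measurable_funX; apply: measurableT_comp => //.
  by apply: continuous_measurable_fun; exact: sqrt_continuous.
apply: measurable_sum => i.
by apply: measurable_funM; exact: measurable_coord_cV.
Qed.

Lemma gauss_pdf_ge0 x : 0 <= gauss_pdf x.
Proof. by rewrite mulr_ge0 ?expR_ge0// invr_ge0 powR_ge0. Qed.

Definition gauss_measure (A : set 'cV[R]_n) : \bar R :=
  (\int[lebesgue_cV R n]_(x in A) (gauss_pdf x)%:E)%E.

Let gauss_measure0 : gauss_measure set0 = 0%E.
Proof. exact: integral_set0. Qed.

Let gauss_measure_ge0 A : (0 <= gauss_measure A)%E.
Proof. by apply: integral_ge0 => x _; rewrite lee_fin gauss_pdf_ge0. Qed.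

Let gauss_measure_additive : semi_sigma_additive gauss_measure.
Proof.
move=> F mF tF mUF; rewrite /gauss_measure ge0_integral_bigcup//=.
- apply: is_cvg_ereal_nneg_natsum_cond => k _ _; exact: gauss_measure_ge0.
- apply/measurable_funTS/measurable_EFinP; exact: measurable_gauss_pdf.
- by move=> x _; rewrite lee_fin gauss_pdf_ge0.
Qed.

HB.instance Definition _ := isMeasure.Build _ _ _ gauss_measure
  gauss_measure0 gauss_measure_ge0 gauss_measure_additive.

End euclidean.

Section convex_functions.
Context (R : realType) (n : nat).
Implicit Types (phi : 'cV[R]_n -> \bar R) (f : 'cV[R]_n -> R).
Local Open Scope ereal_scope.

Definition Cvx : set ('cV[R]_n -> \bar R) :=
  [set phi : 'cV[R]_n -> \bar R | [/\ forall x, phi x != -oo,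
    exists x, phi x != +oo,
    lower_semicontinuous phi &
    forall (x y : 'cV[R]_n) (t : R), (0 < t < 1)%R ->
      phi (t *: x + (1 - t) *: y)%R <=
        t%:E * phi x + (1 - t)%:E * phi y]].

Definition LCc : set ('cV[R]_n -> R) :=
  [set f : 'cV[R]_n -> R | exists phi : 'cV[R]_n -> \bar R, [/\ Cvx phi,
    forall M : R, exists r : R, forall x, (r < enorm x)%R -> M%:E < phi x &
    forall x, (f x)%:E = expeR (- phi x)]].

Definition legendre phi : 'cV[R]_n -> \bar R :=
  fun x => ereal_sup [set (dotp x y)%:E - phi y | y in [set: 'cV[R]_n]].

Definition support_fun f : 'cV[R]_n -> \bar R :=
  legendre (fun y => - lne (f y)%:E).

Definition polar f : 'cV[R]_n -> \bar R := fun x => expeR (- support_fun f x).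

End convex_functions.

Section minkowski.
Context (R : realType) (n : nat) (e : 'cV[R]_n) (mu : probability 'cV[R]_n R).
Local Open Scope ereal_scope.

(* Any rotation taking the pole e to x / |x|; when mu is invariant under the
   rotations fixing e, [circledast] does not depend on the choice. *)
Definition rotation_to (x : 'cV[R]_n) : 'M[R]_n :=
  xget 1%:M%R [set A | special_orthogonal A /\
                       (A *m e = (enorm x)^-1 *: x)%R].

(* A measure on the sphere is encoded as a Borel measure mu on R^n with
   mu sphere = 1. *)
Definition circledast (phi : 'cV[R]_n -> \bar R) : 'cV[R]_n -> \bar R :=
  let F x := \int[mu]_(v in @sphere R n)
               phi (enorm x *: (rotation_to x *m v))%R in
  fun x => if x == 0%R then limf_einf F (0%R : 'cV[R]_n)^' else F x.

Definition Psi (f : 'cV[R]_n -> R) : 'cV[R]_n -> R :=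
  xget (fun=> 0%R) [set g : 'cV[R]_n -> R | LCc g /\
                  support_fun g = circledast (support_fun f)].

End minkowski.

(* Main.v *)
(** Let [k x = h(f, x) - x . y0 + r0] be the support function of [f] after
subtracting an affine minorant, so that [k >= 0], and let [K] be the average
[k * mu]; since [mu] is centered and a probability, [h(Psi f, x) = K x - r0].
On a plane through the origin, [K] is an integral of [k (W M(a, b, r) v)] with
[W] orthogonal and [M(a, b, r)] the multiplication by [a + i b] on a fixed plane
containing the pole and by [r = |a + i b|] on its complement; [K] is convex
because this integral is convex in [(a, b, r)] and even in [r], hence
nondecreasing in [r >= 0].  Averaging over a random orthogonal
matrix gives [\int K = \int k] for the Gaussian measure.  The right-hand side
is then governed by the Gaussian integral of [exp (|x|^2/2 + r0 - K x)], and the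
inequality is Jensen's.  In the equality case [K x - |x|^2/2] is almost
everywhere constant, hence constant by convexity and lower semicontinuity, which
makes [Psi f] a multiple of the Gaussian. *)

From HB Require Import structures.
Require Import Defs.
From mathcomp Require Import all_boot all_order all_algebra.
From mathcomp Require Import all_classical all_reals all_analysis.
From mathcomp Require Import measurable_realfun ring lra.

Set Implicit Arguments.
Unset Strict Implicit.
Unset Printing Implicit Defensive.

Import Order.TTheory GRing.Theory Num.Theory.
Import numFieldTopology.Exports numFieldNormedType.Exports.

Local Open Scope classical_set_scope.
Local Open Scope ring_scope.

(** * Orthogonal matrices and Householder reflections *)

Section euclid.
Context (R : realType).

(** The rotation taking the pole to [x / |x|] is replaced by the Householder reflection exchanging
    [|x| e] and [x], which is a formula measurable in [x], while [rotation_to] is an arbitrary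
    choice. The price is that [mu] must be invariant under every orthogonal map fixing the pole,
    determinant -1 included; this is where a circle orthogonal to the pole, hence [n >= 3], is
    needed. Monotonicity in [r] is the crux of convexity: for [x = W (a e + b f)] the averaged
    matrix is [W M(a, b, |x|)], linear in its three parameters, but at a convex combination of two
    points the norm only satisfies the triangle inequality, so the third parameter falls short of
    the combination of the third parameters. Subtracting an affine minorant makes the integrands
    nonnegative, so that Tonelli and Fatou apply without integrability and infinite values are
    allowed. *)

Lemma dotpE n (x y : 'cV[R]_n) : dotp x y = (x^T *m y) ord0 ord0.
Proof. by rewrite mxE; apply: eq_bigr => i _; rewrite mxE. Qed.

Section basics.
Context (n : nat).
Implicit Types (x y z w : 'cV[R]_n) (A B : 'M[R]_n).

Lemma dotpC x y : dotp x y = dotp y x.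
Proof. by apply: eq_bigr => i _; rewrite mulrC. Qed.

Lemma dotpDl x y z : dotp (x + y) z = dotp x z + dotp y z.
Proof. by rewrite -big_split; apply: eq_bigr => i _; rewrite mxE mulrDl. Qed.

Lemma dotpZl a x y : dotp (a *: x) y = a * dotp x y.
Proof. by rewrite mulr_sumr; apply: eq_bigr => i _; rewrite mxE mulrA. Qed.

Lemma dotpNl x y : dotp (- x) y = - dotp x y.
Proof. by rewrite -scaleN1r dotpZl mulN1r. Qed.

Lemma dotpDr x y z : dotp z (x + y) = dotp z x + dotp z y.
Proof. by rewrite dotpC dotpDl ![dotp z _]dotpC. Qed.

Lemma dotpZr a x y : dotp y (a *: x) = a * dotp y x.
Proof. by rewrite dotpC dotpZl dotpC. Qed.

Lemma dotpNr x y : dotp y (- x) = - dotp y x.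
Proof. by rewrite dotpC dotpNl dotpC. Qed.

Lemma dotp0r x : dotp x 0 = 0.
Proof. by rewrite -(scale0r (0 : 'cV[R]_n)) dotpZr mul0r. Qed.

Lemma dotp0l x : dotp 0 x = 0. Proof. by rewrite dotpC dotp0r. Qed.

Definition dotp_lin := (dotpDl, dotpDr, dotpNl, dotpNr, dotpZl, dotpZr).

Lemma dotp_ge0 x : 0 <= dotp x x.
Proof. by apply: sumr_ge0 => i _; rewrite -expr2 sqr_ge0. Qed.

Lemma dotp_eq0 x : (dotp x x == 0) = (x == 0).
Proof.
apply/idP/eqP => [|->]; last by rewrite dotp0r.
rewrite psumr_eq0 => [/allP x0|i _]; last by rewrite -expr2 sqr_ge0.
apply/matrixP => i j; rewrite ord1 mxE; have := x0 i.
by rewrite mem_index_enum => /(_ isT)/implyP/(_ isT); rewrite mulf_eq0 orbb => /eqP.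
Qed.

Lemma enorm_ge0 x : 0 <= enorm x. Proof. exact: sqrtr_ge0. Qed.

Lemma enorm_sqr x : enorm x ^+ 2 = dotp x x.
Proof. by rewrite sqr_sqrtr// dotp_ge0. Qed.

Lemma enorm_eq0 x : (enorm x == 0) = (x == 0).
Proof. by rewrite -dotp_eq0 -enorm_sqr expf_eq0. Qed.

Lemma enorm_gt0 x : (0 < enorm x) = (x != 0).
Proof. by rewrite lt_neqAle enorm_ge0 andbT eq_sym enorm_eq0. Qed.

Lemma enorm0 : enorm (0 : 'cV[R]_n) = 0.
Proof. by apply/eqP; rewrite enorm_eq0. Qed.

Lemma enorm_dotp x y : (enorm x = enorm y) <-> (dotp x x = dotp y y).
Proof. by split=> [xy|xy]; [rewrite -!enorm_sqr xy|rewrite /enorm xy]. Qed.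

Lemma enormZ a x : enorm (a *: x) = `|a| * enorm x.
Proof.
by rewrite /enorm !dotp_lin mulrA -expr2 sqrtrM ?sqr_ge0// sqrtr_sqr.
Qed.

Lemma enormN x : enorm (- x) = enorm x.
Proof. by rewrite -scaleN1r enormZ normrN1 mul1r. Qed.

Lemma cauchy_schwarz x y : dotp x y <= enorm x * enorm y.
Proof.
have [->|x0] := eqVneq x 0; first by rewrite dotp0l enorm0 mul0r.
have [->|y0] := eqVneq y 0; first by rewrite dotp0r enorm0 mulr0.
(* The squared norm of this vector is [2 a b (a b - d)] in the notation below. *)
have := dotp_ge0 (enorm y *: x - enorm x *: y).
rewrite !dotp_lin (dotpC y x) -!enorm_sqr.
set a := enorm x; set b := enorm y; set d := dotp x y => H.
have a0 : 0 < a by rewrite enorm_gt0.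
have b0 : 0 < b by rewrite enorm_gt0.
have : 0 <= (2 * a * b) * (a * b - d) by nra.
by rewrite pmulr_rge0 ?subr_ge0// !mulr_gt0.
Qed.

Lemma enormD x y : enorm (x + y) <= enorm x + enorm y.
Proof.
rewrite -(@ler_pXn2r _ 2)// ?nnegrE ?addr_ge0 ?enorm_ge0//.
rewrite enorm_sqr !dotp_lin sqrrD !enorm_sqr (dotpC y x).
have := cauchy_schwarz x y; lra.
Qed.

Lemma enormB x y : enorm x - enorm y <= enorm (x - y).
Proof. by rewrite lerBlDr; apply: le_trans (enormD _ _); rewrite subrK. Qed.

Lemma enormBC x y : enorm (x - y) = enorm (y - x).
Proof. by rewrite -enormN opprB. Qed.

Lemma dotp_mulmx A x y : dotp (A *m x) y = dotp x (A^T *m y).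
Proof. by rewrite !dotpE trmx_mul mulmxA. Qed.

Definition is_orth A := A^T *m A = 1%:M.

Lemma is_orthM A B : is_orth A -> is_orth B -> is_orth (A *m B).
Proof.
by rewrite /is_orth trmx_mul => oA oB; rewrite mulmxA -(mulmxA B^T) oA mulmx1.
Qed.

Lemma is_orth_tr A : is_orth A -> is_orth A^T.
Proof. by rewrite /is_orth trmxK => /mulmx1C. Qed.

Lemma is_orth1 : is_orth 1%:M.
Proof. by rewrite /is_orth trmx1 mulmx1. Qed.

Lemma is_orthN A : is_orth A -> is_orth (- A).
Proof. move=> oA; rewrite /is_orth (_ : (- A)^T = - A^T) ?mulNmx ?mulmxN ?opprK//.
by apply/matrixP => i j; rewrite !mxE. Qed.

Lemma is_orth_det A : is_orth A -> \det A = 1 \/ \det A = -1.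
Proof.
move=> /(congr1 determinant); rewrite det_mulmx det_tr det1 -expr2 => /eqP.
by rewrite sqrf_eq1 => /orP[]/eqP; [left|right].
Qed.

Lemma dotp_is_orth A x y : is_orth A -> dotp (A *m x) (A *m y) = dotp x y.
Proof. by move=> oA; rewrite dotp_mulmx mulmxA oA mul1mx. Qed.

Lemma enorm_is_orth A x : is_orth A -> enorm (A *m x) = enorm x.
Proof. by move=> oA; apply/enorm_dotp; rewrite dotp_is_orth. Qed.

(* At [w = 0] the division by zero makes this the identity. *)
Definition householder w : 'M[R]_n := 1%:M - (2 / dotp w w) *: (w *m w^T).

Lemma householderE w x :
  householder w *m x = x - (2 * dotp w x / dotp w w) *: w.
Proof.
rewrite mulmxBl mul1mx -scalemxAl -mulmxA.
have -> : w^T *m x = (dotp w x)%:M by rewrite dotpE [LHS]mx11_scalar.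
by rewrite mul_mx_scalar scalerA mulrAC.
Qed.

Lemma householder_tr w : (householder w)^T = householder w.
Proof. by rewrite linearB/= trmx1 linearZ/= trmx_mul trmxK. Qed.

(** The matrix is symmetric, so orthogonality means being an involution, which is checked on
    vectors. *)
Lemma householder_is_orth w : is_orth (householder w).
Proof.
rewrite /is_orth householder_tr.
have mE (M : 'M[R]_n) : (forall x : 'cV_n, M *m x = x) -> M = 1%:M.
  move=> Mx; apply/matrixP => i j.
  have := Mx (delta_mx j ord0); rewrite -colE => /colP/(_ i).
  by rewrite !mxE andbT.
apply: mE => x; rewrite -mulmxA !householderE !dotp_lin.
have [->|w0] := eqVneq w 0; first by rewrite !scaler0 !subr0.
have d0 : dotp w w != 0 by rewrite dotp_eq0.
rewrite -addrA -opprD -scalerDl -[RHS]subr0; congr (_ - _).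
by rewrite (_ : _ + _ = 0) ?scale0r//; field.
Qed.

(** Equal norms make [x] and [y] mirror images in the hyperplane orthogonal to [x - y]. This is the
    source of orthogonal maps with a prescribed value. *)
Lemma householder_swap x y : enorm x = enorm y ->
  householder (x - y) *m x = y.
Proof.
move=> /enorm_dotp xy; rewrite householderE.
have [->|nxy] := eqVneq x y; first by rewrite subrr scaler0 subr0.
have d0 : dotp (x - y) (x - y) != 0 by rewrite dotp_eq0 subr_eq0.
have -> : 2 * dotp (x - y) x / dotp (x - y) (x - y) = 1.
  rewrite -[RHS](divff d0); congr (_ / _).
  by rewrite !dotp_lin -xy (dotpC y x); ring.
by rewrite scale1r opprB addrC subrK.
Qed.

Lemma householder_fix w x : dotp w x = 0 -> householder w *m x = x.
Proof. by move=> wx; rewrite householderE wx mulr0 mul0r scale0r subr0. Qed.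

Lemma coord_le_enorm x i : `|x i ord0| <= enorm x.
Proof.
rewrite -sqrtr_sqr ler_sqrt ?dotp_ge0// /dotp (bigD1 i)//= -expr2 lerDl.
by apply: sumr_ge0 => j _; rewrite -expr2 sqr_ge0.
Qed.

Lemma enorm_le_sum x : enorm x <= \sum_i `|x i ord0|.
Proof.
rewrite -(@ler_pXn2r _ 2)// ?nnegrE ?enorm_ge0//; last exact: sumr_ge0.
rewrite enorm_sqr [leRHS]expr2 mulr_suml; apply: ler_sum => i _.
rewrite (le_trans (ler_norm _))// normrM ler_wpM2l// (bigD1 i)//= lerDl.
exact: sumr_ge0.
Qed.

Lemma nbhs_enormP x (V : set 'cV[R]_n) :
  nbhs x V <-> exists2 d : R, 0 < d & forall y, enorm (y - x) < d -> V y.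
Proof.
split=> [/nbhs_ballP[d /= d0 dV]|[d d0 dV]].
  exists d => // y yx; apply: dV; split => // i j; rewrite ord1.
  by rewrite /ball/= distrC; apply: le_lt_trans yx; have := coord_le_enorm (y - x) i; rewrite !mxE.
(* [n.+1] rather than [n] allows dimension 0 and makes the sum of the [n] coordinate bounds strictly
   smaller than [d]. *)
apply/nbhs_ballP; exists (d / n.+1%:R) => /=; first by rewrite divr_gt0.
move=> y xy; apply: dV; apply: (le_lt_trans (enorm_le_sum _)).
apply: (@le_lt_trans _ _ (\sum_(i < n) (d / n.+1%:R))).
  apply: ler_sum => i _; have := xy.2 i ord0; rewrite /ball/= distrC => /ltW.
  by rewrite !mxE.
rewrite sumr_const card_ord -[ltLHS]mulr_natr -mulrA gtr_pMr// mulrC ltr_pdivrMr// mul1r ltr_nat.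
by [].
Qed.

Lemma cvg_enormP (u : nat -> 'cV[R]_n) x :
  (u @ \oo --> x) <-> (forall d : R, 0 < d -> \forall k \near \oo, enorm (u k - x) < d).
Proof.
split=> [ux d d0|ux V /nbhs_enormP[d d0 dV]].
  by apply: (ux [set y | enorm (y - x) < d]); apply/nbhs_enormP; exists d.
by rewrite /nbhs/=; near=> k; apply: dV; near: k; exact: ux.
Unshelve. all: by end_near. Qed.

End basics.
End euclid.

(** * Lebesgue and Gaussian integrals on column vectors *)

Section density.
Local Open Scope ereal_scope.
Context d (T : measurableType d) (R : realType).
Import HBNNSimple.

(** The hypothesis on [nu] is the case of indicators; linearity gives simple functions and monotone
    convergence the rest. *)
Lemma ge0_integral_density (mu nu : {measure set T -> \bar R}) (p : T -> R)
    (f : T -> \bar R) :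
  measurable_fun setT p -> (forall x, (0 <= p x)%R) ->
  (forall A, measurable A -> nu A = \int[mu]_(x in A) (p x)%:E) ->
  measurable_fun setT f -> (forall x, 0 <= f x) ->
  \int[nu]_x f x = \int[mu]_x (f x * (p x)%:E).
Proof.
move=> mp p0 nuE mf f0.
have mpE : measurable_fun setT (EFin \o p) by apply/measurable_EFinP.
pose f_ := nnsfun_approx measurableT mf.
transitivity (limn (fun n => \int[nu]_x (f_ n x)%:E)).
  rewrite -monotone_convergence//.
  - apply: eq_integral => y _; apply/esym/cvg_lim => //.
    exact: cvg_nnsfun_approx.
  - by move=> n; exact/measurable_EFinP.
  - by move=> n y _; rewrite lee_fin.
  - by move=> y _ m n mn; rewrite lee_fin; exact/lefP/nd_nnsfun_approx.
rewrite (_ : (fun n => _) = fun n => \int[mu]_x ((f_ n x)%:E * (p x)%:E)).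
  rewrite -monotone_convergence//.
  - apply: eq_integral => y _; apply/cvg_lim => //.
    apply: cvgeZr => //; exact: cvg_nnsfun_approx.
  - by move=> n; apply: emeasurable_funM => //; exact/measurable_EFinP.
  - by move=> n y _; rewrite mule_ge0// lee_fin.
  - move=> y _ m n mn; rewrite lee_wpmul2r ?lee_fin//.
    exact/lefP/nd_nnsfun_approx.
apply/funext => n; transitivity (\sum_(r \in range (f_ n))
    \int[nu]_x (r * \1_(f_ n @^-1` [set r]) x)%:E).
  rewrite -ge0_integral_fsum//.
  - by apply: eq_integral => x _; rewrite [in LHS]fimfunE -fsumEFin.
  - by move=> r; exact/measurable_EFinP/measurable_funM.
  - by move=> r x _; rewrite nnfun_muleindic_ge0.
transitivity (\sum_(r \in range (f_ n))
    \int[mu]_x ((r * \1_(f_ n @^-1` [set r]) x)%:E * (p x)%:E)); last first.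
  rewrite -ge0_integral_fsum//.
  - apply: eq_integral => x _; rewrite -ge0_mule_fsuml.
      by rewrite [in RHS]fimfunE -fsumEFin.
    by move=> r; rewrite nnfun_muleindic_ge0.
  - move=> r; apply: emeasurable_funM => //.
    exact/measurable_EFinP/measurable_funM.
  - by move=> r x _; rewrite mule_ge0 ?nnfun_muleindic_ge0// lee_fin.
apply: eq_fsbigr => r /[!inE] -[x _ <-{r}].
have fx0 : (0 <= f_ n x)%R by [].
under [RHS]eq_integral => y _ do rewrite EFinM -muleA.
under [LHS]eq_integral => y _ do rewrite EFinM.
rewrite !ge0_integralZl//.
- congr (_ * _); rewrite integral_indic// setIT nuE// [LHS]integral_mkcond.
  apply: eq_integral => y _; rewrite patchE indicE.
  by case: (y \in _); rewrite ?mul1e ?mul0e.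
- by apply: emeasurable_funM => //; exact/measurable_EFinP.
- by move=> y _; rewrite mule_ge0// lee_fin.
- exact/measurable_EFinP.
Qed.

End density.

Section invariant.
Local Open Scope ereal_scope.
Context d1 d2 (T1 : measurableType d1) (T2 : measurableType d2) (R : realType).
Variables (phi : T1 -> T2) (mphi : measurable_fun setT phi).
Let mphi_mixin := isMeasurableFun.Build _ _ _ _ _ mphi.
Let mphi_pack : {mfun _ >-> _} := HB.pack phi mphi_mixin.

Lemma ge0_integral_measure_preserving (mu : {measure set T1 -> \bar R})
    (nu : {measure set T2 -> \bar R}) (f : T2 -> \bar R) :
  (forall A, measurable A -> mu (phi @^-1` A) = nu A) ->
  measurable_fun setT f -> (forall x, 0 <= f x) ->
  \int[mu]_x f (phi x) = \int[nu]_x f x.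
Proof.
move=> muphi mf f0.
rewrite -[LHS](ge0_integral_pushforward mphi mu (D := setT))//.
apply: (eq_measure_integral nu (m1 := pushforward mu mphi_pack)) => A mA _.
exact: muphi.
Qed.

End invariant.

Section measurability.
Context (R : realType) (n : nat).

Lemma lsc_measurable_cV (f : 'cV[R]_n -> \bar R) :
  lower_semicontinuous f -> measurable_fun setT f.
Proof.
move=> scif; apply: (measurability _ (ErealGenOInfty.measurableE R)).
move=> /= _ [_ [a ->]] <-; apply: measurableI => //.
rewrite measurable_cVE; apply: sub_sigma_algebra.
by rewrite preimage_itvoy; move/lower_semicontinuousP : scif; exact.
Qed.

Context d (T : measurableType d).

Lemma measurable_fun_coord (f : T -> 'cV[R]_n) i :
  measurable_fun setT f -> measurable_fun setT (fun t => f t i ord0).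
Proof. by move=> mf; apply: (measurableT_comp (measurable_coord_cV i)). Qed.

Lemma measurable_fun_dotp (f g : T -> 'cV[R]_n) :
  measurable_fun setT f -> measurable_fun setT g ->
  measurable_fun setT (fun t => dotp (f t) (g t)).
Proof.
move=> mf mg; apply: measurable_sum => i.
by apply: measurable_funM; exact: measurable_fun_coord.
Qed.

Lemma measurable_fun_enorm (f : T -> 'cV[R]_n) :
  measurable_fun setT f -> measurable_fun setT (fun t => enorm (f t)).
Proof.
move=> mf; apply: (measurableT_comp (f := @Num.sqrt R)).
  by apply: continuous_measurable_fun; exact: sqrt_continuous.
exact: measurable_fun_dotp.
Qed.

Lemma measurable_fun_scale (a : T -> R) (f : T -> 'cV[R]_n) :
  measurable_fun setT a -> measurable_fun setT f ->
  measurable_fun setT (fun t => a t *: f t).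
Proof.
move=> ma mf; apply: measurable_fun_cVP => i.
rewrite (_ : _ \o _ = fun t => a t * f t i ord0); last first.
  by apply/funext => t; rewrite /coord_cV /= mxE.
by apply: measurable_funM => //; exact: measurable_fun_coord.
Qed.

Lemma measurable_fun_addcV (f g : T -> 'cV[R]_n) :
  measurable_fun setT f -> measurable_fun setT g ->
  measurable_fun setT (fun t => f t + g t).
Proof.
move=> mf mg; apply: measurable_fun_cVP => i.
rewrite (_ : _ \o _ = fun t => f t i ord0 + g t i ord0); last first.
  by apply/funext => t; rewrite /coord_cV /= mxE.
by apply: measurable_funD; exact: measurable_fun_coord.
Qed.

Lemma measurable_fun_oppcV (f : T -> 'cV[R]_n) :
  measurable_fun setT f -> measurable_fun setT (fun t => - f t).
Proof.
move=> mf; rewrite (_ : (fun t => - f t) = (fun t => (-1) *: f t)).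
  by apply: measurable_fun_scale.
by apply/funext => t; rewrite scaleN1r.
Qed.

Lemma measurable_fun_mulmx m (U : T -> 'M[R]_(m, n)) (f : T -> 'cV[R]_n) :
  (forall i j, measurable_fun setT (fun t => U t i j)) ->
  measurable_fun setT f -> measurable_fun setT (fun t => U t *m f t).
Proof.
move=> mU mf; apply: measurable_fun_cVP => i.
rewrite (_ : _ \o _ = fun t => \sum_j U t i j * f t j ord0); last first.
  by apply/funext => t; rewrite /coord_cV /= mxE.
apply: measurable_sum => j; apply: measurable_funM => //.
exact: measurable_fun_coord.
Qed.

Lemma measurable_mulmx m (A : 'M[R]_(m, n)) :
  measurable_fun setT (fun x : 'cV[R]_n => A *m x).
Proof.
apply: measurable_fun_cVP => i.
rewrite (_ : _ \o _ = fun t : 'cV[R]_n => \sum_j A i j * t j ord0); last first.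
  by apply/funext => t; rewrite /coord_cV /= mxE.
apply: measurable_sum => j; apply: measurable_funM => //.
exact: measurable_coord_cV.
Qed.

End measurability.

Section curried_fubini.
Local Open Scope ereal_scope.
Context d1 d2 (T1 : measurableType d1) (T2 : measurableType d2) (R : realType).
Context (m1 : {sigma_finite_measure set T1 -> \bar R})
  (m2 : {sigma_finite_measure set T2 -> \bar R}).
Variable f : T1 -> T2 -> \bar R.
Hypothesis mf : measurable_fun setT (fun p => f p.1 p.2).
Hypothesis f0 : forall x y, 0 <= f x y.

Lemma measurable_fun_integral2 : measurable_fun setT (fun x => \int[m2]_y f x y).
Proof.
exact: (measurable_fun_fubini_tonelli_F (m2 := m2) (fun p => f p.1 p.2) mf).
Qed.

Lemma exchange_integral : \int[m1]_x \int[m2]_y f x y = \int[m2]_y \int[m1]_x f x y.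
Proof.
exact: (fubini_tonelli (m1 := m1) (m2 := m2) (fun p => f p.1 p.2) mf).
Qed.

End curried_fubini.

(** * Invariance of Lebesgue measure under translations and orthogonal maps *)

Section lebesgue.
Context (R : realType).
Local Open Scope ereal_scope.

Lemma integral_shift (f : measurableTypeR R -> \bar R) a :
  measurable_fun setT f -> (forall x, 0 <= f x) ->
  \int[lebesgue_measure]_x f (x + a)%R = \int[@lebesgue_measure R]_x f x.
Proof.
move=> mf f0.
pose phi : measurableTypeR R -> measurableTypeR R := fun x => (x + a)%R.
have ms : measurable_fun setT phi by apply: measurable_funD.
have := @ge0_integral_measure_preserving _ _ _ _ R phi ms lebesgue_measure lebesgue_measure f; apply => // A mA.
pose ms_mixin := isMeasurableFun.Build _ _ _ _ _ ms.
pose ms_pack : {mfun _ >-> _} := HB.pack phi ms_mixin.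
apply/esym/(@lebesgue_measure_unique R (pushforward lebesgue_measure ms_pack)) => //= _ [[x y]] _ <-.
rewrite /pushforward.
have -> : phi @^-1` `]x, y]%classic =
    `](x - a)%R, (y - a)%R]%classic.
  by apply/seteqP; split => t /=; rewrite !in_itv/= ltrBlDr lerBrDr.
rewrite !lebesgue_measure_itv/= !lte_fin ltrD2; case: ifP => // _.
by rewrite -!EFinB opprB addrA addrNK.
Qed.

Lemma integral_lebesgue_cVS n (f : 'cV[R]_n.+1 -> \bar R) :
  measurable_fun setT f -> (forall x, 0 <= f x) ->
  \int[lebesgue_cV R n.+1]_x f x =
  \int[lebesgue_measure]_t \int[lebesgue_cV R n]_x f (cons_cV (t, x)).
Proof.
move=> mf f0 /=; rewrite /lebesgue_cV_succ.
rewrite (ge0_integral_pushforward (@measurable_cons_cV R n))//.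
rewrite preimage_setT (fubini_tonelli1 (f \o @cons_cV R n))//=.
exact: measurableT_comp mf (@measurable_cons_cV R n).
Qed.

Lemma cons_cVD n (s t : R) (x y : 'cV[R]_n) :
  (cons_cV (s, x) + cons_cV (t, y) = cons_cV ((s + t)%R, (x + y)%R))%R.
Proof.
apply/matrixP => i j; rewrite !mxE.
by case: (unlift ord0 i) => [k|] //=; rewrite mxE.
Qed.

Lemma cons_cV_eta n (x : 'cV[R]_n.+1) : cons_cV (x ord0 ord0, tail_cV x) = x.
Proof.
apply/matrixP => i j; rewrite !mxE.
by case: (unliftP ord0 i) => [k|] ->; rewrite (ord1 j) /= ?mxE.
Qed.

Lemma integral_lebesgue_cV_shift n (f : 'cV[R]_n -> \bar R) a :
  measurable_fun setT f -> (forall x, 0 <= f x) ->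
  \int[lebesgue_cV R n]_x f (x + a)%R = \int[lebesgue_cV R n]_x f x.
Proof.
elim: n f a => [|n ih] f a mf f0.
  by apply: eq_integral => x _; congr f; apply/matrixP => -[].
have mc : measurable_fun setT (f \o @cons_cV R n).
  exact: measurableT_comp mf (@measurable_cons_cV R n).
rewrite !integral_lebesgue_cVS//; last first.
  by apply: measurableT_comp => //; apply: measurable_fun_addcV.
transitivity (\int[@lebesgue_measure R]_t \int[lebesgue_cV R n]_x
   f (cons_cV ((t + a ord0 ord0)%R, x))).
  apply: eq_integral => t _.
  rewrite -(ih (fun x => f (cons_cV ((t + a ord0 ord0)%R, x))) (tail_cV a))//.
    by apply: eq_integral => x _; rewrite -cons_cVD cons_cV_eta.
  exact: (measurableT_comp mc (measurable_pair1 _)).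
rewrite (integral_shift (f := fun t => \int[lebesgue_cV R n]_x f (cons_cV (t, x))))//.
  apply: (@measurable_fun_integral2 _ _ _ _ _ _ (fun t x => f (cons_cV (t, x)))) => //.
by move=> t; apply: integral_ge0.
Qed.

Lemma dotp_cons n (s t : R) (x y : 'cV[R]_n) :
  dotp (cons_cV (s, x)) (cons_cV (t, y)) = (s * t + dotp x y)%R.
Proof.
rewrite /dotp big_ord_recl !mxE unlift_none; congr (_ + _)%R.
by apply: eq_bigr => i _; rewrite !mxE liftK.
Qed.

Lemma gauss_pdf_cons n (t : R) (x : 'cV[R]_n) :
  gauss_pdf (cons_cV (t, x)) = (normal_pdf 0 1 t * gauss_pdf x)%R.
Proof.
rewrite /gauss_pdf !enorm_sqr dotp_cons normal_pdfE ?oner_neq0//.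
rewrite /normal_peak /normal_fun subr0 expr1n mul1r.
have -> : ((n.+1%:R / 2 : R) = n%:R / 2 + 2^-1)%R by rewrite -natr1; field.
have tp : (0 < 2 * pi :> R)%R by rewrite mulr_gt0 ?pi_gt0.
rewrite powRD; last by rewrite gt_eqF ?implybT.
rewrite (powR12_sqrt (ltW tp)) invfM -(mulr_natl pi 2).
have -> : (- ((t * t + dotp x x) / 2) = - t ^+ 2 / 2 + - (dotp x x / 2))%R by field.
by rewrite expRD; ring.
Qed.

Lemma integral_gauss_pdf n : \int[lebesgue_cV R n]_x (gauss_pdf x)%:E = 1.
Proof.
elim: n => [|n ih].
  rewrite /= integral_dirac//=.
    rewrite diracT mul1e /gauss_pdf mul0r powRr0 invr1 mul1r.
    by rewrite enorm_sqr /dotp big_ord0 mul0r oppr0 expR0.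
  by apply/measurable_EFinP; exact: measurable_gauss_pdf.
rewrite integral_lebesgue_cVS; first last.
- by move=> x; rewrite lee_fin gauss_pdf_ge0.
- by apply/measurable_EFinP; exact: measurable_gauss_pdf.
rewrite -(@integral_normal_pdf R 0 1); apply: eq_integral => t _.
under eq_integral => x _ do rewrite gauss_pdf_cons EFinM.
rewrite ge0_integralZl ?ih ?mule1//.
- by apply/measurable_EFinP; exact: measurable_gauss_pdf.
- by move=> x _; rewrite lee_fin gauss_pdf_ge0.
- by rewrite lee_fin normal_pdf_ge0.
Qed.

(* Uniqueness of Haar measure: both integrals times [\int g] are compared
   through a double integral, [g] being the (radial) Gaussian density. *)
Lemma integral_lebesgue_cV_is_orth n (A : 'M[R]_n) (f : 'cV[R]_n -> \bar R) :
  is_orth A -> measurable_fun setT f -> (forall x, 0 <= f x) ->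
  \int[lebesgue_cV R n]_x f (A *m x)%R = \int[lebesgue_cV R n]_x f x.
Proof.
move=> oA mf f0; set L := lebesgue_cV R n.
pose g x : \bar R := (gauss_pdf (x : 'cV[R]_n))%:E.
have mg : measurable_fun setT g.
  by apply/measurable_EFinP; exact: measurable_gauss_pdf.
have g0 x : 0 <= g x by rewrite lee_fin gauss_pdf_ge0.
have G1 : \int[L]_x g x = 1 by exact: integral_gauss_pdf.
have gO x y : enorm x = enorm y -> g x = g y by rewrite /g /gauss_pdf => ->.
clearbody g.
have mA := measurable_mulmx A.
(* With [x] integrated first, the shift of [x] by [A^T y] frees [f] of [y]. With [y] integrated
   first, the shift of [y] by [- A x] leaves [g (y - A x)], equal to [g (A^T y - x)] because [g] is
   radial; its integral in [x] is again 1. *)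
transitivity (\int[L]_x \int[L]_y (f (A *m x + y)%R * g y)).
  transitivity (\int[L]_y \int[L]_x (f (A *m x + y)%R * g y)).
    transitivity (\int[L]_y (\int[L]_x f (A *m x)%R * g y)).
      rewrite ge0_integralZl ?G1 ?mule1//.
      by apply: integral_ge0.
    apply: eq_integral => y _; rewrite ge0_integralZr//.
    - congr (_ * _); rewrite -(@integral_lebesgue_cV_shift _ (fun x => f (A *m x)%R) (A^T *m y)%R)//.
        by apply: eq_integral => x _; rewrite mulmxDr mulmxA (mulmx1C oA) mul1mx.
      exact: (measurableT_comp mf).
    - apply: (measurableT_comp mf); apply: measurable_fun_addcV => //.
  apply: (@exchange_integral _ _ _ _ R L L (fun y x => f (A *m x + y)%R * g y)).
    apply: emeasurable_funM; last exact: measurableT_comp.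
    apply: (measurableT_comp mf); apply: measurable_fun_addcV => //.
    exact: (measurableT_comp mA).
  by move=> y x; rewrite mule_ge0.
transitivity (\int[L]_x \int[L]_y (f y * g (A^T *m y - x)%R)).
  apply: eq_integral => x _.
  rewrite -(integral_lebesgue_cV_shift (- (A *m x))%R).
  - apply: eq_integral => y _; congr (f _ * _); first by rewrite addrC subrK.
    apply: gO; rewrite -(enorm_is_orth _ (is_orth_tr oA)).
    by rewrite mulmxBr mulmxA oA mul1mx.
  - apply: emeasurable_funM => //; apply: (measurableT_comp mf).
    exact: measurable_fun_addcV.
  - by move=> y; rewrite mule_ge0.
rewrite [LHS](@exchange_integral _ _ _ _ R L L (fun x y => f y * g (A^T *m y - x)%R)); first last.
- by move=> x y; rewrite mule_ge0.
- apply: emeasurable_funM; first exact: measurableT_comp.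
  apply: (measurableT_comp mg); apply: measurable_fun_addcV.
    by apply: (measurableT_comp (measurable_mulmx _)).
  by apply: measurable_fun_oppcV.
apply: eq_integral => y _.
rewrite ge0_integralZl//.
- rewrite -[RHS]mule1; congr (_ * _); rewrite -G1.
  rewrite -[RHS](@integral_lebesgue_cV_shift n g (- (A^T *m y))%R mg g0).
  by apply: eq_integral => x _; apply: gO; rewrite -enormN opprB.
- apply: (measurableT_comp mg); apply: measurable_fun_addcV => //.
  by apply: measurable_fun_oppcV.
Qed.

End lebesgue.

(** * Gaussian moments and random orthogonal matrices *)

Section normal_variance.
Context (R : realType).
Local Notation p := (normal_pdf (0 : R) 1).
Let upper_arith (v x : R) : 0 < x -> x <= (v - 1) / 4 ->
  (2 + x) / 2 * v <= (1 + x) ^+ 2 -> False.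
Proof.
move=> x0 xv; rewrite leNgt => /negP; apply.
have H : (2 + x) * (1 + 4 * x) <= (2 + x) * v by rewrite ler_pM2l; lra.
by nra.
Qed.

Let lower_arith (v x : R) : 0 < x -> x <= 1 / 2 -> x <= (1 - v) / 4 ->
  (1 - x) ^+ 2 <= (2 - x) / 2 * v -> False.
Proof.
move=> x0 x1 xv; rewrite leNgt => /negP; apply.
have H : (2 - x) * v <= (2 - x) * (1 - 4 * x) by rewrite ler_pM2l; lra.
by nra.
Qed.

Let V := (\int[@lebesgue_measure R]_t (t ^+ 2 * p t)%:E)%E.

Let pE (s t : R) : 0 < s -> s * normal_pdf 0 s t = normal_peak 1 * expR (- t ^+ 2 / (s ^+ 2 *+ 2)) :> R.
Proof.
move=> s0; rewrite normal_pdfE ?gt_eqF// /normal_fun subr0 mulrA; congr (_ * _).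
rewrite /normal_peak expr1n mul1r -mulrnAr sqrtrM ?sqr_ge0// sqrtr_sqr gtr0_norm//.
by rewrite invfM mulrA divff ?mul1r// gt_eqF.
Qed.

Let p1E t : p t = normal_peak 1 * expR (- t ^+ 2 / 2) :> R.
Proof. by rewrite -[LHS]mul1r pE// expr1n. Qed.

(** The right-hand side is [p t] times [exp (- u)] with [u = (s^-2 - 1) / 2 * t^2], and
    [exp (- u) >= 1 - u]. As every normal density has integral 1, integrating bounds the variance
    without integration by parts. *)
Let pdf_tangent (s t : R) : 0 < s ->
  p t * (1 - (s ^- 2 - 1) / 2 * t ^+ 2) <= s * normal_pdf 0 s t.
Proof.
move=> s0; rewrite pE// p1E -(mulrA (normal_peak 1)) ler_wpM2l ?normal_peak_ge0//.
have -> : - t ^+ 2 / (s ^+ 2 *+ 2) = - t ^+ 2 / 2 + (- ((s ^- 2 - 1) / 2 * t ^+ 2)).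
  by field; rewrite gt_eqF.
by rewrite expRD ler_wpM2l ?expR_ge0// expR_ge1Dx.
Qed.

Let mpdf (s : R) : measurable_fun setT (fun t => (normal_pdf (0 : R) s t)%:E).
Proof. by apply/measurable_EFinP; exact: measurable_normal_pdf. Qed.

Let mV : measurable_fun setT (fun t : R => (t ^+ 2 * p t)%:E).
Proof.
apply/measurable_EFinP; apply: measurable_funM; first exact: measurable_funX.
exact: measurable_normal_pdf.
Qed.

Let V0 t : 0 <= t ^+ 2 * p t.
Proof. by rewrite mulr_ge0 ?sqr_ge0 ?normal_pdf_ge0. Qed.

Let p0 (s t : R) : (0 <= (normal_pdf 0 s t)%:E)%E.
Proof. by rewrite lee_fin normal_pdf_ge0. Qed.

Let V0E t : (0 <= (t ^+ 2 * p t)%:E)%E. Proof. by rewrite lee_fin. Qed.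

(** For finite [V] this says [V <= 2 s^2 / (s + 1)], which tends to 1 as [s] decreases to 1; [Vge]
    is the reverse bound for [s < 1]. The two cases are separate so that all coefficients are
    nonnegative before [V] is known to be finite. *)
Let Vle (s : R) : 1 < s -> ((1 + ((1 - s ^- 2) / 2)%:E * V) <= s%:E)%E.
Proof.
move=> s1; have s0 : 0 < s by apply: lt_trans s1.
have c0 : 0 <= (1 - s ^- 2) / 2.
  by rewrite divr_ge0// subr_ge0 invf_le1 ?exprn_gt0// exprn_ege1// ltW.
rewrite -{1}(@integral_normal_pdf R 0 1) -[X in (_ <= X)%E]mule1.
rewrite -(@integral_normal_pdf R 0 s) /V -!ge0_integralZl//; first last.
- by rewrite lee_fin ltW.
- exact: mpdf.
rewrite -ge0_integralD//; first last.
- by apply: measurable_funeM.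
- by move=> t _; apply: mule_ge0.
- exact: mpdf.
apply: ge0_le_integral => //.
- by move=> t _; apply: adde_ge0 => //; apply: mule_ge0.
- by apply: emeasurable_funD; [exact: mpdf|exact: measurable_funeM mV].
- by apply: measurable_funeM; exact: mpdf.
move=> t _; rewrite -!EFinM -EFinD lee_fin; apply: le_trans (pdf_tangent t s0).
by rewrite le_eqVlt; apply/orP; left; apply/eqP; ring.
Qed.

Let Vge (s : R) : 0 < s -> s < 1 -> (1 <= s%:E + ((s ^- 2 - 1) / 2)%:E * V)%E.
Proof.
move=> s0 s1.
have c0 : 0 <= (s ^- 2 - 1) / 2.
  by rewrite divr_ge0// subr_ge0 invf_ge1 ?exprn_gt0// exprn_ile1// ltW.
rewrite -{1}(@integral_normal_pdf R 0 1) -[X in (_ <= X + _)%E]mule1.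
rewrite -(@integral_normal_pdf R 0 s) /V -!ge0_integralZl//; first last.
- by rewrite lee_fin ltW.
- exact: mpdf.
rewrite -ge0_integralD//; first last.
- exact: measurable_funeM mV.
- by move=> t _; apply: mule_ge0.
- by apply: measurable_funeM; exact: mpdf.
- by move=> t _; apply: mule_ge0 => //; rewrite lee_fin ltW.
apply: ge0_le_integral => //.
- exact: mpdf.
- by apply: emeasurable_funD; apply: measurable_funeM; [exact: mpdf|exact: mV].
move=> t _; rewrite -!EFinM -EFinD lee_fin -lerBlDr; apply: le_trans (pdf_tangent t s0).
by rewrite le_eqVlt; apply/orP; left; apply/eqP; ring.
Qed.

Lemma integral_normal_variance :
  (\int[@lebesgue_measure R]_t (t ^+ 2 * normal_pdf 0 1 t)%:E = 1)%E.
Proof.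
rewrite -/V.
have V_ge0 : (0 <= V)%E by apply: integral_ge0 => t _; rewrite lee_fin.
case VE : V V_ge0 => [v| |] //; last first.
  have := @Vle 2; rewrite VE ltr1n => /(_ isT); rewrite gt0_muley// lte_fin.
  by rewrite divr_gt0// subr_gt0 invf_lt1 ?exprn_gt0// exprn_egt1// ltr1n.
rewrite lee_fin => v0; congr (_%:E); apply/eqP; rewrite eq_le; apply/andP; split.
  rewrite leNgt; apply/negP => v1.
  (* With [s = 1 + x] the bound becomes [(2 + x) / 2 * v <= (1 + x)^2], false as soon as
     [v >= 1 + 4 x]. *)
  pose x := Num.min 1 ((v - 1) / 4).
  have x0 : 0 < x by rewrite lt_min ltr01 divr_gt0 ?subr_gt0.
  have xv : x <= (v - 1) / 4 by rewrite ge_min lexx orbT.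
  have x1 : x <= 1 by rewrite ge_min lexx.
  have := @Vle (1 + x); rewrite VE ltrDl x0 => /(_ isT).
  rewrite -EFinM -EFinD lee_fin => H.
  have y0 : 0 < (1 + x) ^+ 2 by rewrite exprn_gt0// addr_gt0.
  have {H} : (1 + x) ^+ 2 * (1 + (1 - (1 + x) ^- 2) / 2 * v) <= (1 + x) ^+ 2 * (1 + x).
    by rewrite ler_pM2l.
  have -> : (1 + x) ^+ 2 * (1 + (1 - (1 + x) ^- 2) / 2 * v) =
     (1 + x) ^+ 2 + x * ((2 + x) / 2 * v) by field; rewrite gt_eqF// addr_gt0.
  rewrite [_ * (1 + x)]mulrDr mulr1 lerD2l (mulrC _ x) ler_pM2l// => H.
  exact: upper_arith x0 xv H.
rewrite leNgt; apply/negP => v1.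
(* Now [s = 1 - x]; the cap [1 / 2] keeps [s] positive. *)
pose x := Num.min (1 / 2) ((1 - v) / 4).
have x0 : 0 < x by rewrite lt_min divr_gt0// divr_gt0 ?subr_gt0.
have xv : x <= (1 - v) / 4 by rewrite ge_min lexx orbT.
have x1 : x <= 1 / 2 by rewrite ge_min lexx.
have z0 : 0 < 1 - x by lra.
have z1 : 1 - x < 1 by lra.
have := @Vge (1 - x) z0 z1; rewrite VE.
rewrite -EFinM -EFinD lee_fin => H.
have y0 : 0 < (1 - x) ^+ 2 by rewrite exprn_gt0.
have {H} : (1 - x) ^+ 2 * (1 - (1 - x)) <= (1 - x) ^+ 2 * (((1 - x) ^- 2 - 1) / 2 * v).
  by rewrite ler_pM2l// lerBlDl.
have -> : (1 - x) ^+ 2 * (((1 - x) ^- 2 - 1) / 2 * v) =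
     x * ((2 - x) / 2 * v) by field; rewrite gt_eqF.
rewrite (_ : 1 - (1 - x) = x); last by ring.
rewrite mulrC ler_pM2l// => H.
exact: lower_arith x0 x1 xv H.
Qed.

End normal_variance.

Section gauss.
Context (R : realType).
Local Open Scope ereal_scope.

Lemma gauss_measureT n : @gauss_measure R n setT = 1.
Proof. exact: integral_gauss_pdf. Qed.

HB.instance Definition _ n :=
  Measure_isProbability.Build _ _ _ (@gauss_measure R n) (gauss_measureT n).

Lemma ge0_integral_gaussE n (f : 'cV[R]_n -> \bar R) :
  measurable_fun setT f -> (forall x, 0 <= f x) ->
  \int[@gauss_measure R n]_x f x =
  \int[lebesgue_cV R n]_x (f x * (gauss_pdf x)%:E).
Proof.
apply: ge0_integral_density => //; first exact: measurable_gauss_pdf.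
exact: gauss_pdf_ge0.
Qed.

Lemma ge0_integral_gauss_orth n (A : 'M[R]_n) (f : 'cV[R]_n -> \bar R) :
  is_orth A -> measurable_fun setT f -> (forall x, 0 <= f x) ->
  \int[@gauss_measure R n]_x f (A *m x)%R = \int[@gauss_measure R n]_x f x.
Proof.
move=> oA mf f0.
have mfA : measurable_fun setT (fun x : 'cV[R]_n => f (A *m x)%R).
  exact: (measurableT_comp mf (measurable_mulmx A)).
rewrite (ge0_integral_gaussE mf f0) (ge0_integral_gaussE mfA (fun x => f0 _)).
have mfp : measurable_fun setT (fun x : 'cV[R]_n => f x * (gauss_pdf x)%:E).
  apply: emeasurable_funM => //; apply/measurable_EFinP.
  exact: measurable_gauss_pdf.
have fp0 x : 0 <= f x * (gauss_pdf x)%:E.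
  by rewrite mule_ge0// lee_fin gauss_pdf_ge0.
rewrite -(integral_lebesgue_cV_is_orth oA mfp fp0).
by apply: eq_integral => x _; rewrite /gauss_pdf enorm_is_orth.
Qed.

Lemma gauss_second_moment n :
  \int[@gauss_measure R n]_x (enorm x ^+ 2)%:E = n%:R%:E.
Proof.
have msq m : measurable_fun setT (fun x : 'cV[R]_m => (enorm x ^+ 2)%:E).
  by apply/measurable_EFinP; apply: measurable_funX; exact: measurable_fun_enorm.
have mp m : measurable_fun setT (fun x : 'cV[R]_m => (gauss_pdf x)%:E).
  by apply/measurable_EFinP; exact: measurable_gauss_pdf.
have sq0 m (x : 'cV[R]_m) : 0 <= (enorm x ^+ 2)%:E by rewrite lee_fin sqr_ge0.
have p0 m (x : 'cV[R]_m) : 0 <= (gauss_pdf x)%:E by rewrite lee_fin gauss_pdf_ge0.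
rewrite ge0_integral_gaussE//.
elim: n => [|n ih].
  rewrite integral0_eq// => x _.
  by rewrite enorm_sqr /dotp big_ord0 mul0e.
rewrite integral_lebesgue_cVS; first last.
- by move=> x; rewrite mule_ge0.
- exact: emeasurable_funM (msq _) (mp _).
rewrite -natr1 EFinD addeC -(@integral_normal_variance R).
rewrite -[X in _ = _ + X]mule1 -(@integral_normal_pdf R 0 1).
have mn : measurable_fun setT (fun t : R => (normal_pdf 0 1 t)%:E).
  by apply/measurable_EFinP; exact: measurable_normal_pdf.
rewrite -ge0_integralZl//; last by move=> t _; rewrite lee_fin normal_pdf_ge0.
rewrite -ge0_integralD//; first last.
- exact: measurable_funeM.
- by move=> t _; rewrite mule_ge0// lee_fin normal_pdf_ge0.
- by apply/measurable_EFinP; apply: measurable_funM => //; exact: measurable_normal_pdf.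
- by move=> t _; rewrite lee_fin mulr_ge0 ?sqr_ge0 ?normal_pdf_ge0.
apply: eq_integral => t _.
transitivity (\int[lebesgue_cV R n]_x ((t ^+ 2 * normal_pdf 0 1 t)%:E * (gauss_pdf x)%:E +
   (normal_pdf 0 1 t)%:E * ((enorm x ^+ 2)%:E * (gauss_pdf x)%:E))).
  apply: eq_integral => x _; rewrite gauss_pdf_cons !enorm_sqr dotp_cons.
  by rewrite -!EFinM -EFinD; congr (_%:E); ring.
have tp0 : 0 <= (t ^+ 2 * normal_pdf 0 1 t)%:E.
  by rewrite lee_fin mulr_ge0 ?sqr_ge0 ?normal_pdf_ge0.
have mM : measurable_fun setT (fun x : 'cV[R]_n => (enorm x ^+ 2)%:E * (gauss_pdf x)%:E).
  exact: emeasurable_funM (msq _) (mp _).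
have np0 : 0 <= (normal_pdf 0 1 t)%:E :> \bar R by rewrite lee_fin normal_pdf_ge0.
rewrite ge0_integralD//.
- rewrite !ge0_integralZl//.
  + by rewrite ih integral_gauss_pdf mule1 muleC.
  + by move=> x _; apply: mule_ge0.
  + exact: mp.
- by move=> x _; apply: mule_ge0.
- exact: measurable_funeM (mp _).
- by move=> x _; apply: mule_ge0 => //; exact: mule_ge0.
- exact: measurable_funeM.
Qed.

Lemma measurable_cV0 n : measurable [set (0%R : 'cV[R]_n)].
Proof.
rewrite (_ : [set _] = (@enorm R n) @^-1` [set 0%R]).
  by rewrite -[X in measurable X]setTI; apply: measurable_fun_enorm.
apply/seteqP; split => x /=; first by move=> ->; exact: enorm0.
by move=> /eqP; rewrite enorm_eq0 => /eqP.
Qed.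

(** The origin is a degenerate box. In dimension 0 it carries all the mass, hence [n.+1]. *)
Lemma gauss_measure_pt0 n : @gauss_measure R n.+1 [set 0%R] = 0.
Proof.
have m0 := @measurable_cV0 n.+1.
rewrite /gauss_measure null_set_integral//.
  by apply: measurable_funTS; apply/measurable_EFinP; exact: measurable_gauss_pdf.
rewrite (_ : [set _] = [set x : 'cV[R]_n.+1 | forall i, x i ord0 \in `[0%R, 0%R]]); last first.
  apply/seteqP; split => x /= => [-> i|x0]; first by rewrite mxE in_itv/= lexx.
  apply/matrixP => i j; rewrite ord1 mxE; have := x0 i.
  by rewrite in_itv/= => H; apply/eqP; rewrite eq_le andbC.
have H := @lebesgue_cV_box R n.+1 (fun=> 0%R) (fun=> 0%R) (fun=> lexx _).
by rewrite big_ord_recl subrr mul0r in H; exact: H.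
Qed.

End gauss.

Section product_probability.
Local Open Scope ereal_scope.
Context d1 d2 (T1 : measurableType d1) (T2 : measurableType d2) (R : realType).
Context (P1 : probability T1 R) (P2 : probability T2 R).

(** A name on which the probability structure can be declared; [haar_exists] builds its sample space
    from such products. *)
Definition prod_prob := P1 \x P2.

HB.instance Definition _ := Measure.on prod_prob.

Let prod_probT : prod_prob setT = 1.
Proof.
rewrite -setXTT /prod_prob product_measure1E//.
by rewrite -[RHS]mule1; congr (_ * _); exact: probability_setT.
Qed.

HB.instance Definition _ := Measure_isProbability.Build _ _ _ prod_prob prod_probT.

End product_probability.

Section haar.
Context (R : realType).

Lemma measurable_householder n d (T : measurableType d) (w : T -> 'cV[R]_n) i j :
  measurable_fun setT w ->
  measurable_fun setT (fun t => householder (w t) i j).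
Proof.
move=> mw.
(* The inverse is written as a real power, which is measurable and also takes the value 0 at 0. *)
rewrite (_ : (fun t => _) = (fun t => (1%:M : 'M[R]_n) i j -
   2 * powR (dotp (w t) (w t)) (- 1) * (w t i ord0 * w t j ord0))); last first.
  apply/funext => t; rewrite /householder !mxE big_ord1 !mxE.
  by rewrite powR_inv1 ?dotp_ge0.
apply: measurable_funB => //; apply: measurable_funM.
  apply: measurable_funM => //; apply: (measurableT_comp (measurable_powR _)).
  exact: measurable_fun_dotp.
by apply: measurable_funM; apply: measurable_fun_coord.
Qed.

Definition diag1 n (U : 'M[R]_n) : 'M[R]_n.+1 := block_mx (1%:M : 'M[R]_1) 0 0 U.

Lemma cons_cVE n (a : R) (x : 'cV[R]_n) :
  cons_cV (a, x) = col_mx (a%:M : 'M[R]_1) x :> 'M[R]_(1 + n, 1).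
Proof.
apply/matrixP => i j; rewrite [j]ord1 [RHS]mxE mxE.
case: (unliftP ord0 i) => [k ->|->].
  rewrite (_ : lift ord0 k = rshift 1 k); last exact/val_inj.
  by rewrite (unsplitK (inr k)).
rewrite (_ : ord0 = lshift n (ord0 : 'I_1)); last exact/val_inj.
by rewrite (unsplitK (inl _)) mxE eqxx.
Qed.

Lemma diag1_mul n (U : 'M[R]_n) a x :
  diag1 U *m cons_cV (a, x) = cons_cV (a, U *m x).
Proof. by rewrite !cons_cVE /diag1 (@mul_block_col _ 1 n 1 n 1) !mul0mx mul1mx addr0 add0r. Qed.

Lemma diag1_is_orth n (U : 'M[R]_n) : is_orth U -> is_orth (diag1 U).
Proof.
rewrite /is_orth /diag1 => oU; rewrite (@tr_block_mx _ 1 n 1 n) (@mulmx_block _ 1 n 1 n 1 n).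
by rewrite !trmx0 !trmx1 !mul0mx !mulmx0 mulmx1 oU !addr0 add0r -scalar_mx_block.
Qed.

Lemma measurable_diag1 n d (T : measurableType d) (U : T -> 'M[R]_n) i j :
  (forall i j, measurable_fun setT (fun t => U t i j)) ->
  measurable_fun setT (fun t => diag1 (U t) i j).
Proof.
move=> mU.
pose s (k : 'I_(1 + n)) := fintype.split k.
have E t : diag1 (U t) i j =
    match s i, s j with inl _, inl _ => 1 | inr k, inr l => U t k l | _, _ => 0 end.
  rewrite /diag1 /block_mx !mxE -/(s i); case: (s i) => k; rewrite mxE -/(s j);
    by case: (s j) => l; rewrite ?mxE// !ord1 eqxx.
under eq_fun do rewrite E.
by case: (s i) => k; case: (s j) => l; first [exact: mU | exact: measurable_cst].
Qed.

Local Open Scope ereal_scope.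

(* A random orthogonal matrix, built as a product of random Householder
   reflections, that spreads every vector uniformly over its sphere. *)
Lemma haar_exists n : exists d (T : measurableType d)
    (P : probability T R) (U : T -> 'M[R]_n),
  [/\ forall i j, measurable_fun setT (fun t => U t i j),
    forall t, is_orth (U t) &
    forall (f : 'cV[R]_n -> \bar R) (x y : 'cV[R]_n),
      measurable_fun setT f -> (forall z, 0 <= f z) -> enorm x = enorm y ->
      \int[P]_t f (U t *m x)%R = \int[P]_t f (U t *m y)%R].
Proof.
elim: n => [|n [d [T [P [U [mU oU ihU]]]]]].
  exists _, unit, (dirac tt), (fun=> 1%:M); split => //.
  - by move=> t; exact: is_orth1.
  - by move=> f x y _ _ _; congr (integral _ _ _); apply/funext => t; congr f; apply/matrixP => -[].
pose G : probability 'cV[R]_n.+1 R := @gauss_measure R n.+1.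
pose e1 : 'cV[R]_n.+1 := delta_mx ord0 ord0.
have e1E x : dotp e1 x = x ord0 ord0.
  rewrite /dotp (bigD1 ord0)//= big1 ?mxE ?eqxx ?mul1r ?addr0// => i i0.
  by rewrite mxE (negbTE i0) mul0r.
have e11 : enorm e1 = 1%R by rewrite /enorm e1E mxE eqxx sqrtr1.
pose H (z : 'cV[R]_n.+1) := householder (z - enorm z *: e1)%R.
have Hz z : (H z *m z = enorm z *: e1)%R.
  by apply: householder_swap; rewrite enormZ e11 mulr1 ger0_norm ?enorm_ge0.
have oH z : is_orth (H z) by exact: householder_is_orth.
have mH i j : measurable_fun setT (fun z => H z i j).
  apply: measurable_householder; apply: measurable_fun_addcV => //.
  by apply: measurable_fun_oppcV; apply: measurable_fun_scale => //; exact: measurable_fun_enorm.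
have H0 z x : (enorm z * (H z *m x) ord0 ord0 = dotp z x)%R.
  by rewrite -e1E -dotpZl -Hz dotp_is_orth.
pose U' (p : 'cV[R]_n.+1 * T) := (diag1 (U p.2) *m H p.1)%R.
have mU' i j : measurable_fun setT (fun p => U' p i j).
  rewrite /U'; under eq_fun do rewrite mxE.
  apply: measurable_sum => k; apply: measurable_funM.
    apply: (@measurable_diag1 _ _ _ (fun p : 'cV[R]_n.+1 * T => U p.2)) => i' j'.
    exact: (measurableT_comp (mU i' j')).
  exact: (measurableT_comp (mH k j)).
exists _, _, (prod_prob G P), U'; split => //.
- by move=> p; apply: is_orthM => //; exact: diag1_is_orth.
move=> f x y mf f0 xy.
have mfU (z : 'cV[R]_n.+1) : measurable_fun setT (fun p => f (U' p *m z)%R).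
  by apply: (measurableT_comp mf); exact: measurable_fun_mulmx.
have fubE z : \int[G \x P]_p f (U' p *m z)%R = \int[G]_w \int[P]_t f (U' (w, t) *m z)%R.
  by rewrite (fubini_tonelli1 (fun p => f (U' p *m z)%R)).
rewrite !fubE.
pose M w z := \int[P]_t f (U' (w, t) *m z)%R.
have mM z : measurable_fun setT (M ^~ z).
  apply: (@measurable_fun_integral2 _ _ _ _ _ P (fun w t => f (U' (w, t) *m z)%R)) => //.
have M0 w z : 0 <= M w z by apply: integral_ge0.
pose A := householder (x - y)%R.
have oA : is_orth A by exact: householder_is_orth.
have Ax : (A *m x)%R = y by exact: householder_swap.
(* The Gaussian variable absorbs the reflection [A] that maps [x] to [y]. It remains to compare the
   pairs [(w, x)] and [(A w, y)], which have the same inner product. *)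
transitivity (\int[G]_w M (A *m w)%R y); last exact: (ge0_integral_gauss_orth oA (mM y) (fun w => M0 w y)).
have mMA : measurable_fun setT (fun w => M (A *m w)%R y).
  exact: (measurableT_comp (mM y) (measurable_mulmx A)).
apply: (ge0_ae_eq_integral measurableT (mM x) mMA (fun w _ => M0 w x) (fun w _ => M0 _ y)).
exists [set 0%R]; split.
- exact: measurable_cV0.
- exact: gauss_measure_pt0.
move=> w; apply: contra_notP => /eqP w0 _.
have ew : enorm w != 0%R by rewrite enorm_eq0.
(* By [H0] this coordinate is the inner product divided by [|w|]. With equal first coordinates and
   equal norms, the tails have equal norms too, and the induction hypothesis applies to them. *)
have hd : (H w *m x)%R ord0 ord0 = (H (A *m w) *m y)%R ord0 ord0.
  apply: (mulfI ew); rewrite H0 -[in RHS](enorm_is_orth w oA) H0.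
  by rewrite -Ax dotp_is_orth.
have UE p z : (U' p *m z)%R = cons_cV ((H p.1 *m z)%R ord0 ord0, (U p.2 *m tail_cV (H p.1 *m z))%R).
  by rewrite -mulmxA -{1}(cons_cV_eta (H p.1 *m z)%R) diag1_mul.
rewrite /M; under eq_integral => t _ do rewrite UE /= hd.
under [RHS]eq_integral => t _ do rewrite UE /=.
set a := (_ ord0 ord0).
apply: (ihU (fun v => f (cons_cV (a, v)))).
- exact: (measurableT_comp (measurableT_comp mf (@measurable_cons_cV R n)) (measurable_pair1 _)).
- by [].
apply/enorm_dotp.
have tl z : dotp (tail_cV z) (tail_cV z) = (dotp z z - z ord0 ord0 ^+ 2)%R.
  by rewrite -[in RHS](cons_cV_eta z) dotp_cons !mxE unlift_none expr2 addrAC subrr add0r.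
rewrite !tl hd !dotp_is_orth//; congr (_ - _)%R.
exact/enorm_dotp.
Qed.

End haar.

(** * Convex functions and the Legendre transform *)

Section convex.
Context (R : realType) (n : nat).
Implicit Types (phi : 'cV[R]_n -> \bar R) (x y z p s : 'cV[R]_n).

Lemma Cvx_fin_le phi z M : Cvx phi -> (phi z <= M%:E)%E ->
  exists2 c, phi z = c%:E & c <= M.
Proof.
by move=> [/(_ z)]; case: (phi z) => [c|//|//] _ _ _ _; rewrite lee_fin => cM; exists c.
Qed.

Lemma Cvx_fin_comb phi x y a b t : Cvx phi -> phi x = a%:E -> phi y = b%:E ->
  0 < t -> t < 1 ->
  exists2 c, phi (t *: x + (1 - t) *: y) = c%:E & c <= t * a + (1 - t) * b.
Proof.
move=> Cphi xa yb t0 t1; apply: Cvx_fin_le => //; case: Cphi => _ _ _ cphi.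
by have := cphi x y t; rewrite t0 t1 xa yb => /(_ isT).
Qed.

Lemma Cvx_nbhs phi x a : Cvx phi -> (a%:E < phi x)%E ->
  exists2 d, 0 < d & forall y, enorm (y - x) < d -> (a%:E < phi y)%E.
Proof.
by move=> [_ _ lphi _] /lphi[V /nbhs_enormP[d d0 dV] aV]; exists d => // y /dV/aV.
Qed.

Lemma Cvx_finite_pt phi : Cvx phi -> exists x r, phi x = r%:E.
Proof.
move=> [phiNy [x xy] _ _]; exists x; have := phiNy x.
by case: (phi x) xy => // r _ _; exists r.
Qed.

Lemma legendre_ge phi x y : ((dotp x y)%:E - phi y <= legendre phi x)%E.
Proof. by apply: ereal_sup_ubound; exists y. Qed.

Lemma legendre_le phi x M :
  (forall y, ((dotp x y)%:E - phi y <= M)%E) -> (legendre phi x <= M)%E.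
Proof. by move=> H; apply: ge_ereal_sup => _ [y _ <-]. Qed.

Lemma dotp_norm x y : `|dotp x y| <= enorm x * enorm y.
Proof.
by rewrite ler_norml cauchy_schwarz andbT lerNl -dotpNl -(enormN x) cauchy_schwarz.
Qed.

Lemma legendre_Cvx phi : (forall x, phi x != -oo%E) ->
  (exists x r, phi x = r%:E) ->
  (exists x r, (legendre phi x <= r%:E)%E) -> Cvx (legendre phi).
Proof.
move=> phiNy [y0 [r0 yr0]] [x1 [r1 xr1]]; split.
- move=> x; rewrite gt_eqF//; apply: lt_le_trans (legendre_ge phi x y0).
  by rewrite yr0 -EFinB ltNyr.
- by exists x1; rewrite lt_eqF//; apply: le_lt_trans xr1 (ltry _).
- move=> x a /ereal_sup_gt[_ [y _ <-]].
  have := phiNy y; case phiy : (phi y) => [r| |] // _; rewrite -EFinB lte_fin => ar.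
  pose e := dotp x y - r - a; have e0 : 0 < e by rewrite subr_gt0.
  have Y0 : 0 < enorm y + 1 by rewrite ltr_wpDl ?enorm_ge0.
  exists [set x' | enorm (x' - x) < e / (enorm y + 1)].
    by apply/nbhs_enormP; exists (e / (enorm y + 1)) => //; rewrite divr_gt0.
  move=> x' /= xx'; apply: lt_le_trans (legendre_ge phi x' y).
  rewrite phiy -EFinB lte_fin.
  have -> : dotp x' y = dotp x y + dotp (x' - x) y.
    by rewrite dotpDl dotpNl addrC subrK.
  have : `|dotp (x' - x) y| < e.
    apply: le_lt_trans (dotp_norm _ _) _.
    apply: (@le_lt_trans _ _ (enorm (x' - x) * (enorm y + 1))).
      by rewrite ler_wpM2l ?enorm_ge0// lerDl.
    by rewrite -ltr_pdivlMr.
  by rewrite ltr_norml /e => /andP[? ?]; lra.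
- move=> x y t /andP[t0 t1]; apply: legendre_le => z.
  have := phiNy z; case phiz : (phi z) => [r| |] // _; last by rewrite leNye.
  have -> : ((dotp (t *: x + (1 - t) *: y) z)%:E - r%:E =
     t%:E * ((dotp x z)%:E - r%:E) + (1 - t)%:E * ((dotp y z)%:E - r%:E))%E.
    by rewrite -!EFinB -!EFinM -EFinD !dotp_lin; congr (_%:E); ring.
  rewrite -phiz; apply: leeD; apply: lee_wpmul2l; rewrite ?lee_fin ?subr_ge0 ?(ltW t0) ?(ltW t1)//;
    exact: legendre_ge.
Qed.

Lemma parallelogram x y :
  dotp (2^-1 *: x + (1 - 2^-1) *: y) (2^-1 *: x + (1 - 2^-1) *: y) =
  (dotp x x + dotp y y) / 2 - dotp (x - y) (x - y) / 4.
Proof. by rewrite !dotp_lin (dotpC y x); field. Qed.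

(* A minimising sequence is Cauchy by the parallelogram identity. *)
Lemma prox_exists phi x0 (c N : R) : Cvx phi -> (forall x, (c%:E <= phi x)%E) -> 0 < N ->
  exists p r, phi p = r%:E /\
    forall y q, phi y = q%:E ->
      r + N * dotp (p - x0) (p - x0) <= q + N * dotp (y - x0) (y - x0).
Proof.
move=> Cphi phic N0.
pose S := [set v | exists y q, phi y = q%:E /\ v = q + N * dotp (y - x0) (y - x0)].
have Slb : has_lbound S.
  exists c => _ [y [q [yq ->]]]; have := phic y; rewrite yq lee_fin => cq.
  by rewrite ler_wpDr// mulr_ge0 ?dotp_ge0// ltW.
have S0 : S !=set0.
  by have [y [q yq]] := Cvx_finite_pt Cphi; eexists; exists y, q; split.
pose m := inf S.
have mle y q : phi y = q%:E -> m <= q + N * dotp (y - x0) (y - x0).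
  by move=> yq; apply: ge_inf => //; exists y, q.
have /choice[u uP] : forall k : nat, exists y, exists2 q, phi y = q%:E &
    q + N * dotp (y - x0) (y - x0) < m + k.+1%:R^-1.
  move=> k; have k0 : 0 < k.+1%:R^-1 :> R by [].
  have [_ [y [q [yq ->]]] lt] := inf_adherent k0 (conj S0 Slb).
  by exists y, q.
have udist j k : N / 4 * dotp (u j - u k) (u j - u k) <= (j.+1%:R^-1 + k.+1%:R^-1) / 2.
  have [qj uj ltj] := uP j; have [qk uk ltk] := uP k.
  have h2 : (0 < 2^-1 :> R) by rewrite invr_gt0.
  have h3 : (2^-1 < 1 :> R) by rewrite invf_lt1// ltr1n.
  have [cc zE cle] := Cvx_fin_comb Cphi uj uk h2 h3.
  have := mle _ _ zE.
  have -> : 2^-1 *: u j + (1 - 2^-1) *: u k - x0 =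
      2^-1 *: (u j - x0) + (1 - 2^-1) *: (u k - x0).
    by apply/matrixP => a b; rewrite !mxE; field.
  rewrite parallelogram (_ : u j - x0 - (u k - x0) = u j - u k); last first.
    by rewrite opprB addrA subrK.
  move: ltj ltk cle; set dj := dotp (u j - x0) _; set dk := dotp (u k - x0) _.
  set D := dotp (u j - u k) _; set ij := j.+1%:R^-1; set ik := k.+1%:R^-1 => *.
  nra.
have near_inv (e : R) : 0 < e -> \forall k \near \oo, k.+1%:R^-1 < e.
  by move=> e0; near=> k; near: k; exact: near_infty_natSinv_lt (PosNum e0).
have ucvg : cvg (u @ \oo).
  apply/cauchy_cvgP/cauchy_ballP => e e0.
  have e1 : 0 < N / 4 * (e * e) by rewrite !mulr_gt0// invr_gt0.
  have [K _ KP] := near_inv _ e1.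
  have nearU : \forall x \near u @ \oo, exists2 j, (K <= j)%N & x = u j.
    by exists K => // j Kj; exists j.
  near=> x y.
  have [j Kj ->] : exists2 j, (K <= j)%N & x = u j by near: x.
  have [k Kk ->] : exists2 j, (K <= j)%N & y = u j by near: y.
  split => // a b; rewrite ord1 /ball/=.
  have -> : u j a 0 - u k a 0 = (u j - u k) a ord0 by rewrite !mxE.
  apply: le_lt_trans (coord_le_enorm _ a) _.
  rewrite -(@ltr_pXn2r _ 2)// ?nnegrE ?enorm_ge0 ?ltW// enorm_sqr expr2.
  have N4 : 0 < N / 4 by rewrite divr_gt0.
  rewrite -(ltr_pM2l N4); apply: le_lt_trans (udist j k) _.
  move: (KP _ Kj) (KP _ Kk) => /=.
  by move: (j.+1%:R^-1) (k.+1%:R^-1) (N / 4 * (e * e)) => a' b' c'; lra.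
pose p := lim (u @ \oo).
have up : forall d, 0 < d -> \forall k \near \oo, enorm (u k - p) < d.
  exact/cvg_enormP.
pose v := m - N * dotp (p - x0) (p - x0).
have phip : (phi p <= v%:E)%E.
  rewrite leNgt; apply/negP => vp.
  have [a [va ap]] : exists a, v < a /\ (a%:E < phi p)%E.
    move: vp; case: (phi p) => [b|_|//].
      by rewrite lte_fin => vb; exists ((v + b) / 2); rewrite lte_fin; split; lra.
    by exists (v + 1); rewrite ltry; split => //; lra.
  have [d d0 dphi] := Cvx_nbhs Cphi ap.
  have e0 : 0 < (a - v) / 2 by lra.
  (* Moving from [p] to [u k] lowers the penalty [N |. - x0|^2] by at most [2 N |u k - p| |p - x0|].
     A distance below [(a - v) / 2 / B] makes this less than [(a - v) / 2], and the near-minimality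
     error takes less than the other half. *)
  pose B := N * (2 * enorm (p - x0)) + 1.
  have B0 : 0 < B.
    by rewrite ltr_wpDl// !mulr_ge0 ?enorm_ge0// ltW.
  have : \forall k \near \oo, False; last by case=> k _ /(_ k (leqnn _)).
  near=> k.
  have [q uq ltq] := uP k.
  have : (a%:E < phi (u k))%E by apply: dphi; near: k; exact: up.
  rewrite uq lte_fin => aq.
  have k1 : k.+1%:R^-1 < (a - v) / 2 by near: k; exact: near_inv.
  have uk : enorm (u k - p) < (a - v) / 2 / B.
    by near: k; apply: up; rewrite divr_gt0.
  move: uk; rewrite ltr_pdivlMr// => uk.
  have dE : dotp (u k - x0) (u k - x0) = dotp (p - x0) (p - x0)
      + 2 * dotp (u k - p) (p - x0) + dotp (u k - p) (u k - p).
    have -> : u k - x0 = (u k - p) + (p - x0) by rewrite addrA subrK.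
    move: (u k - p) (p - x0) => a' b'.
    by rewrite !dotp_lin (dotpC b' a'); ring.
  have := dotp_norm (u k - p) (p - x0).
  rewrite ler_norml => /andP[cs _].
  have dd := dotp_ge0 (u k - p).
  move: ltq; rewrite dE => ltq; move: uk cs dd ltq k1 aq; rewrite /B /v.
  have := enorm_ge0 (u k - p); have := enorm_ge0 (p - x0).
  set E := enorm (u k - p); set F := enorm (p - x0).
  set dp := dotp (u k - p) (p - x0); set D := dotp (p - x0) _; set G := dotp (u k - p) _.
  set i := k.+1%:R^-1 => F0 E0 uk cs G0 ltq k1 aq.
  have h1 : 0 <= N * (dp + E * F) by rewrite mulr_ge0 ?(ltW N0)//; lra.
  have h2 : 0 <= N * G by rewrite mulr_ge0 ?(ltW N0).
  nra.
have [r pr rv] := Cvx_fin_le Cphi phip.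
exists p, r; split => // y q yq; apply: le_trans (mle _ _ yq).
by move: rv; rewrite /v => rv; lra.
Unshelve. all: by end_near. Qed.

(** At a minimiser [p] of [phi + N |. - x0|^2] the vector [2 N (x0 - p)] is a subgradient of [phi],
    and a large [N] forces the tangent value at [x0] up to [a]. This plays the part of a separation
    theorem. *)
Lemma affine_minorant phi x0 (c a : R) : Cvx phi -> (forall x, (c%:E <= phi x)%E) ->
  (a%:E < phi x0)%E ->
  exists s b, (forall y, ((dotp s y + b)%:E <= phi y)%E) /\ a <= dotp s x0 + b.
Proof.
move=> Cphi phic ax0; have [d d0 dphi] := Cvx_nbhs Cphi ax0.
(* Either [p] is within [d] of [x0], where [phi > a], or the penalty is at least [N d^2 >= a - c],
   which compensates for the lower bound [c]. *)
pose N := `|a - c| / (d * d) + 1.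
have N0 : 0 < N by rewrite ltr_wpDl// divr_ge0// mulr_ge0// ltW.
have [p [r [pr pmin]]] := prox_exists x0 Cphi phic N0.
pose s := (2 * N) *: (x0 - p).
exists s, (r - dotp s p); split; last first.
  have -> : dotp s x0 + (r - dotp s p) = r + 2 * N * dotp (p - x0) (p - x0).
    by rewrite /s !dotp_lin (dotpC p x0); ring.
  have [pd|dp] := ltP (enorm (p - x0)) d.
    have := dphi _ pd; rewrite pr lte_fin => ar.
    by have := dotp_ge0 (p - x0) => D0; rewrite (le_trans (ltW ar))// lerDl !mulr_ge0// ltW.
  have := phic p; rewrite pr lee_fin => cr.
  have dd : d * d <= dotp (p - x0) (p - x0).
    by rewrite -enorm_sqr expr2 ler_pM// ltW.
  have Nd : a - c <= N * (d * d).
    rewrite /N mulrDl divfK ?gt_eqF ?mulr_gt0//.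
    have := ler_norm (a - c); have : 0 < d * d by rewrite mulr_gt0.
    by lra.
  have : N * (d * d) <= N * dotp (p - x0) (p - x0) by rewrite ler_pM2l.
  have : 0 <= N * dotp (p - x0) (p - x0) by rewrite mulr_ge0 ?dotp_ge0// ltW.
  lra.
move=> y; have [phiNy _ _ _] := Cphi; have := phiNy y.
case yq : (phi y) => [q| |] // _; last by rewrite leey.
rewrite lee_fin; pose D := dotp (y - p) (y - p).
(* Minimality is tested at [t y + (1 - t) p] and divided by [t]; the error [N t D] vanishes with
   [t]. *)
suff H t : 0 < t -> t < 1 -> dotp s y + (r - dotp s p) <= q + N * t * D.
  rewrite leNgt; apply/negP => Hq.
  pose g := dotp s y + (r - dotp s p) - q; have g0 : 0 < g by rewrite subr_gt0.
  have ND0 : 0 <= N * D by rewrite mulr_ge0 ?dotp_ge0// ltW.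
  pose t := Num.min (1 / 2) (g / (2 * (N * D + 1))).
  have t0 : 0 < t by rewrite lt_min divr_gt0//= divr_gt0//; lra.
  have t1 : t < 1 by rewrite gt_min; apply/orP; left; lra.
  have tg : t <= g / (2 * (N * D + 1)) by rewrite ge_min lexx orbT.
  have := H t t0 t1; move: tg; rewrite ler_pdivlMr; last by lra.
  move=> tg Ht; have : g <= t * (N * D) by rewrite /g; lra.
  have := mulr_ge0 (ltW t0) ND0; clear -t0 tg; lra.
move=> t0 t1; have [cc zE cle] := Cvx_fin_comb Cphi yq pr t0 t1.
have := pmin _ _ zE.
have -> : t *: y + (1 - t) *: p - x0 = (p - x0) + t *: (y - p).
  by apply/matrixP => i j; rewrite !mxE; ring.
have -> : dotp s y + (r - dotp s p) = r - 2 * N * dotp (p - x0) (y - p).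
  by rewrite /s !dotp_lin; ring.
have -> : dotp (p - x0 + t *: (y - p)) (p - x0 + t *: (y - p)) =
  dotp (p - x0) (p - x0) + 2 * t * dotp (p - x0) (y - p) + t ^+ 2 * D.
  rewrite /D; move: (p - x0) (y - p) => a' b'.
  by rewrite !dotp_lin (dotpC b' a'); ring.
set P := dotp (p - x0) (p - x0); set Q := dotp (p - x0) (y - p) => H.
rewrite -(ler_pM2l t0); nra.
Qed.

(** Fenchel-Moreau for functions bounded below. If the biconjugate were smaller at [x], an affine
    minorant of [phi] would exceed it at [x]; its slope [s] then gives a term of the outer supremum
    that is too large. *)
Lemma biconjugate phi (c : R) : Cvx phi -> (forall x, (c%:E <= phi x)%E) ->
  legendre (legendre phi) = phi.
Proof.
move=> Cphi phic; apply/funext => x; apply/eqP; rewrite eq_le; apply/andP; split.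
  apply: legendre_le => y; have := legendre_ge phi y x; rewrite dotpC.
  have [phiNy _ _ _] := Cphi; have := phiNy x.
  case: (phi x) => [r| |] // _; last by rewrite leey.
  case: (legendre phi y) => [l| |] //.
  - by rewrite -!EFinB !lee_fin; lra.
  - by rewrite leNye.
rewrite leNgt; apply/negP => lt.
have [a [lta ap]] : exists a, (legendre (legendre phi) x < a%:E)%E /\ (a%:E < phi x)%E.
  move: lt; case: (phi x) => [b| |]; case: (legendre (legendre phi) x) => [l| |] //.
  - by rewrite lte_fin => lb; exists ((l + b) / 2); rewrite !lte_fin; split; lra.
  - by move=> _; exists (b - 1); rewrite ltNyr lte_fin; split => //; lra.
  - by move=> _; exists (l + 1); rewrite ltry lte_fin; split => //; lra.
  - by move=> _; exists 0; rewrite ltNyr ltry.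
have [s [b [sb asb]]] := affine_minorant Cphi phic ap.
have Ls : (legendre phi s <= (- b)%:E)%E.
  apply: legendre_le => y; have := sb y.
  case: (phi y) => [q| |] //; last by rewrite leNye.
  by rewrite -EFinB !lee_fin; lra.
move: lta; rewrite ltNge => /negP; apply.
apply: le_trans (legendre_ge _ x s); rewrite dotpC.
move: Ls; case: (legendre phi s) => [l| |] //; last by rewrite leey.
by rewrite -EFinB !lee_fin; lra.
Qed.

(** On the segment from a point [x1] of finite value, a gain of 1 at distance [D] turns into linear
    growth beyond [D]. Nearer to [x1], lower semicontinuity at [x1] and the same chord inequality
    [seg] give a lower bound. *)
Lemma coercive_growth phi : Cvx phi ->
  (forall M, exists r, forall x, r < enorm x -> (M%:E < phi x)%E) ->
  exists a b, 0 < a /\ forall x, ((a * enorm x - b)%:E <= phi x)%E.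
Proof.
move=> Cphi coer; have [x1 [r1 xr1]] := Cvx_finite_pt Cphi.
have /(Cvx_nbhs Cphi)[d d0 dphi] : ((r1 - 1)%:E < phi x1)%E.
  by rewrite xr1 lte_fin; lra.
have [rho rhoP] := coer (r1 + 1).
pose D := `|rho| + enorm x1 + 1.
have D0 : 0 < D by rewrite ltr_wpDl// addr_ge0// enorm_ge0.
have seg y q l A : phi y = q%:E -> 0 < l -> l < 1 ->
    (forall z, enorm (z - x1) = l * enorm (y - x1) -> (A%:E < phi z)%E) ->
    A - r1 < l * (q - r1).
  move=> yq l0 l1 Az; have [cc zE cle] := Cvx_fin_comb Cphi yq xr1 l0 l1.
  have : (A%:E < cc%:E)%E.
    rewrite -zE; apply: Az.
    have -> : l *: y + (1 - l) *: x1 - x1 = l *: (y - x1).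
      by apply/matrixP => i j; rewrite !mxE; ring.
    by rewrite enormZ gtr0_norm.
  by rewrite lte_fin; lra.
(* At distance [d / 2] on the way to [y] the drop is still less than 1, so along the whole segment
   the slope is at least [- 2 / d]. *)
have low1 y q : phi y = q%:E -> r1 - 1 - 2 * (enorm (y - x1)) / d <= q.
  move=> yq; set e := enorm (y - x1); have e0 : 0 <= e by exact: enorm_ge0.
  have [ed|de] := ltP e d.
    have := dphi _ ed; rewrite yq lte_fin => ?.
    have : 0 <= 2 * e / d by rewrite divr_ge0 ?mulr_ge0// ltW.
    lra.
  have ep : 0 < e by apply: lt_le_trans de.
  have l0 : 0 < d / (2 * e) by rewrite divr_gt0// mulr_gt0.
  have l1 : d / (2 * e) < 1 by rewrite ltr_pdivrMr ?mulr_gt0// mul1r; lra.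
  have H : r1 - 1 - r1 < d / (2 * e) * (q - r1).
    apply: (seg y) => // z; rewrite -/e => ez; apply: dphi; rewrite ez.
    have -> : d / (2 * e) * e = d / 2 by field; rewrite gt_eqF.
    lra.
  have {}H : - (2 * e) < d * (q - r1).
    move: H; rewrite mulrAC ltr_pdivlMr ?mulr_gt0//; lra.
  have d'0 : 0 < d^-1 by rewrite invr_gt0.
  have : - (2 * e) * d^-1 < q - r1 by rewrite ltr_pdivrMr// (mulrC _ d).
  lra.
have low2 y q : phi y = q%:E -> D < enorm (y - x1) -> r1 + enorm (y - x1) / D <= q.
  move=> yq; set e := enorm (y - x1) => De; have ep : 0 < e by apply: lt_trans De.
  have l0 : 0 < D / e by rewrite divr_gt0.
  have l1 : D / e < 1 by rewrite ltr_pdivrMr// mul1r.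
  have H : r1 + 1 - r1 < D / e * (q - r1).
    apply: (seg y) => // z; rewrite -/e divfK ?gt_eqF// => ez; apply: rhoP.
    have : enorm (z - x1) <= enorm z + enorm x1.
      by rewrite -(enormN x1); exact: enormD.
    by rewrite ez /D => ?; have := ler_norm rho; lra.
  have {}H : e < D * (q - r1).
    move: H; rewrite mulrAC ltr_pdivlMr//; lra.
  by rewrite -lerBrDl ler_pdivrMr// (mulrC _ D) ltW.
(* The constant 2 is the drop of 1 in [low1] plus the bound 1 on [|y - x1| / D] inside the ball of
   radius [D]. *)
exists D^-1, (enorm x1 / D + 2 + 2 * D / d - r1); split; first by rewrite invr_gt0.
move=> y; have [phiNy _ _ _] := Cphi; have := phiNy y.
case yq : (phi y) => [q| |] // _; last by rewrite leey.
rewrite lee_fin mulrC.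
have yx : enorm y / D <= enorm (y - x1) / D + enorm x1 / D.
  rewrite -mulrDl ler_pM2r ?invr_gt0//.
  by rewrite -{1}(subrK x1 y); exact: enormD.
have Dd : 0 <= 2 * D / d by rewrite divr_ge0 ?mulr_ge0// ltW.
have [De|eD] := ltP D (enorm (y - x1)).
  by have := low2 _ _ yq De; lra.
have := low1 _ _ yq.
have : enorm (y - x1) / D <= 1 by rewrite ler_pdivrMr// mul1r.
have : 2 * enorm (y - x1) / d <= 2 * D / d.
  by rewrite ler_pM2r ?invr_gt0// ler_pM2l.
lra.
Qed.

Lemma expeRN_fin phi x : (phi x != -oo)%E -> (fine (expeR (- phi x)))%:E = expeR (- phi x).
Proof. by case: (phi x) => [r| |]. Qed.

Lemma support_fun_exp (f : 'cV[R]_n -> R) phi :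
  (forall x, (f x)%:E = expeR (- phi x)) -> support_fun f = legendre phi.
Proof.
move=> fphi; rewrite /support_fun; congr legendre; apply/funext => y.
by rewrite fphi expeRK oppeK.
Qed.

Lemma legendre_quadratic b :
  legendre (fun y => (enorm y ^+ 2 / 2 + b)%:E) =
  (fun x : 'cV[R]_n => (enorm x ^+ 2 / 2 - b)%:E).
Proof.
apply/funext => x; apply/eqP; rewrite eq_le; apply/andP; split.
  apply: legendre_le => y; rewrite -EFinB lee_fin !enorm_sqr.
  by have := dotp_ge0 (x - y); rewrite !dotp_lin (dotpC y x); lra.
apply: le_trans (legendre_ge _ x x).
by rewrite -EFinB lee_fin !enorm_sqr; lra.
Qed.

Lemma support_fun_gauss b :
  support_fun (fun y => expR (b - enorm y ^+ 2 / 2)) =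
  (fun x : 'cV[R]_n => (enorm x ^+ 2 / 2 + b)%:E).
Proof.
rewrite (@support_fun_exp _ (fun y => (enorm y ^+ 2 / 2 + - b)%:E)).
  by rewrite legendre_quadratic opprK.
by move=> x /=; rewrite opprD opprK addrC.
Qed.

(** The potential of [g] is bounded below by coercivity, so biconjugation recovers it from the
    support function. *)
Lemma LCc_gauss_uniq (g : 'cV[R]_n -> R) b : LCc g ->
  support_fun g = (fun x => (enorm x ^+ 2 / 2 + b)%:E) ->
  g = (fun y => expR (b - enorm y ^+ 2 / 2)).
Proof.
move=> [phi [Cphi coer gphi]]; rewrite (support_fun_exp gphi) => H.
have [a [c [a0 low]]] := coercive_growth Cphi coer.
have phic x : ((- c)%:E <= phi x)%E.
  apply: le_trans (low x); rewrite lee_fin lerDr mulr_ge0 ?enorm_ge0 ?ltW//.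
have := biconjugate Cphi phic; rewrite H legendre_quadratic => phiE.
apply/funext => y; apply: EFin_inj; rewrite gphi -phiE /=.
by rewrite opprB.
Qed.

(** The witness is [exp (- legendre phi)]. The bound [M] on the ball of radius [a] gives its
    potential the growth [a |y| - M], by testing the supremum at the point of norm [a] in the
    direction of [y]. *)
Lemma LCc_exists phi (c a M : R) : Cvx phi -> (forall x, (c%:E <= phi x)%E) ->
  0 < a -> (forall x, enorm x <= a -> (phi x <= M%:E)%E) ->
  exists g, LCc g /\ support_fun g = phi.
Proof.
move=> Cphi phic a0 phiM.
have Lge y : ((a * enorm y - M)%:E <= legendre phi y)%E.
  have [->|y0] := eqVneq y 0.
    apply: le_trans (legendre_ge _ _ 0); rewrite enorm0 mulr0 dotp0l.
    have := phiM 0; rewrite enorm0 => /(_ (ltW a0)).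
    by case: (phi 0) => [r| |]//; rewrite ?leey// -EFinB !lee_fin; lra.
  pose x := (a / enorm y) *: y.
  have ey : 0 < enorm y by rewrite enorm_gt0.
  have := phiM x; rewrite /x enormZ gtr0_norm ?divr_gt0// divfK ?gt_eqF//.
  move=> /(_ (lexx _)) pM; apply: le_trans (legendre_ge _ _ x); rewrite /x.
  have -> : dotp y ((a / enorm y) *: y) = a * enorm y.
    by rewrite dotpZr -enorm_sqr; field; rewrite gt_eqF.
  by move: pM; case: (phi _) => [r| |]//; rewrite ?leey// -EFinB !lee_fin; lra.
have CL : Cvx (legendre phi).
  apply: legendre_Cvx.
  - by have [] := Cphi.
  - exact: Cvx_finite_pt.
  - exists 0, (- c); apply: legendre_le => y; rewrite dotp0l.
    have := phic y; case: (phi y) => [r| |]//; rewrite ?leNye// -EFinB !lee_fin; lra.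
pose g y := fine (expeR (- legendre phi y)).
have gE y : (g y)%:E = expeR (- legendre phi y).
  by apply: expeRN_fin; case: CL.
exists g; split.
  exists (legendre phi); split => // M'; exists ((M' + M) / a) => y.
  rewrite ltr_pdivrMr// => H; apply: lt_le_trans (Lge y); rewrite lte_fin; lra.
by rewrite (support_fun_exp gE) (biconjugate Cphi phic).
Qed.

End convex.

(** * Rotation-scalings of a plane *)

Lemma mulmx_ext (R : realType) n (A B : 'M[R]_n) :
  (forall x : 'cV[R]_n, A *m x = B *m x) -> A = B.
Proof.
move=> AB; apply/matrixP => i j.
have := AB (delta_mx j ord0); rewrite -!colE => /colP/(_ i).
by rewrite !mxE.
Qed.

Section plane.
Context (R : realType) (n : nat) (p q : 'cV[R]_n).
Hypotheses (pp : dotp p p = 1) (qq : dotp q q = 1) (pq : dotp p q = 0).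

(* Rotation-scaling by [a + i b] on the plane spanned by [p] and [q],
   multiplication by [r] on its orthogonal complement. *)
Definition planeM a b r : 'M[R]_n :=
  r%:M + (a - r) *: (p *m p^T + q *m q^T) + b *: (q *m p^T - p *m q^T).

Let outerE (x y v : 'cV[R]_n) : x *m y^T *m v = dotp y v *: x.
Proof.
rewrite -mulmxA (_ : y^T *m v = (dotp y v)%:M) ?mul_mx_scalar//.
by rewrite dotpE [LHS]mx11_scalar.
Qed.

Lemma planeME a b r v : planeM a b r *m v =
  r *: v + ((a - r) * dotp p v - b * dotp q v) *: p +
  ((a - r) * dotp q v + b * dotp p v) *: q.
Proof.
rewrite /planeM !mulmxDl mul_scalar_mx -!scalemxAl mulmxDl mulmxBl !outerE.
by apply/matrixP => i j; rewrite !mxE; ring.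
Qed.

Let qp : dotp q p = 0. Proof. by rewrite dotpC. Qed.

(** [planeM] represents the ring of pairs of a complex number [a + i b] and a real [r].
    Transposition is conjugation, so orthogonality reduces to [|a + i b| = |r| = 1]. *)
Lemma planeM_mul a b r a' b' r' : planeM a b r *m planeM a' b' r' =
  planeM (a * a' - b * b') (a * b' + b * a') (r * r').
Proof.
apply: mulmx_ext => x; rewrite -mulmxA !planeME !dotp_lin pp qq pq qp.
by apply/matrixP => i j; rewrite !mxE; ring.
Qed.

Lemma planeM1 : planeM 1 0 1 = 1%:M.
Proof.
apply: mulmx_ext => x; rewrite planeME mul1mx.
by apply/matrixP => i j; rewrite !mxE; ring.
Qed.

Lemma planeM_tr a b r : (planeM a b r)^T = planeM a (- b) r.
Proof.
rewrite /planeM; apply/matrixP => i j; rewrite !mxE !big_ord1 !mxE eq_sym.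
by ring.
Qed.

Lemma planeM_scale k a b r : k *: planeM a b r = planeM (k * a) (k * b) (k * r).
Proof.
apply: mulmx_ext => x; rewrite -scalemxAl !planeME.
by apply/matrixP => i j; rewrite !mxE; ring.
Qed.

Lemma planeM_orth a b r : a ^+ 2 + b ^+ 2 = 1 -> r ^+ 2 = 1 -> is_orth (planeM a b r).
Proof.
move=> ab rr; rewrite /is_orth planeM_tr planeM_mul -planeM1.
by congr planeM; [rewrite -ab; ring|ring|rewrite -rr expr2].
Qed.

Lemma planeM_p a b r : planeM a b r *m p = a *: p + b *: q.
Proof.
rewrite planeME pp qp; apply/matrixP => i j; rewrite !mxE; ring.
Qed.

Lemma planeM_perp a b r v : dotp p v = 0 -> dotp q v = 0 -> planeM a b r *m v = r *: v.
Proof. by move=> pv qv; rewrite planeME pv qv !mulr0 subr0 addr0 !scale0r !addr0. Qed.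

Lemma enorm_planeM_le a b r v :
  enorm (planeM a b r *m v) <= (3 * `|r| + 2 * `|a| + 2 * `|b|) * enorm v.
Proof.
have ep : enorm p = 1 by rewrite /enorm pp sqrtr1.
have eq : enorm q = 1 by rewrite /enorm qq sqrtr1.
have hp : `|dotp p v| <= enorm v.
  rewrite ler_norml lerNl -dotpNl.
  by rewrite (le_trans (cauchy_schwarz _ _)) ?enormN ?ep ?mul1r//= (le_trans (cauchy_schwarz _ _)) ?ep ?mul1r.
have hq : `|dotp q v| <= enorm v.
  rewrite ler_norml lerNl -dotpNl.
  by rewrite (le_trans (cauchy_schwarz _ _)) ?enormN ?eq ?mul1r//= (le_trans (cauchy_schwarz _ _)) ?eq ?mul1r.
have h0 := enorm_ge0 v.
have har : `|a - r| <= `|a| + `|r| by exact: ler_normB.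
rewrite planeME; apply: le_trans (enormD _ _) _.
apply: le_trans (lerD (enormD _ _) (lexx _)) _.
rewrite !enormZ ep eq !mulr1.
have h1 (u1 u2 w1 w2 : R) : `|w1| <= enorm v -> `|w2| <= enorm v ->
    `|u1 * w1 + u2 * w2| <= (`|u1| + `|u2|) * enorm v.
  move=> H1 H2; apply: le_trans (ler_normD _ _) _; rewrite !normrM mulrDl.
  by rewrite lerD// ler_wpM2l.
have := h1 (a - r) (- b) _ _ hp hq; rewrite mulNr normrN => H1.
have := h1 (a - r) b _ _ hq hp => H2.
have H3 : `|a - r| * enorm v <= (`|a| + `|r|) * enorm v by rewrite ler_wpM2r.
move: H1 H2 H3; set A := `|_ - b * _|; set B := `|_ + b * _|; set d := `|a - r|; lra.
Qed.

(** A rotation is the square of the rotation by half its angle, whose determinant is 1 or -1. *)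
Lemma planeM_det (a b : R) : a ^+ 2 + b ^+ 2 = 1 -> \det (planeM a b 1) = 1.
Proof.
move=> ab; suff [c [d [cd ->]]] : exists c d, c ^+ 2 + d ^+ 2 = 1 /\
    planeM a b 1 = planeM c d 1 *m planeM c d 1.
  rewrite det_mulmx.
  by have [->|->] := is_orth_det (planeM_orth cd (expr1n _ 2)); rewrite ?mulr1// mulrNN mulr1.
(* The half-angle formulas used below divide by zero at the half turn, which is the square of a
   quarter turn. *)
have [a1|a1] := eqVneq a (-1).
  exists 0, 1; split; first by rewrite expr0n expr1n add0r.
  have b0 : b = 0.
    by apply/eqP; rewrite -sqrf_eq0; apply/eqP; move: ab; rewrite a1; lra.
  by rewrite planeM_mul a1 b0; congr planeM; ring.
have a2 : 0 < (1 + a) / 2.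
  have : a ^+ 2 <= 1 by rewrite -ab lerDl sqr_ge0.
  move=> a2; have a3 : -1 <= a by rewrite leNgt; apply/negP => ?; nra.
  by have : -1 < a; [rewrite lt_neqAle eq_sym a1|lra].
pose c := Num.sqrt ((1 + a) / 2).
have c2 : c ^+ 2 = (1 + a) / 2 by rewrite sqr_sqrtr// ltW.
have c0 : c != 0 by rewrite gt_eqF// sqrtr_gt0.
have cd : c ^+ 2 + (b / (2 * c)) ^+ 2 = 1.
  have -> : (b / (2 * c)) ^+ 2 = b ^+ 2 / (4 * c ^+ 2) by field.
  have -> : b ^+ 2 = 1 - a ^+ 2 by rewrite -ab; ring.
  by rewrite c2; field; lra.
exists c, (b / (2 * c)); split => //; rewrite planeM_mul; congr planeM.
- by move: cd c2; rewrite -!expr2; lra.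
- by field.
- by rewrite mulr1.
Qed.

End plane.

Arguments planeM {R n} p q (a b r)%_R.

(** * Invariance of the measure under all orthogonal maps fixing the pole *)

Section invariance.
Context (R : realType) (n : nat) (e : 'cV[R]_n) (mu : probability 'cV[R]_n R).
Hypothesis mu_invariant : forall A : 'M[R]_n,
     special_orthogonal A -> A *m e = e ->
     forall B : set 'cV[R]_n, measurable B -> mu (mulmx A @^-1` B) = mu B.
Local Open Scope ereal_scope.

Let SO_inv (A : 'M[R]_n) (k : 'cV[R]_n -> \bar R) : is_orth A -> \det A = 1%R ->
  (A *m e)%R = e -> measurable_fun setT k -> (forall v, 0 <= k v) ->
  \int[mu]_v k (A *m v)%R = \int[mu]_v k v.
Proof.
move=> oA dA Ae mk k0.
apply: (ge0_integral_measure_preserving (measurable_mulmx A)) => //.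
exact: mu_invariant.
Qed.

Let gauss_ae_cst m (g : 'cV[R]_m.+1 -> \bar R) c : measurable_fun setT g ->
  (forall a, 0 <= g a) -> 0 <= c -> (forall a, a != 0%R -> g a = c) ->
  \int[@gauss_measure R m.+1]_a g a = c.
Proof.
move=> mg g0 c0 gc.
transitivity (\int[@gauss_measure R m.+1]_a cst c a); last first.
  rewrite integral_cst// -[RHS]mule1; congr (_ * _); exact: gauss_measureT.
apply: (ge0_ae_eq_integral measurableT mg (measurable_cst c) (fun a _ => g0 a) (fun a _ => c0)).
exists [set 0%R]; split; [exact: measurable_cV0|exact: gauss_measure_pt0|].
by move=> a; apply: contra_notP => /eqP a0 _; rewrite gc.
Qed.

Section reflection.
Context (p q : 'cV[R]_n).
Hypotheses (pp : dotp p p = 1%R) (qq : dotp q q = 1%R) (pq : dotp p q = 0%R).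
Hypotheses (pe : dotp p e = 0%R) (qe : dotp q e = 0%R).

(** The rotation by the angle of [a]. A Gaussian [a] gives a uniform angle, and its orthogonal
    invariance is already known; the origin, which has no angle, is negligible. *)
Let A (a : 'cV[R]_2) := planeM p q (a ord0 ord0 / enorm a) (a ord_max ord0 / enorm a) 1.

Let unit_dir (a : 'cV[R]_2) : a != 0%R ->
  ((a ord0 ord0 / enorm a) ^+ 2 + (a ord_max ord0 / enorm a) ^+ 2 = 1)%R.
Proof.
move=> a0; have ea : enorm a != 0%R by rewrite enorm_eq0.
rewrite !exprMn -mulrDl exprVn enorm_sqr /dotp !big_ord_recl big_ord0 addr0.
rewrite (_ : lift ord0 ord0 = ord_max); last exact/val_inj.
rewrite !expr2 divff//.
by move: ea; rewrite -sqrf_eq0 enorm_sqr /dotp !big_ord_recl big_ord0 addr0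
  (_ : lift ord0 ord0 = ord_max)//; exact/val_inj.
Qed.

(** Let [z = x + i y] be the component of [v] in the plane and [w] the unit number of the angle of
    [a]. The reflection sends [w z] to minus its conjugate, which is [w' z] with
    [w' = - conj w * (conj z / z)]. Here [g0 + i g1] is [conj z / z], replaced by 1 when [z = 0],
    and [C] is the map from [w] to [w']. *)
Let A_refl (v : 'cV[R]_n) : exists2 C : 'M[R]_2, is_orth C &
  forall a, (householder p *m (A a *m v) = A (C *m a) *m v)%R.
Proof.
pose x := dotp p v; pose y := dotp q v; pose D := (x ^+ 2 + y ^+ 2)%R.
pose g0 := if D == 0%R then 1%R else ((x ^+ 2 - y ^+ 2) / D)%R.
pose g1 := if D == 0%R then 0%R else (- (2 * x * y) / D)%R.
have gg : (g0 ^+ 2 + g1 ^+ 2 = 1)%R.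
  rewrite /g0 /g1; case: eqVneq => [_|D0]; first by rewrite expr1n expr0n addr0.
  by rewrite /D in D0 *; field.
have D0xy : D = 0%R -> (x = 0 /\ y = 0)%R.
  by move/eqP; rewrite paddr_eq0 ?sqr_ge0// !sqrf_eq0 => /andP[/eqP-> /eqP->].
have gx : (g0 * x - g1 * y = x)%R.
  rewrite /g0 /g1; case: eqVneq => [/D0xy[-> ->]|D0]; first by rewrite !mulr0 subr0.
  by rewrite /D in D0 *; field.
have gy : (g1 * x + g0 * y = - y)%R.
  rewrite /g0 /g1; case: eqVneq => [/D0xy[-> ->]|D0]; first by rewrite !mulr0 addr0 oppr0.
  by rewrite /D in D0 *; field.
pose C : 'M[R]_2 := \matrix_(i, j) (if i == ord0 then (if j == ord0 then - g0 else - g1)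
   else (if j == ord0 then - g1 else g0))%R.
have C0 a : ((C *m a) ord0 ord0 = - g0 * a ord0 ord0 - g1 * a ord_max ord0)%R.
  rewrite !mxE !big_ord_recl big_ord0 addr0 !mxE/= mulNr.
  by rewrite (_ : lift ord0 ord0 = ord_max) ?mulNr//; exact/val_inj.
have C1 a : ((C *m a) ord_max ord0 = - g1 * a ord0 ord0 + g0 * a ord_max ord0)%R.
  rewrite !mxE !big_ord_recl big_ord0 addr0 !mxE/=.
  by rewrite (_ : lift ord0 ord0 = ord_max)//; exact/val_inj.
have I2 (i : 'I_2) : i = ord0 \/ i = ord_max.
  by case: i => [[|[|//]] ?]; [left|right]; exact/val_inj.
have oC : is_orth C.
  rewrite /is_orth (_ : C^T = C); last first.
    by apply/matrixP => i j; rewrite !mxE; case: (i == ord0); case: (j == ord0).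
  apply: mulmx_ext => w; rewrite mul1mx -mulmxA; apply/matrixP => i j; rewrite (ord1 j).
  have [->|->] := I2 i; rewrite ?C0 ?C1 ?C0 ?C1.
    transitivity ((g0 ^+ 2 + g1 ^+ 2) * w ord0 ord0)%R; first by ring.
    by rewrite gg mul1r.
  transitivity ((g0 ^+ 2 + g1 ^+ 2) * w ord_max ord0)%R; first by ring.
  by rewrite gg mul1r.
exists C => // a; rewrite /A enorm_is_orth// C0 C1.
set c := (a ord0 ord0 / enorm a)%R; set s := (a ord_max ord0 / enorm a)%R.
have -> : ((- g0 * a ord0 ord0 - g1 * a ord_max ord0) / enorm a = - g0 * c - g1 * s)%R.
  by rewrite /c /s; ring.
have -> : ((- g1 * a ord0 ord0 + g0 * a ord_max ord0) / enorm a = - g1 * c + g0 * s)%R.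
  by rewrite /c /s; ring.
rewrite householderE pp !planeME -/x -/y !dotp_lin pp pq -/x.
set c' := (- g0 * c - g1 * s)%R; set s' := (- g1 * c + g0 * s)%R.
have -> : ((c' - 1) * x - s' * y = - (c * x - s * y) - x)%R.
  transitivity (- c * (g0 * x - g1 * y) - s * (g1 * x + g0 * y) - x)%R; first by rewrite /c' /s'; ring.
  by rewrite gx gy; ring.
have -> : ((c' - 1) * y + s' * x = (s * x + c * y) - y)%R.
  transitivity (s * (g0 * x - g1 * y) - c * (g1 * x + g0 * y) - y)%R; first by rewrite /c' /s'; ring.
  by rewrite gx gy; ring.
by apply/matrixP => i j; rewrite !mxE divr1; ring.
Qed.

Lemma householder_inv (k : 'cV[R]_n -> \bar R) :
  measurable_fun setT k -> (forall v, 0 <= k v) ->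
  \int[mu]_v k (householder p *m v)%R = \int[mu]_v k v.
Proof.
move=> mk k0; pose G : probability 'cV[R]_2 R := @gauss_measure R 2.
have mA (a : 'I_n) (b : 'I_n) : measurable_fun setT (fun t => A t a b).
  pose P1 := (p *m p^T + q *m q^T)%R; pose P2 := (q *m p^T - p *m q^T)%R.
  rewrite (_ : (fun t => _) = (fun t : 'cV[R]_2 => (1%:M : 'M[R]_n) a b +
      (t ord0 ord0 * powR (enorm t) (- 1) - 1) * P1 a b +
      (t ord_max ord0 * powR (enorm t) (- 1)) * P2 a b)%R); last first.
    apply/funext => t; rewrite /A /planeM -/P1 -/P2 powR_inv1 ?enorm_ge0//.
    by move: P1 P2 => P1 P2; rewrite !mxE.
  have minv (i : 'I_2) : measurable_fun setT (fun t : 'cV[R]_2 => t i ord0 * powR (enorm t) (- 1))%R.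
    apply: measurable_funM; first exact: measurable_fun_coord.
    by apply: (measurableT_comp (measurable_powR _)); exact: measurable_fun_enorm.
  apply: measurable_funD.
    apply: measurable_funD => //; apply: measurable_funM => //.
    by apply: measurable_funB => //; exact: minv.
  by apply: measurable_funM => //; exact: minv.
have mAv : measurable_fun setT (fun z : 'cV[R]_2 * 'cV[R]_n => A z.1 *m z.2)%R.
  apply: measurable_fun_mulmx => // i j; exact: (measurableT_comp (mA i j)).
(* Each [A a] with [a] nonzero is a rotation fixing [e], so averaging over [a] does not change the
   integral. *)
have key (h : 'cV[R]_n -> \bar R) : measurable_fun setT h -> (forall v, 0 <= h v) ->
    \int[mu]_v h v = \int[mu]_v \int[G]_a h (A a *m v)%R.
  move=> mh h0.
  have mhA : measurable_fun setT (fun z : 'cV[R]_2 * 'cV[R]_n => h (A z.1 *m z.2)%R).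
    exact: (measurableT_comp mh mAv).
  rewrite -[RHS](@exchange_integral _ _ _ _ R G mu (fun a v => h (A a *m v)%R) mhA (fun _ _ => h0 _)).
  apply/esym/gauss_ae_cst.
  - exact: (@measurable_fun_integral2 _ _ _ _ R mu (fun a v => h (A a *m v)%R) mhA (fun _ _ => h0 _)).
  - by move=> a; apply: integral_ge0.
  - exact: integral_ge0.
  move=> a a0; apply: SO_inv => //.
  - by apply: planeM_orth => //; [exact: unit_dir|rewrite expr1n].
  - by apply: planeM_det => //; exact: unit_dir.
  - by rewrite planeM_perp// scale1r.
have mks : measurable_fun setT (fun v => k (householder p *m v)%R).
  exact: (measurableT_comp mk (measurable_mulmx _)).
rewrite (key _ mks (fun _ => k0 _)) (key _ mk k0); apply: eq_integral => v _.
have [C oC AC] := A_refl v.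
rewrite -[RHS](ge0_integral_gauss_orth oC).
- by apply: eq_integral => a _; rewrite AC.
- by apply: (measurableT_comp mk); exact: measurable_fun_mulmx.
- by [].
Qed.

End reflection.

Lemma dotp_delta (i j : 'I_n) :
  dotp (delta_mx i ord0) (delta_mx j ord0) = (i == j)%:R :> R.
Proof.
rewrite /dotp (bigD1 i)//= big1 ?addr0 => [|k ki]; rewrite !mxE ?eqxx ?andbT.
  by rewrite mul1r.
by rewrite (negbTE ki) mul0r.
Qed.

(** Conjugation by [W] reduces this to a coordinate reflection, a diagonal matrix. *)
Lemma det_householder_is_orth (W : 'M[R]_n) i : is_orth W ->
  \det (householder (W *m delta_mx i ord0)) = (-1)%R.
Proof.
move=> oW; set d := delta_mx i ord0 : 'cV[R]_n.
have dE x : dotp d x = x i ord0.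
  rewrite /dotp (bigD1 i)//= big1 ?mxE ?eqxx ?mul1r ?addr0// => j ji.
  by rewrite mxE (negbTE ji) mul0r.
have -> : householder (W *m d) = (W *m householder d *m W^T)%R.
  apply: mulmx_ext => x; rewrite -!mulmxA !householderE mulmxBr -scalemxAr.
  by rewrite mulmxA (mulmx1C oW) mul1mx dotp_is_orth// dotp_mulmx.
rewrite !det_mulmx mulrC mulrA -det_mulmx oW det1 mul1r.
have -> : householder d = diag_mx (\row_j (if j == i then -1 else 1 : R))%R.
  apply: mulmx_ext => x; rewrite householderE dotp_delta eqxx dE divr1.
  apply/matrixP => j k; rewrite (ord1 k) mul_diag_mx !mxE.
  by case: (eqVneq j i) => [->|_]; rewrite /= ?mulr1 ?mulr0; ring.
rewrite det_diag (bigD1 i)//= big1 ?mulr1 => [|j ji]; rewrite mxE ?eqxx//.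
by rewrite (negbTE ji).
Qed.

(* Reflections are not rotations, but a circle has the same orbits under
   both, so averaging over a circle gives invariance under reflections too. *)
Lemma orth_inv (A : 'M[R]_n) (k : 'cV[R]_n -> \bar R) : (3 <= n)%N ->
  enorm e = 1%R -> is_orth A -> (A *m e)%R = e ->
  measurable_fun setT k -> (forall v, 0 <= k v) ->
  \int[mu]_v k (A *m v)%R = \int[mu]_v k v.
Proof.
move=> n3 e1 oA Ae mk k0.
have [n0' n1'] : (0 < n)%N /\ (1 < n)%N by split; apply: leq_trans n3.
pose d0 : 'cV[R]_n := delta_mx (Ordinal n0') ord0.
pose W := householder (d0 - e)%R.
have oW : is_orth W by exact: householder_is_orth.
have We : (W *m d0)%R = e.
  by apply: householder_swap; rewrite e1 /enorm dotp_delta eqxx sqrtr1.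
pose p : 'cV[R]_n := (W *m delta_mx (Ordinal n1') ord0)%R.
pose q : 'cV[R]_n := (W *m delta_mx (Ordinal n3) ord0)%R.
have pp : dotp p p = 1%R by rewrite dotp_is_orth// dotp_delta eqxx.
have qq : dotp q q = 1%R by rewrite dotp_is_orth// dotp_delta eqxx.
have pq : dotp p q = 0%R by rewrite dotp_is_orth// dotp_delta.
have pe : dotp p e = 0%R by rewrite -We dotp_is_orth// dotp_delta.
have qe : dotp q e = 0%R by rewrite -We dotp_is_orth// dotp_delta.
have [dA|dA] := is_orth_det oA; first exact: SO_inv.
have mkA : measurable_fun setT (fun v => k (A *m v)%R).
  exact: (measurableT_comp mk (measurable_mulmx _)).
(* Composing with the reflection in [p], which also fixes [e], restores determinant 1. *)
rewrite -(householder_inv pp qq pq pe qe mkA (fun _ => k0 _)).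
under eq_integral => v _ do rewrite mulmxA.
apply: SO_inv => //.
- by apply: is_orthM => //; exact: householder_is_orth.
- by rewrite det_mulmx dA det_householder_is_orth// mulrNN mulr1.
- by rewrite -mulmxA householder_fix.
Qed.

End invariance.

(** * Averaging over the measure *)

Section liminf.
Context (R : realType).
Local Open Scope ereal_scope.

Lemma limn_einf_gt (u : nat -> \bar R) (a : R) :
  (\forall j \near \oo, a%:E < u j) -> a%:E <= limn_einf u.
Proof.
move=> au; rewrite -[limn_einf u]/(limf_einf u \oo) limf_einfE.
apply: (@le_trans _ _ (ereal_inf (u @` [set j | a%:E < u j]))).
  by apply: le_ereal_inf_tmp => _ [j /= aj <-]; exact: ltW.
by apply: ereal_sup_ubound; exists [set j | a%:E < u j].
Qed.

Lemma limn_einf_le (u : nat -> \bar R) a :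
  (forall j, u j <= a) -> limn_einf u <= a.
Proof.
move=> ua; rewrite -[limn_einf u]/(limf_einf u \oo) limf_einfE.
apply: ge_ereal_sup => _ [V [K _ KV] <-].
apply: le_trans (ua K); apply: ereal_inf_lbound; exists K => //.
by apply: KV => /=.
Qed.

Lemma lsc_le_limn_einf n (k : 'cV[R]_n -> \bar R) v (u : nat -> 'cV[R]_n) :
  lower_semicontinuous k -> (u @ \oo --> v) -> k v <= limn_einf (k \o u).
Proof.
move=> lk uv; rewrite leNgt; apply/negP => lt.
have [b [lb bk]] : exists b : R, limn_einf (k \o u) < b%:E /\ b%:E < k v.
  move: lt; case: (k v) => [x| |]; case: (limn_einf _) => [l| |] //.
  - by rewrite lte_fin => lx; exists ((l + x) / 2)%R; rewrite !lte_fin; split; lra.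
  - by move=> _; exists (x - 1)%R; rewrite ltNyr lte_fin; split => //; lra.
  - by move=> _; exists (l + 1)%R; rewrite ltry lte_fin; split => //; lra.
  - by move=> _; exists 0%R; rewrite ltNyr ltry.
move: lb; rewrite ltNge => /negP; apply; apply: limn_einf_gt.
have [V vV bV] := lk v b bk.
have H : nbhs \oo (u @^-1` V) by exact: uv V vV.
by apply: filterS H => j; exact: bV.
Qed.

End liminf.

Section circ.
Context (R : realType) (n : nat) (n3 : (3 <= n)%N).
Context (e : 'cV[R]_n) (e1 : enorm e = 1) (mu : probability 'cV[R]_n R).
Hypothesis mu_sphere : mu (@sphere R n) = 1%E.
Hypothesis mu_invariant : forall A : 'M[R]_n,
     special_orthogonal A -> A *m e = e ->
     forall B : set 'cV[R]_n, measurable B -> mu (mulmx A @^-1` B) = mu B.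
Local Open Scope ereal_scope.

Lemma measurable_sphere : measurable (@sphere R n).
Proof.
rewrite (_ : @sphere R n = (@enorm R n) @^-1` [set 1%R])//.
by rewrite -[X in measurable X]setTI; apply: measurable_fun_enorm.
Qed.

Lemma integral_sphere (g : 'cV[R]_n -> \bar R) : measurable_fun setT g ->
  (forall v, 0 <= g v) -> \int[mu]_(v in @sphere R n) g v = \int[mu]_v g v.
Proof.
move=> mg g0; have mS := measurable_sphere.
rewrite [RHS](@ge0_negligible_integral _ _ _ mu setT (~` @sphere R n))//.
- by rewrite setTD setCK.
- exact: measurableC.
- have H : mu (~` @sphere R n) = 1 - 1.
    by rewrite -[X in _ - X]mu_sphere; exact: probability_setC.
  by apply: (etrans H); rewrite subee.
Qed.

Lemma integral_sphere_eq (g h : 'cV[R]_n -> \bar R) : measurable_fun setT g ->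
  measurable_fun setT h -> (forall v, 0 <= g v) -> (forall v, 0 <= h v) ->
  (forall v, enorm v = 1%R -> g v = h v) -> \int[mu]_v g v = \int[mu]_v h v.
Proof.
move=> mg mh g0 h0 gh; rewrite -(integral_sphere mg g0) -(integral_sphere mh h0).
by apply: eq_integral => v; rewrite inE => /gh.
Qed.

Definition rotp (x : 'cV[R]_n) := householder (enorm x *: e - x)%R.

Lemma rotp_orth x : is_orth (rotp x). Proof. exact: householder_is_orth. Qed.

Lemma rotpE x : (enorm x *: (rotp x *m e) = x)%R.
Proof.
rewrite scalemxAr; apply: householder_swap.
by rewrite enormZ e1 mulr1 ger0_norm ?enorm_ge0.
Qed.

Lemma measurable_rotp i j : measurable_fun setT (fun x => rotp x i j).
Proof.
apply: measurable_householder; apply: measurable_fun_addcV.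
  by apply: measurable_fun_scale => //; exact: measurable_fun_enorm.
exact: measurable_fun_oppcV.
Qed.

(** A measurable form of [circledast], with no special case at the origin, where the integrand is
    constant. *)
Definition circ (k : 'cV[R]_n -> \bar R) x :=
  \int[mu]_v k (enorm x *: (rotp x *m v))%R.

Section circ_theory.
Variable k : 'cV[R]_n -> \bar R.
Hypotheses (k0 : forall x, 0 <= k x) (lk : lower_semicontinuous k).

Let mk : measurable_fun setT k. Proof. exact: lsc_measurable_cV. Qed.

Let mkM (L : 'M[R]_n) : measurable_fun setT (fun v => k (L *m v)%R).
Proof. exact: (measurableT_comp mk (measurable_mulmx L)). Qed.

Let mkMZ r (L : 'M[R]_n) : measurable_fun setT (fun v => k (r *: (L *m v))%R).
Proof. by under eq_fun do rewrite scalemxAl; exact: mkM. Qed.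

(** For nonzero [x], two orthogonal maps with the same value at [e] differ by one that fixes [e]. *)
Lemma circE (T : 'M[R]_n) x : is_orth T -> (enorm x *: (T *m e) = x)%R ->
  circ k x = \int[mu]_v k (enorm x *: (T *m v))%R.
Proof.
move=> oT Tx; rewrite /circ; have [->|x0] := eqVneq x 0%R.
  by apply: eq_integral => v _; rewrite enorm0 !scale0r.
have ex : enorm x != 0%R by rewrite enorm_eq0.
have oR := rotp_orth x.
pose A := ((rotp x)^T *m T)%R.
have Te : (T *m e = rotp x *m e)%R by apply: (scalerI ex); rewrite Tx rotpE.
have oA : is_orth A by apply: is_orthM => //; exact: is_orth_tr.
have Ae : (A *m e)%R = e by rewrite /A -mulmxA Te mulmxA oR mul1mx.
rewrite -(orth_inv mu_invariant n3 e1 oA Ae (mkMZ (enorm x) (rotp x)) (fun _ => k0 _)).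
apply: eq_integral => v _.
by rewrite /A !mulmxA (mulmx1C oR) mul1mx.
Qed.

Lemma circ_at0 : circ k 0%R = k 0%R.
Proof.
rewrite /circ enorm0; under eq_integral do rewrite scale0r.
rewrite (_ : (fun _ => k 0%R) = cst (k 0%R))// integral_cst//.
by rewrite -[RHS]mule1; congr (_ * _); exact: probability_setT.
Qed.

Section frame.
Variable f : 'cV[R]_n.
Hypotheses (ff : dotp f f = 1%R) (ef : dotp e f = 0%R).
Let ee : dotp e e = 1%R. Proof. by rewrite -enorm_sqr e1 expr1n. Qed.

Let planeN a b : dotp (a *: e + b *: f)%R (a *: e + b *: f)%R = (a ^+ 2 + b ^+ 2)%R.
Proof. by rewrite !dotp_lin (dotpC f e) ee ff ef; ring. Qed.

(** The matrix [W M(a, b, |y|)] is [|y|] times an orthogonal matrix taking [e] to [y / |y|]. When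
    [y = 0] all three parameters vanish. *)
Lemma circ_frame (W : 'M[R]_n) a b y : is_orth W ->
  y = (W *m (a *: e + b *: f))%R ->
  circ k y = \int[mu]_v k (W *m (planeM e f a b (enorm y) *m v))%R.
Proof.
move=> oW yE.
have ab : (a ^+ 2 + b ^+ 2 = enorm y ^+ 2)%R.
  by rewrite yE enorm_is_orth// enorm_sqr planeN.
have [y0|y0] := eqVneq (enorm y) 0%R.
  have /eqP : (a ^+ 2 + b ^+ 2 = 0)%R by rewrite ab y0 expr0n.
  rewrite paddr_eq0 ?sqr_ge0// !sqrf_eq0 => /andP[/eqP a0 /eqP b0].
  apply: eq_integral => v _; rewrite y0 scale0r a0 b0; congr k.
  have -> : planeM e f 0 0 0 = 0%R :> 'M[R]_n.
    by rewrite -(mul0r (0%R : R)) -planeM_scale scale0r.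
  by rewrite mul0mx mulmx0.
pose N := planeM e f (a / enorm y) (b / enorm y) 1.
have NE : planeM e f a b (enorm y) = (enorm y *: N)%R.
  by rewrite planeM_scale; congr planeM; field.
have oN : is_orth N.
  apply: planeM_orth => //; last by rewrite expr1n.
  by rewrite !exprMn -mulrDl ab exprVn divff// expf_eq0.
rewrite (@circE (W *m N)%R).
- by apply: eq_integral => v _; rewrite NE -scalemxAl -scalemxAr mulmxA.
- exact: is_orthM.
- rewrite -mulmxA planeM_p// [RHS]yE scalemxAr; congr (_ *m _)%R.
  by rewrite scalerDr !scalerA; congr (_ *: _ + _ *: _)%R; field.
Qed.

(** Puts [x] and [y] in the image of the plane of [e] and [f] under one orthogonal map, with [x] on
    the ray of [e]. [H] keeps [e] and turns [f] towards the part of [y] orthogonal to [x]. *)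
Lemma frame_exists x y : exists (H : 'M[R]_n) (a b : R),
  [/\ is_orth H, (H *m e)%R = e &
      y = (rotp x *m H *m (a *: e + b *: f))%R].
Proof.
pose y' := ((rotp x)^T *m y)%R; pose a := dotp e y'.
pose y'' := (y' - a *: e)%R; pose b := enorm y''.
pose H := householder (b *: f - y'')%R.
have ey : dotp e y'' = 0%R by rewrite /y'' !dotp_lin ee mulr1 subrr.
have ef1 : enorm f = 1%R by rewrite /enorm ff sqrtr1.
have He : (H *m e)%R = e.
  by apply: householder_fix; rewrite dotpC dotpDr dotpNr dotpZr ef ey mulr0 subr0.
exists H, a, b; split => //; first exact: householder_is_orth.
rewrite -mulmxA mulmxDr -scalemxAr He householder_swap; last first.
  by rewrite enormZ ef1 mulr1 ger0_norm ?enorm_ge0.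
by rewrite /y'' addrC subrK /y' mulmxA (mulmx1C (rotp_orth x)) mul1mx.
Qed.

Hypothesis ck : forall x y t, (0 < t < 1)%R ->
  k (t *: x + (1 - t) *: y)%R <= t%:E * k x + (1 - t)%:E * k y.

Let integral_comb (g h : 'cV[R]_n -> \bar R) t : (0 < t < 1)%R ->
  measurable_fun setT g -> measurable_fun setT h ->
  (forall v, 0 <= g v) -> (forall v, 0 <= h v) ->
  \int[mu]_v (t%:E * g v + (1 - t)%:E * h v) =
  t%:E * \int[mu]_v g v + (1 - t)%:E * \int[mu]_v h v.
Proof.
move=> /andP[t0 t1] mg mh g0 h0.
have t0' : 0 <= t%:E by rewrite lee_fin ltW.
have t1' : 0 <= (1 - t)%:E by rewrite lee_fin subr_ge0 ltW.
rewrite ge0_integralD//.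
- by rewrite !ge0_integralZl.
- by move=> v _; exact: mule_ge0.
- exact: measurable_funeM.
- by move=> v _; exact: mule_ge0.
- exact: measurable_funeM.
Qed.

Let le_integral_comb (G g h : 'cV[R]_n -> \bar R) t : (0 < t < 1)%R ->
  measurable_fun setT G -> measurable_fun setT g -> measurable_fun setT h ->
  (forall v, 0 <= G v) -> (forall v, 0 <= g v) -> (forall v, 0 <= h v) ->
  (forall v, G v <= t%:E * g v + (1 - t)%:E * h v) ->
  \int[mu]_v G v <= t%:E * \int[mu]_v g v + (1 - t)%:E * \int[mu]_v h v.
Proof.
move=> t01 mG mg mh G0 g0 h0 le; rewrite -integral_comb//.
apply: ge0_le_integral => //.
by apply: emeasurable_funD; exact: measurable_funeM.
Qed.

(* [r |-> \int k (W M(a, b, r) v)] is convex, and even because the reflection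
   of [span (e, f)^perp] preserves [mu]; hence it is nondecreasing for [r >= 0]. *)
Let spread_mono (W : 'M[R]_n) a b r r' : (0 <= r)%R -> (r <= r')%R ->
  \int[mu]_v k (W *m (planeM e f a b r *m v))%R <=
  \int[mu]_v k (W *m (planeM e f a b r' *m v))%R.
Proof.
move=> r0; rewrite le_eqVlt => /predU1P[->//|rr'].
have mL s : measurable_fun setT (fun v => k (W *m (planeM e f a b s *m v))%R).
  by under eq_fun do rewrite mulmxA; exact: mkM.
(* Chosen so that [r = t r' + (1 - t) (- r')]. *)
pose t := ((r + r') / (2 * r'))%R.
have r'0 : (0 < r')%R by apply: le_lt_trans rr'.
have t01 : (0 < t < 1)%R.
  by rewrite divr_gt0 ?ltr_wpDl ?mulr_gt0//= ltr_pdivrMr ?mulr_gt0// mul1r; lra.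
have tr : ((2 * t - 1) * r' = r)%R by rewrite /t; field; rewrite gt_eqF.
clearbody t.
pose s := planeM e f 1 0 (-1).
have os : is_orth s by apply: planeM_orth => //; ring.
have se : (s *m e)%R = e by rewrite planeM_p// scale1r scale0r addr0.
have even : \int[mu]_v k (W *m (planeM e f a b (- r') *m v))%R =
    \int[mu]_v k (W *m (planeM e f a b r' *m v))%R.
  rewrite -(orth_inv mu_invariant n3 e1 os se (mL r') (fun _ => k0 _)).
  apply: eq_integral => v _; congr k; congr (_ *m _)%R.
  by rewrite mulmxA planeM_mul//; congr (planeM _ _ _ _ _ *m _)%R; ring.
have := @le_integral_comb _ _ _ t t01 (mL r) (mL r') (mL (- r')%R)
  (fun _ => k0 _) (fun _ => k0 _) (fun _ => k0 _).
rewrite even.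
set I := (X in _ <= _ * X + _); move=> H.
have {}H : \int[mu]_v k (W *m (planeM e f a b r *m v))%R <= t%:E * I + (1 - t)%:E * I.
  apply: H => v.
  have -> : (W *m (planeM e f a b r *m v) =
     t *: (W *m (planeM e f a b r' *m v)) + (1 - t) *: (W *m (planeM e f a b (- r') *m v)))%R.
    rewrite !scalemxAr -mulmxDr; congr (_ *m _)%R; rewrite !planeME !dotpZr.
    by rewrite -tr; apply/matrixP => i j; rewrite !mxE; ring.
  exact: ck.
apply: le_trans H _; have I0 : 0 <= I by apply: integral_ge0.
rewrite -ge0_muleDl.
- by rewrite -EFinD addrC subrK mul1e.
- by case/andP: t01 => /ltW.
- by case/andP: t01 => _ /ltW; rewrite lee_fin subr_ge0.
Qed.

Lemma circ_convex x y t : (0 < t < 1)%R ->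
  circ k (t *: x + (1 - t) *: y)%R <= t%:E * circ k x + (1 - t)%:E * circ k y.
Proof.
move=> t01; have [t0 t1] := andP t01.
have [H [a [b [oH He yE]]]] := frame_exists x y.
pose W := (rotp x *m H)%R.
have oW : is_orth W by apply: is_orthM => //; exact: rotp_orth.
have xE : x = (W *m (enorm x *: e + 0 *: f))%R.
  by rewrite scale0r addr0 -scalemxAr -mulmxA He rotpE.
pose z := (t *: x + (1 - t) *: y)%R.
have zE : z = (W *m ((t * enorm x + (1 - t) * a) *: e + (t * 0 + (1 - t) * b) *: f))%R.
  rewrite /z {1}xE yE !scalemxAr -mulmxDr; congr (_ *m _)%R.
  by apply/matrixP => i j; rewrite !mxE; ring.
have zr : (enorm z <= t * enorm x + (1 - t) * enorm y)%R.
  rewrite (le_trans (enormD _ _))// !enormZ !gtr0_norm ?subr_gt0//.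
rewrite -/z (circ_frame oW xE) (circ_frame oW yE) (circ_frame oW zE).
(* Raising the third parameter from [|z|] to the combination of the norms makes the matrix the exact
   convex combination of those of [x] and [y]. *)
apply: le_trans (spread_mono _ _ _ (enorm_ge0 _) zr) _.
apply: le_integral_comb => //; try by under eq_fun do rewrite mulmxA; exact: mkM.
move=> v.
have -> : (W *m (planeM e f (t * enorm x + (1 - t) * a) (t * 0 + (1 - t) * b)
      (t * enorm x + (1 - t) * enorm y) *m v) =
    t *: (W *m (planeM e f (enorm x) 0 (enorm x) *m v)) +
    (1 - t) *: (W *m (planeM e f a b (enorm y) *m v)))%R.
  rewrite !scalemxAr -mulmxDr; congr (_ *m _)%R; rewrite !planeME !dotpZr.
  by apply/matrixP => i j; rewrite !mxE; ring.
exact: ck.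
Qed.

(** Fatou along a sequence [y j] tending to [x] and violating the claim. The frames of the [y j]
    need not converge, so each integrand is first composed with a map that preserves [mu]. *)
Lemma circ_lsc : lower_semicontinuous (circ k).
Proof.
move=> x a ax; apply: contrapT => nV.
have /choice[y yP] : forall j : nat, exists y,
    (enorm (y - x) < j.+1%:R^-1)%R /\ circ k y <= a%:E.
  move=> j; apply: contrapT => ny; apply: nV.
  exists [set y | enorm (y - x) < j.+1%:R^-1]%R.
    by apply/nbhs_enormP; exists (j.+1%:R^-1)%R.
  by move=> y yx; rewrite ltNge; apply/negP => ya; apply: ny; exists y.
have /choice[F FP] : forall j, exists p : 'M[R]_n * R * R,
   [/\ is_orth p.1.1, (p.1.1 *m e)%R = e &
      y j = (rotp x *m p.1.1 *m (p.1.2 *: e + p.2 *: f))%R].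
  by move=> j; have [H [b [c HH]]] := frame_exists x (y j); exists (H, b, c).
pose W j := (rotp x *m (F j).1.1)%R.
have oW j : is_orth (W j) by apply: is_orthM; [exact: rotp_orth|have [] := FP j].
(* [V j] fixes [e], and [W j *m V j] is [rotp x] for every [j]. Hence [L j v] differs from the
   integration point at [x] only through the plane matrix, whose parameters converge. *)
pose V j := ((W j)^T *m rotp x)%R.
have oV j : is_orth (V j) by apply: is_orthM; [exact: is_orth_tr|exact: rotp_orth].
have WeE j : (W j *m e = rotp x *m e)%R by rewrite -mulmxA; have [_ -> _] := FP j.
have Ve j : (V j *m e)%R = e by rewrite /V -mulmxA -(WeE j) mulmxA oW mul1mx.
pose M j := planeM e f (F j).1.2 (F j).2 (enorm (y j)).
pose L j (v : 'cV[R]_n) := (W j *m (M j *m (V j *m v)))%R.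
have LE j : circ k (y j) = \int[mu]_v k (L j v).
  have [_ _ yE] := FP j; rewrite (circ_frame (oW j) yE).
  rewrite -(orth_inv mu_invariant n3 e1 (oV j) (Ve j) _ (fun _ => k0 _))//.
  by under eq_fun do rewrite mulmxA; exact: mkM.
have Ldist j (v : 'cV[R]_n) : (enorm (L j v - enorm x *: (rotp x *m v)) <= 7 * enorm v * j.+1%:R^-1)%R.
  have [_ _ yE] := FP j; have [yx _] := yP j.
  have VE : (rotp x *m v = W j *m (V j *m v))%R.
    by rewrite /V !mulmxA (mulmx1C (oW j)) mul1mx.
  have xE : x = (W j *m (enorm x *: e))%R by rewrite -scalemxAr WeE rotpE.
  have dE : (y j - x = W j *m (((F j).1.2 - enorm x) *: e + (F j).2 *: f))%R.
    rewrite [in LHS]xE [in LHS]yE -mulmxBr; congr (_ *m _)%R.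
    by apply/matrixP => i l; rewrite !mxE; ring.
  have nE : (((F j).1.2 - enorm x) ^+ 2 + (F j).2 ^+ 2 = enorm (y j - x) ^+ 2)%R.
    by rewrite dE enorm_is_orth// enorm_sqr planeN.
  have d0 := enorm_ge0 (y j - x)%R.
  have ha : (`|(F j).1.2 - enorm x| <= enorm (y j - x))%R.
    by rewrite -(@ler_pXn2r _ 2)// ?nnegrE// real_normK ?num_real// -nE lerDl sqr_ge0.
  have hb : (`|(F j).2| <= enorm (y j - x))%R.
    by rewrite -(@ler_pXn2r _ 2)// ?nnegrE// real_normK ?num_real// -nE lerDr sqr_ge0.
  have hr : (`|enorm (y j) - enorm x| <= enorm (y j - x))%R.
    by rewrite ler_norml lerNl opprB {1}enormBC !enormB.
  have -> : (L j v - enorm x *: (rotp x *m v) =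
     W j *m (planeM e f ((F j).1.2 - enorm x) (F j).2 (enorm (y j) - enorm x) *m (V j *m v)))%R.
    rewrite VE /L /M scalemxAr -mulmxBr; congr (_ *m _)%R; rewrite !planeME.
    by apply/matrixP => i l; rewrite !mxE; ring.
  rewrite enorm_is_orth//; apply: le_trans (enorm_planeM_le _ _ _ _ _ _) _ => //.
  rewrite enorm_is_orth//.
  have v0 := enorm_ge0 v.
  apply: (@le_trans _ _ (7 * enorm (y j - x) * enorm v)%R).
    rewrite ler_wpM2r//; lra.
  rewrite -!mulrA ler_pM2l// mulrC ler_wpM2l//; exact: ltW.
have Lcvg (v : 'cV[R]_n) : L j v @[j --> \oo] --> (enorm x *: (rotp x *m v))%R.
  apply/cvg_enormP => d d0.
  have B0 : (0 < 7 * enorm v + 1)%R by rewrite ltr_wpDl// mulr_ge0 ?enorm_ge0.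
  near=> j.
  apply: le_lt_trans (Ldist j v) _.
  apply: (@le_lt_trans _ _ ((7 * enorm v + 1) * j.+1%:R^-1)%R).
    by rewrite ler_wpM2r// lerDl.
  rewrite mulrC -ltr_pdivlMr//; near: j.
  exact: near_infty_natSinv_lt (PosNum (divr_gt0 d0 B0)).
have mL j : measurable_fun setT (fun v => k (L j v)).
  by rewrite /L; under eq_fun do rewrite 2!mulmxA; exact: mkM.
move: ax; rewrite ltNge => /negP; apply.
apply: (@le_trans _ _ (limn_einf (fun j => \int[mu]_v k (L j v)))); last first.
  by apply: limn_einf_le => j; rewrite -LE; have [] := yP j.
apply: le_trans (fatou mu measurableT mL (fun j v _ => k0 _)).
apply: ge0_le_integral => //.
- rewrite /limn_einf; apply: (measurableT_comp (f := -%E)) => //.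
  apply: (measurable_fun_limn_esup (f := fun j v => - k (L j v))) => j.
  exact: (measurableT_comp (f := -%E)).
- by move=> v _; exact: (lsc_le_limn_einf lk (Lcvg v)).
Unshelve. all: by end_near. Qed.

End frame.

Lemma circ_le (M : R) r : (0 <= M)%R -> (forall y, enorm y = enorm r -> k y <= M%:E) ->
  circ k r <= M%:E.
Proof.
move=> M0 kM; rewrite /circ -integral_sphere//.
apply: (@le_trans _ _ (\int[mu]_(v in @sphere R n) cst M%:E v)).
  apply: ge0_le_integral => //.
  - exact: measurable_sphere.
  - by apply: measurable_funTS; exact: mkMZ.
  - move=> v /= v1; apply: kM; rewrite enormZ ger0_norm ?enorm_ge0//.
    by rewrite enorm_is_orth ?v1 ?mulr1//; exact: rotp_orth.
rewrite integral_cst//; last exact: measurable_sphere.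
have /eqP := mu_sphere; rewrite eq_le => /andP[S1 _].
by rewrite -[leRHS]mule1; apply: lee_wpmul2l; [rewrite lee_fin|exact: S1].
Qed.

Lemma circ_ge0 x : 0 <= circ k x.
Proof. by apply: integral_ge0. Qed.

Lemma integral_circ : measurable_fun setT (circ k) ->
  \int[@gauss_measure R n]_x circ k x = \int[@gauss_measure R n]_x k x.
Proof.
move=> mc; pose G : probability 'cV[R]_n R := @gauss_measure R n.
have [d [T [P [U [mU oU hU]]]]] := haar_exists R n.
have Pcst c : 0 <= c -> \int[P]_t c = c.
  move=> c0; rewrite (_ : (fun _ => c) = cst c)// integral_cst//.
  by rewrite -[RHS]mule1; congr (_ * _); exact: probability_setT.
have avg (h : 'cV[R]_n -> \bar R) : measurable_fun setT h -> (forall x, 0 <= h x) ->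
    \int[G]_x h x = \int[P]_t \int[G]_x h (U t *m x)%R.
  move=> mh h0; rewrite -[LHS]Pcst; last exact: integral_ge0.
  by apply: eq_integral => t _; rewrite (ge0_integral_gauss_orth (oU t) mh h0).
have circU t x : circ k (U t *m x)%R = \int[mu]_v k (U t *m (enorm x *: (rotp x *m v)))%R.
  rewrite (@circE (U t *m rotp x)%R).
  - by apply: eq_integral => v _; rewrite enorm_is_orth// -scalemxAr mulmxA.
  - by apply: is_orthM => //; exact: rotp_orth.
  - by rewrite enorm_is_orth// -mulmxA scalemxAr rotpE.
have mrot : measurable_fun setT (fun p : 'cV[R]_n * 'cV[R]_n => enorm p.1 *: (rotp p.1 *m p.2))%R.
  apply: measurable_fun_scale; first exact: measurable_fun_enorm.
  by apply: measurable_fun_mulmx => // i j; exact: (measurableT_comp (measurable_rotp i j)).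
have mtxv : measurable_fun setT (fun p : (T * 'cV[R]_n) * 'cV[R]_n =>
    k (U p.1.1 *m (enorm p.1.2 *: (rotp p.1.2 *m p.2)))%R).
  apply: (measurableT_comp mk); apply: measurable_fun_mulmx => [i j|].
    by apply: (measurableT_comp (mU i j)); exact: measurableT_comp.
  have mp : measurable_fun setT (fun p : (T * 'cV[R]_n) * 'cV[R]_n => (p.1.2, p.2)).
    apply/measurable_fun_pairP; split; last exact: measurable_snd.
    exact: (measurableT_comp measurable_snd measurable_fst).
  exact: (measurableT_comp mrot mp).
have mtx : measurable_fun setT (fun p : T * 'cV[R]_n =>
    \int[mu]_v k (U p.1 *m (enorm p.2 *: (rotp p.2 *m v)))%R).
  exact: (@measurable_fun_integral2 _ _ _ _ R mu
    (fun (p : T * 'cV[R]_n) v => k (U p.1 *m (enorm p.2 *: (rotp p.2 *m v)))%R) mtxv).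
have mUx : measurable_fun setT (fun p : T * 'cV[R]_n => k (U p.1 *m p.2)%R).
  apply: (measurableT_comp mk); apply: measurable_fun_mulmx => // i j.
  exact: (measurableT_comp (mU i j)).
rewrite (avg _ mc circ_ge0) (avg _ mk k0).
under eq_integral => t _ do under eq_integral => x _ do rewrite circU.
rewrite (@exchange_integral _ _ _ _ R P G (fun t x =>
  \int[mu]_v k (U t *m (enorm x *: (rotp x *m v)))%R) mtx); last first.
  by move=> t x; apply: integral_ge0.
rewrite [RHS](@exchange_integral _ _ _ _ R P G (fun t x => k (U t *m x)%R) mUx (fun _ _ => k0 _)).
apply: eq_integral => x _.
have mtv : measurable_fun setT (fun p : T * 'cV[R]_n =>
    k (U p.1 *m (enorm x *: (rotp x *m p.2)))%R).
  apply: (measurableT_comp mk); apply: measurable_fun_mulmx => [i j|].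
    exact: (measurableT_comp (mU i j)).
  apply: measurable_fun_scale => //; apply: (measurableT_comp (measurable_mulmx (rotp x))) => //.
rewrite (@exchange_integral _ _ _ _ R P mu (fun t v =>
  k (U t *m (enorm x *: (rotp x *m v)))%R) mtv (fun _ _ => k0 _)).
have c0 : 0 <= \int[P]_t k (U t *m x)%R by apply: integral_ge0.
transitivity (\int[mu]_v cst (\int[P]_t k (U t *m x)%R) v); last first.
  rewrite integral_cst// -[RHS]mule1; congr (_ * _); exact: probability_setT.
(* For [v] on the sphere, [|x| rotp x v] has the norm of [x], so its average over the random matrix
   is that of [x] itself. *)
apply: integral_sphere_eq => //.
- have mvt : measurable_fun setT (fun p : 'cV[R]_n * T =>
    k (U p.2 *m (enorm x *: (rotp x *m p.1)))%R).
    apply: (measurableT_comp mk); apply: measurable_fun_mulmx => [i j|].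
      exact: (measurableT_comp (mU i j)).
    by apply: measurable_fun_scale => //; apply: (measurableT_comp (measurable_mulmx (rotp x))).
  exact: (@measurable_fun_integral2 _ _ _ _ R P (fun v t =>
    k (U t *m (enorm x *: (rotp x *m v)))%R) mvt).
- by move=> v; apply: integral_ge0.
- move=> v v1; apply: hU => //.
  by rewrite enormZ ger0_norm ?enorm_ge0// enorm_is_orth ?v1 ?mulr1//; exact: rotp_orth.
Qed.

End circ_theory.

End circ.

(** * Affine tilts of convex functions *)

Section integral_sum.
Local Open Scope ereal_scope.
Context d (T : measurableType d) (R : realType) (mu : {measure set T -> \bar R}).

(** Additivity with [k] possibly of infinite integral. The negative part of the sum is dominated by
    [|g|], and [k <= (k + g) + |g|] forces its positive part to have infinite integral when [k]
    does. *)
Lemma integral_ge0D_integrable (D : set T) (k : T -> \bar R) (g : T -> R) :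
  measurable D -> measurable_fun D k -> (forall x, 0 <= k x) ->
  mu.-integrable D (EFin \o g) ->
  \int[mu]_(x in D) (k x + (g x)%:E) =
  \int[mu]_(x in D) k x + \int[mu]_(x in D) (g x)%:E.
Proof.
move=> mD mk k0 ig.
have mg : measurable_fun D (EFin \o g) := measurable_int _ ig.
have [koo|] := ltP (\int[mu]_(x in D) k x) +oo.
  apply: (integralD mD _ ig); apply/integrableP; split => //.
  by under eq_integral => x _ do rewrite gee0_abs//.
rewrite leye_eq => /eqP koo.
have /integrableP[_ gfin] := ig.
have gint : \int[mu]_(x in D) (g x)%:E \is a fin_num by exact: (integrable_fin_num mD ig).
rewrite koo addye; last by case: (\int[mu]_(x in D) _) gint.
pose F x := k x + (g x)%:E.
have mF : measurable_fun D F by exact: emeasurable_funD.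
have mFp : measurable_fun D F^\+ by exact: measurable_funepos.
have mFn : measurable_fun D F^\- by exact: measurable_funeneg.
have mag : measurable_fun D (fun x => `|(g x)%:E|) by exact: measurableT_comp.
have Fn : \int[mu]_(x in D) F^\- x < +oo.
  apply: le_lt_trans gfin; apply: ge0_le_integral => //.
  move=> x Dx; rewrite funenegE ge_max abse_ge0 andbT /F.
  move: (k0 x); case: (k x) => [r| |] //=; last by rewrite leNye.
  by rewrite !lee_fin => r0; have := ler_norm (- g x)%R; rewrite normrN; lra.
have Fp : \int[mu]_(x in D) F^\+ x = +oo.
  apply/eqP; rewrite eq_le leey /= leNgt; apply/negP => lt.
  have := lte_add_pinfty lt gfin; rewrite ltNge => /negP; apply.
  rewrite -ge0_integralD// -koo; apply: ge0_le_integral => //.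
  - by apply: emeasurable_funD.
  move=> x Dx; apply: (@le_trans _ _ (F x + `|(g x)%:E|)).
    rewrite /F; move: (k0 x); case: (k x) => [r| |] //= _.
    by rewrite !lee_fin; have := ler_norm (- g x)%R; rewrite normrN; lra.
  by apply: leeD => //; rewrite funeposE le_max lexx.
rewrite -[LHS]/(\int[mu]_(x in D) F x) integralE Fp addye//.
by case: (\int[mu]_(x in D) F^\- x) Fn.
Qed.

End integral_sum.

Section gauss_more.
Context (R : realType) (n : nat).
Local Notation G := (@gauss_measure R n).
Local Open Scope ereal_scope.

(** The ball contains a box of positive volume on which the density is at least [m]. *)
Lemma gauss_ball_gt0 (x0 : 'cV[R]_n) (d : R) : (0 < d)%R ->
  0 < G [set y | enorm (y - x0) < d]%R.
Proof.
move=> d0; pose c := (d / n.+1%:R)%R.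
have c0 : (0 < c)%R by rewrite divr_gt0.
pose B := [set x : 'cV[R]_n | forall i, x i ord0 \in `[(x0 i ord0 - c)%R, (x0 i ord0 + c)%R]].
have mB : measurable B.
  rewrite (_ : B = \bigcap_(i in [set: 'I_n]) (@coord_cV R n i @^-1`
      `[(x0 i ord0 - c)%R, (x0 i ord0 + c)%R]%classic)).
    apply: fin_bigcap_measurable; first exact: finite_finset.
    by move=> i _; rewrite -[X in measurable X]setTI; apply: measurable_coord_cV.
  by apply/seteqP; split => [x H i _|x H i]; [exact: H|exact: (H i I)].
have Bd y : B y -> (enorm (y - x0) < d)%R.
  move=> By; apply: (le_lt_trans (enorm_le_sum _)).
  apply: (@le_lt_trans _ _ (\sum_(i < n) c)%R).
    apply: ler_sum => i _; have := By i; rewrite in_itv/= !mxE => /andP[h1 h2].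
    by rewrite ler_norml; apply/andP; split; lra.
  rewrite sumr_const card_ord -[ltLHS]mulr_natr /c mulrAC ltr_pdivrMr//.
  by rewrite ltr_pM2l// ltr_nat.
have mball : measurable [set y | enorm (y - x0) < d]%R.
  rewrite (_ : mkset _ = (fun y => enorm (y - x0)%R) @^-1` `]-oo, d[%classic).
    rewrite -[X in measurable X]setTI; apply: measurable_fun_enorm => //.
    exact: measurable_fun_addcV.
  by apply/seteqP; split => y /=; rewrite in_itv.
apply: (@lt_le_trans _ _ (G B)); last first.
  by apply: le_measure; rewrite ?inE.
pose r := (enorm x0 + d)%R.
have r0 : (0 <= r)%R by rewrite addr_ge0 ?enorm_ge0// ltW.
pose m := (((2 * pi) `^ (n%:R / 2))^-1 * expR (- (r ^+ 2 / 2)) : R)%R.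
have m0 : (0 < m)%R by rewrite mulr_gt0 ?expR_gt0// invr_gt0 powR_gt0// mulr_gt0// pi_gt0.
have LB : lebesgue_cV R n B = (\prod_(i < n) (2 * c))%:E.
  have H := @lebesgue_cV_box R n (fun i => x0 i ord0 - c)%R (fun i => x0 i ord0 + c)%R.
  apply: etrans (H _) _ => [i|]; first lra.
  by congr (_%:E); apply: eq_bigr => i _; ring.
apply: (@lt_le_trans _ _ (\int[lebesgue_cV R n]_(x in B) cst m%:E x)).
  have /eqP := LB; rewrite eq_le => /andP[_ LB'].
  rewrite integral_cst//; apply: mule_gt0; first by rewrite lte_fin.
  apply: (lt_le_trans _ LB'); rewrite lte_fin prodr_gt0// => i _.
  by rewrite mulr_gt0.
apply: ge0_le_integral => //.
- by move=> x _; rewrite lee_fin ltW.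
- by apply: measurable_funTS; apply/measurable_EFinP; exact: measurable_gauss_pdf.
move=> x Bx; rewrite lee_fin ler_pM2l ?invr_gt0 ?powR_gt0 ?mulr_gt0 ?pi_gt0// ler_expR lerN2.
rewrite ler_pM2r ?invr_gt0// lerXn2r ?nnegrE ?enorm_ge0// /r.
rewrite -(subrK x0 x) (le_trans (enormD _ _))// addrC lerD2l ltW//.
exact: Bd.
Qed.

(** The linear part is odd: the map [x -> - x] exchanges its positive and negative parts.
    Integrability comes from the second moment. *)
Lemma gauss_linear (y0 : 'cV[R]_n) r0 :
  G.-integrable setT (fun x => (dotp x y0 - r0)%:E) /\
  \int[G]_x (dotp x y0 - r0)%:E = (- r0)%:E.
Proof.
have mlin : measurable_fun setT (fun x : 'cV[R]_n => dotp x y0).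
  exact: measurable_fun_dotp.
have mE : measurable_fun setT (fun x : 'cV[R]_n => (dotp x y0)%:E) by apply/measurable_EFinP.
have msq : measurable_fun setT (fun x : 'cV[R]_n => (enorm x ^+ 2)%:E).
  by apply/measurable_EFinP; apply: measurable_funX; exact: measurable_fun_enorm.
have GT : \int[G]_x (1 : \bar R) = 1.
  rewrite (_ : (fun=> 1) = cst 1)// integral_cst// mul1e; exact: gauss_measureT.
have i1 : G.-integrable setT (fun x => (dotp x y0)%:E).
  apply/integrableP; split => //.
  apply: (@le_lt_trans _ _ (\int[G]_x ((enorm y0)%:E * (1 + (enorm x ^+ 2)%:E)))).
    apply: ge0_le_integral => //.
    - exact: measurableT_comp.
    - by apply: measurable_funeM; exact: emeasurable_funD.
    move=> x _; rewrite -EFinD -EFinM lee_fin; apply: le_trans (dotp_norm _ _) _.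
    rewrite mulrC ler_wpM2l ?enorm_ge0//.
    by have := sqr_ge0 (enorm x - 1)%R; have := sqr_ge0 (enorm x); rewrite !expr2; lra.
  have sq0 x : 0 <= (enorm (x : 'cV[R]_n) ^+ 2)%:E by rewrite lee_fin sqr_ge0.
  have mS1 : measurable_fun setT (fun x : 'cV[R]_n => 1 + (enorm x ^+ 2)%:E).
    exact: emeasurable_funD.
  have p1 x : 0 <= 1 + (enorm (x : 'cV[R]_n) ^+ 2)%:E by exact: adde_ge0.
  have ey0 : 0 <= (enorm y0)%:E by rewrite lee_fin enorm_ge0.
  rewrite (@ge0_integralZl _ _ _ G setT measurableT _ mS1 _ (fun x _ => p1 x) ey0).
  by rewrite ge0_integralD// GT gauss_second_moment -EFinD -EFinM ltry.
have ic : G.-integrable setT (cst (- r0)%:E).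
  by apply: finite_measure_integrable_cst.
split; first by under eq_fun do rewrite EFinD; exact: integrableD.
under eq_integral do rewrite EFinD.
rewrite (integralD measurableT i1 ic).
have -> : \int[G]_x (dotp x y0)%:E = 0.
  pose F := (fun x : 'cV[R]_n => (dotp x y0)%:E).
  have mFp : measurable_fun setT F^\+ by exact: measurable_funepos.
  have oN : is_orth (- 1%:M : 'M[R]_n)%R by apply: is_orthN; exact: is_orth1.
  have FN x : F^\+ (- 1%:M *m x)%R = F^\- x.
    by rewrite funeposE funenegE /F mulNmx mul1mx dotpNl.
  have E := ge0_integral_gauss_orth oN mFp (fun x => funepos_ge0 _ _).
  transitivity (\int[G]_x F^\- x - \int[G]_x F^\- x).
    rewrite -[LHS]/(\int[G]_x F x) integralE; congr (_ - _); apply: (etrans (esym E)).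
    by apply: eq_integral => x _; exact: FN.
  by rewrite subee//; exact: (integrable_neg_fin_num measurableT i1).
rewrite add0e integral_cst// -[RHS]mule1; congr (_ * _); exact: gauss_measureT.
Qed.

End gauss_more.

Section cvx_more.
Context (R : realType) (n : nat).
Implicit Types (phi k : 'cV[R]_n -> \bar R).
Local Open Scope ereal_scope.

Lemma Cvx_addr k c : Cvx k -> Cvx (fun x => k x + c%:E).
Proof.
move=> [kNy [x0 x0y] lk ck]; split.
- by move=> x; have := kNy x; case: (k x).
- by exists x0; move: x0y; case: (k x0).
- move=> x a ax.
  have sh u : (a%:E < u + c%:E) = ((a - c)%:E < u).
    by case: u => [r| |]//=; rewrite ?ltry// -EFinD !lte_fin ltrBlDr.
  by move: ax; rewrite sh => /lk[V xV VH]; exists V => // y /VH; rewrite sh.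
- move=> x y t t01; have [t0 t1] := andP t01.
  apply: le_trans (leeD2r _ (ck x y t t01)) _.
  have := kNy x; have := kNy y; have t1' : (0 < 1 - t)%R by rewrite subr_gt0.
  case: (k x) => [a| |] //; case: (k y) => [b| |] // _ _ /=;
    rewrite ?gt0_muley ?lte_fin// ?addye ?addey ?leey//.
  by rewrite -!EFinM -!EFinD lee_fin; lra.
Qed.

(** A finite value [phi y0 = r0] gives the affine minorant [x . y0 - r0] of the transform.
    Translating [phi] so that this point becomes the origin with value 0 makes the minorant zero. *)
Lemma legendre_decomposition phi : Cvx phi ->
  (forall M : R, exists r : R, forall x, (r < enorm x)%R -> M%:E < phi x) ->
  exists k y0 (r0 a M : R), [/\ Cvx k, (forall x, 0 <= k x), (0 < a)%R,
    (forall x, (enorm x <= a)%R -> k x <= M%:E) &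
    forall x, legendre phi x = k x + (dotp x y0 - r0)%:E].
Proof.
move=> Cphi coer; have [a [b [a0 low]]] := coercive_growth Cphi coer.
have [y0 [r0 y0r]] := Cvx_finite_pt Cphi.
have [phiNy _ _ _] := Cphi.
pose psi y := phi (y + y0)%R - r0%:E.
have psi0 : psi 0%R = 0 by rewrite /psi add0r y0r -EFinB subrr.
have psiNy y : psi y != -oo by rewrite /psi; have := phiNy (y + y0)%R; case: (phi _).
(* For [|x| <= a] the growth [phi >= a |.| - b] absorbs [x . y], up to the translation cost
   [a |y0|]. *)
pose k := legendre psi; pose M := (a * enorm y0 + b + r0)%R.
have k0 x : 0 <= k x.
  by apply: le_trans (legendre_ge psi x 0%R); rewrite psi0 dotp0r sube0.
have kM x : (enorm x <= a)%R -> k x <= M%:E.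
  move=> xa; apply: legendre_le => y; have := low (y + y0)%R; rewrite /psi.
  case: (phi _) => [r| |] //; last by rewrite leNye.
  rewrite lee_fin -!EFinB lee_fin => H.
  have h1 : (dotp x y <= a * enorm y)%R.
    by apply: le_trans (cauchy_schwarz _ _) _; rewrite ler_wpM2r ?enorm_ge0.
  have h2 : (enorm y <= enorm (y + y0) + enorm y0)%R.
    by rewrite -(enormN y0) -{1}(addrK y0 y); exact: enormD.
  have h3 : (a * enorm y <= a * (enorm (y + y0) + enorm y0))%R by rewrite ler_pM2l.
  rewrite /M; lra.
exists k, y0, r0, a, M; split => //.
- apply: legendre_Cvx => //; first by exists 0%R, 0%R.
  by exists 0%R, M; apply: kM; rewrite enorm0 ltW.
- move=> x; apply/eqP; rewrite eq_le; apply/andP; split.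
    apply: legendre_le => y; have := legendre_ge psi x (y - y0)%R.
    rewrite /psi subrK -/psi -/k; case: (k x) => [q| |]; case: (phi y) => [r| |] //=;
      rewrite ?leNye ?leey//.
    by rewrite !dotp_lin -!EFinB -EFinD !lee_fin; lra.
  have := k0 x; rewrite /k => _.
  rewrite -leeBrDr//; apply: legendre_le => y; have := legendre_ge phi x (y + y0)%R.
  rewrite /psi; case: (legendre phi x) => [q| |]; case: (phi _) => [r| |] //=;
    rewrite ?leNye ?leey//.
  by rewrite !dotp_lin -!EFinB !lee_fin; lra.
Qed.

End cvx_more.

(** * Identification of [circledast] with [circ] up to a constant *)

Section circledast_circ.
Context (R : realType) (n : nat) (n3 : (3 <= n)%N).
Context (e : 'cV[R]_n) (e1 : enorm e = 1) (mu : probability 'cV[R]_n R).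
Hypothesis mu_sphere : mu (@sphere R n) = 1%E.
Hypothesis mu_invariant : forall A : 'M[R]_n,
     special_orthogonal A -> A *m e = e ->
     forall B : set 'cV[R]_n, measurable B -> mu (mulmx A @^-1` B) = mu B.
Hypothesis mu_centered :
  \col_(i < n) (\int[mu]_(v in @sphere R n) v i ord0) = 0.
Local Open Scope ereal_scope.

Let mS := @measurable_sphere R n.
Let muS_fin : mu (@sphere R n) < +oo.
Proof. by have /eqP := mu_sphere; rewrite eq_le => /andP[S1 _]; apply: (le_lt_trans S1); rewrite ltry. Qed.

Let icoord i : mu.-integrable (@sphere R n) (fun v => (v i ord0)%:E).
Proof.
apply: measurable_bounded_integrable => //.
  by apply: measurable_funTS; exact: measurable_coord_cV.
exists 1%R; split => // M M1 v /= v1.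
by rewrite (le_trans (coord_le_enorm v i))// v1 ltW.
Qed.

(** The centre of mass at the origin enters here: it removes the linear part of the minorant. *)
Lemma sphere_linear (w : 'cV[R]_n) c :
  mu.-integrable (@sphere R n) (fun v => (dotp v w + c)%:E) /\
  \int[mu]_(v in @sphere R n) (dotp v w + c)%:E = c%:E.
Proof.
have E v : (dotp v w + c)%:E = \sum_(i < n) (w i ord0)%:E * (v i ord0)%:E + cst c%:E v.
  by rewrite EFinD /dotp sumEFin; congr (_%:E + _); apply: eq_bigr => i _; rewrite mulrC.
have iw i : mu.-integrable (@sphere R n) (fun v => (w i ord0)%:E * (v i ord0)%:E).
  exact: integrableZl.
have isum : mu.-integrable (@sphere R n) (fun v => \sum_(i < n) (w i ord0)%:E * (v i ord0)%:E).
  by apply: integrable_sum.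
have ic : mu.-integrable (@sphere R n) (cst c%:E).
  by apply: finite_measure_integrable_cst.
split; first by under eq_fun do rewrite E; exact: integrableD.
under eq_integral do rewrite E.
rewrite (integralD mS isum ic) integral_sum// big1 ?add0e => [|i _].
  rewrite integral_cst// -[RHS]mule1; congr (_ * _); exact: mu_sphere.
rewrite integralZl//.
have /matrixP/(_ i ord0) := mu_centered; rewrite !mxE /Rintegral => H.
by rewrite -(fineK (integrable_fin_num mS (icoord i))) H mule0.
Qed.

Variables (k : 'cV[R]_n -> \bar R) (y0 : 'cV[R]_n) (r0 a M : R).
Hypotheses (Ck : Cvx k) (k0 : forall x, 0 <= k x) (a0 : (0 < a)%R).
Hypothesis kM : forall x, (enorm x <= a)%R -> k x <= M%:E.

Let lk : lower_semicontinuous k. Proof. by case: Ck. Qed.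
Let mk : measurable_fun setT k. Proof. exact: lsc_measurable_cV. Qed.

Lemma orth_frame_exists : exists f : 'cV[R]_n, dotp f f = 1%R /\ dotp e f = 0%R.
Proof.
have n1 : (0 < n)%N by apply: leq_trans n3.
have n2 : (1 < n)%N by apply: leq_trans n3.
pose d0 : 'cV[R]_n := delta_mx (Ordinal n1) ord0.
pose d1 : 'cV[R]_n := delta_mx (Ordinal n2) ord0.
pose W := householder (d0 - e)%R.
have oW : is_orth W by exact: householder_is_orth.
have We : (W *m d0)%R = e.
  by apply: householder_swap; rewrite e1 /enorm dotp_delta eqxx sqrtr1.
exists (W *m d1)%R; split; first by rewrite dotp_is_orth// dotp_delta eqxx.
by rewrite -We dotp_is_orth// dotp_delta.
Qed.

Lemma Cvx_circ : Cvx (circ e mu k).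
Proof.
have [f [ff ef]] := orth_frame_exists.
have [_ _ _ ck] := Ck; split.
- by move=> x; rewrite gt_eqF// (lt_le_trans _ (circ_ge0 e mu k0 x)).
- exists 0%R; rewrite circ_at0 lt_eqF//.
  by apply: (le_lt_trans (kM _)); rewrite ?ltry// enorm0 ltW.
- exact: (circ_lsc n3 e1 mu_invariant k0 lk ff ef).
- exact: (circ_convex n3 e1 mu_invariant k0 lk ff ef ck).
Qed.

(** The set from which [rotation_to] chooses is nonempty: if the reflection [rotp e x] has
    determinant -1, composing it with a reflection fixing [e] gives a rotation. *)
Lemma rotation_to_spec (x : 'cV[R]_n) : x != 0%R ->
  is_orth (rotation_to e x) /\ (enorm x *: (rotation_to e x *m e) = x)%R.
Proof.
move=> x0; have ex : enorm x != 0%R by rewrite enorm_eq0.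
suff [A HA] : exists A, special_orthogonal A /\ (A *m e = (enorm x)^-1 *: x)%R.
  have [[oA _] Ae] := @xgetPex _ 1%:M%R [set A | special_orthogonal A /\
      (A *m e = (enorm x)^-1 *: x)%R] (ex_intro _ A HA).
  by split => //; rewrite Ae scalerA divff// scale1r.
have Re : (rotp e x *m e = (enorm x)^-1 *: x)%R.
  by apply: (scalerI ex); rewrite rotpE// scalerA divff// scale1r.
have oR := rotp_orth e x.
have [dR|dR] := is_orth_det oR; first by exists (rotp e x).
have [f [ff ef]] := orth_frame_exists.
have n1 : (0 < n)%N by apply: leq_trans n3.
pose d0 : 'cV[R]_n := delta_mx (Ordinal n1) ord0.
pose W := householder (d0 - f)%R.
have oW : is_orth W by exact: householder_is_orth.
have Wf : (W *m d0)%R = f.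
  by apply: householder_swap; rewrite /enorm ff dotp_delta eqxx.
exists (rotp e x *m householder f)%R; split.
  split; first by apply: is_orthM => //; exact: householder_is_orth.
  by rewrite det_mulmx dR -Wf det_householder_is_orth// mulrNN mulr1.
by rewrite -mulmxA householder_fix// dotpC.
Qed.

(** At the origin the lower limit has to be identified with the value of [circ]: convexity along the
    ray of [e] bounds it above, lower semicontinuity below. *)
Lemma circledast_decomposition :
  circledast e mu (fun x => k x + (dotp x y0 - r0)%:E) =
  (fun x => circ e mu k x + (- r0)%:E).
Proof.
have Fx x : x != 0%R ->
  \int[mu]_(v in @sphere R n) (fun z => k z + (dotp z y0 - r0)%:E)
     (enorm x *: (rotation_to e x *m v))%R = circ e mu k x + (- r0)%:E.
  move=> x0; have [oA Ax] := rotation_to_spec x0.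
  set A := rotation_to e x in oA Ax *.
  have mkA : measurable_fun setT (fun v => k (enorm x *: (A *m v))%R).
    under eq_fun do rewrite scalemxAl.
    exact: (measurableT_comp mk (measurable_mulmx _)).
  have [ig Ig] := sphere_linear (enorm x *: (A^T *m y0))%R (- r0)%R.
  have lin v : (dotp (enorm x *: (A *m v)) y0 - r0 = dotp v (enorm x *: (A^T *m y0)) - r0)%R.
    by rewrite dotpZl dotpZr dotp_mulmx.
  under eq_integral => v _ do rewrite /= lin.
  rewrite (integral_ge0D_integrable mS (measurable_funTS mkA) (fun _ => k0 _) ig) Ig.
  by rewrite (integral_sphere mu_sphere mkA (fun _ => k0 _)) -(circE n3 e1 mu_invariant k0 lk oA Ax).
apply/funext => x; rewrite /circledast; case: eqVneq => [->|]; last exact: Fx.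
have [f [ff ef]] := orth_frame_exists.
have Cc := Cvx_circ.
set F := fun x => _; rewrite limf_einfE.
have FE y : y != 0%R -> F y = circ e mu k y + (- r0)%:E by exact: Fx.
have lec : Cvx (fun x => circ e mu k x + (- r0)%:E) by exact: Cvx_addr.
have [q kq] : exists q, circ e mu k 0%R = q%:E.
  rewrite circ_at0; have := k0 0%R; have := kM (x := 0%R); rewrite enorm0 => /(_ (ltW a0)).
  by case: (k 0%R) => [q| |] //; exists q.
apply/eqP; rewrite eq_le; apply/andP; split.
  apply: ge_ereal_sup => _ [V V0 <-]; rewrite kq -EFinD.
  have /nbhs_enormP[d d0 dV] : nbhs (0%R : 'cV[R]_n) [set y | y != 0%R -> V y] by exact: V0.
  (* [N] bounds the increase of [circ] along the segment from 0 to [a e]. The parameter [t] below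
     keeps [t a e] in the neighbourhood and the increase [t N] below [eps]. *)
  pose N := (`|M| + `|q| + 1)%R.
  have N0 : (0 < N)%R by rewrite ltr_wpDl// addr_ge0.
  apply/lee_addgt0Pr => eps eps0.
  pose t : R := Num.min (1 / 2)%R (Num.min (d / (2 * a))%R (eps / N)%R).
  have t0 : (0 < t)%R by rewrite !lt_min !divr_gt0// mulr_gt0.
  have t1 : (t < 1)%R by rewrite gt_min; apply/orP; left; lra.
  have td : (t * a < d)%R.
    have : (t <= d / (2 * a))%R by rewrite !ge_min lexx !orbT.
    have ta : (0 < t * a)%R by rewrite mulr_gt0.
    by rewrite ler_pdivlMr ?mulr_gt0// => H; lra.
  have te : (t * N <= eps)%R.
    by rewrite -ler_pdivlMr// !ge_min lexx !orbT.
  pose z := (a *: e)%R.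
  have za : enorm z = a by rewrite enormZ e1 mulr1 gtr0_norm.
  have tz : (t *: z + (1 - t) *: 0 = t *: z)%R by rewrite scaler0 addr0.
  have tz0 : (t *: z != 0)%R.
    by rewrite -enorm_eq0 enormZ za gt_eqF// mulr_gt0// gtr0_norm.
  have Vtz : V (t *: z)%R.
    by apply: dV => //; rewrite subr0 enormZ za gtr0_norm.
  apply: (@le_trans _ _ (F (t *: z)%R)); first by apply: ereal_inf_lbound; exists (t *: z)%R.
  rewrite FE// -tz.
  have [_ _ _ cc] := Cc.
  have t01 : (0 < t < 1)%R by rewrite t0.
  apply: le_trans (leeD2r _ (cc z 0%R t t01)) _; rewrite kq.
  have cz : circ e mu k z <= `|M|%:E.
    apply: (circ_le e mu_sphere k0 lk) => // y yz.
    by apply: le_trans (kM _) _; [rewrite yz za|rewrite lee_fin ler_norm].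
  apply: (@le_trans _ _ (t%:E * `|M|%:E + (1 - t)%:E * q%:E + (- r0)%:E)).
    by apply: leeD2r; apply: leeD2r; apply: lee_wpmul2l => //; rewrite lee_fin ltW.
  rewrite -!EFinM -!EFinD lee_fin.
  have : (t * (- q) <= t * `|q|)%R by rewrite ler_pM2l// -normrN ler_norm.
  move: te; rewrite /N; lra.
have [_ _ lH _] := lec.
rewrite kq -EFinD; apply/lee_subgt0Pr => eps eps0; rewrite -EFinB.
have [|V V0 VH] := lH 0%R (q + - r0 - eps)%R; first by rewrite kq -EFinD lte_fin; lra.
apply: (@le_trans _ _ (ereal_inf (F @` [set y | y != 0%R /\ V y]))).
  by apply: le_ereal_inf_tmp => _ [y [yn Vy] <-]; rewrite FE// ltW// VH.
apply: ereal_sup_ubound; exists [set y | y != 0%R /\ V y] => //.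
by rewrite /dnbhs /within/=; apply: filterS V0 => y Vy yn; split.
Qed.

End circledast_circ.

(** * Jensen's inequality and its equality case *)

Lemma measurable_expeR (R : realType) : measurable_fun setT (@expeR R).
Proof.
apply: (measurability _ (ErealGenOInfty.measurableE R)).
move=> /= _ [_ [a ->]] <-; rewrite setTI preimage_itvoy.
have [a0|a0] := ltP a 0.
  rewrite (_ : [set x | _] = setT)//; apply/seteqP; split => // x _ /=.
  by apply: (lt_le_trans _ (expeR_ge0 x)); rewrite lte_fin.
rewrite (_ : [set x | _] = [set` `]lne a%:E, +oo[%O]); first exact: emeasurable_itv.
apply/seteqP; split => x /=; rewrite in_itv/= andbT.
all: by rewrite -[X in (X < expeR x)%E](@lneK R a%:E) ?lte_expeR// in_itv/= lee_fin a0 leey.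
Qed.

Section jensen.
Context (R : realType) (n : nat) (K : 'cV[R]_n -> \bar R).
Hypotheses (CK : Cvx K) (K0 : forall x, (0 <= K x)%E).
Local Notation G := (@gauss_measure R n).
Local Open Scope ereal_scope.
Variable r0 : R.

(** The normalised polar of [Psi f] divided by the Gaussian density, so its Gaussian integral is the
    argument of the logarithm. *)
Definition tilted x := expeR ((enorm x ^+ 2 / 2 + r0)%:E - K x).

Let mK : measurable_fun setT K.
Proof. by apply: lsc_measurable_cV; case: CK. Qed.

Lemma measurable_sqenorm (c : R) :
  measurable_fun setT (fun x : 'cV[R]_n => (enorm x ^+ 2 / 2 + c)%:E).
Proof.
apply/measurable_EFinP; apply: measurable_funD => //; apply: measurable_funM => //.
by apply: measurable_funX; exact: measurable_fun_enorm.
Qed.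

Lemma measurable_tilted : measurable_fun setT tilted.
Proof.
apply: (measurableT_comp (@measurable_expeR R)).
by apply: emeasurable_funB => //; exact: measurable_sqenorm.
Qed.

Lemma tilted_ge0 x : 0 <= tilted x. Proof. exact: expeR_ge0. Qed.

Lemma integral_sqenorm (c : R) : (0 <= c)%R ->
  \int[G]_x (enorm x ^+ 2 / 2 + c)%:E = (n%:R / 2 + c)%:E.
Proof.
move=> c0.
have msq : measurable_fun setT (fun x : 'cV[R]_n => (enorm x ^+ 2)%:E).
  by apply/measurable_EFinP; apply: measurable_funX; exact: measurable_fun_enorm.
have sq0 (x : 'cV[R]_n) : 0 <= (enorm x ^+ 2)%:E by rewrite lee_fin sqr_ge0.
have h0 : 0 <= 2^-1%:E :> \bar R by rewrite lee_fin invr_ge0.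
transitivity (\int[G]_x (2^-1%:E * (enorm x ^+ 2)%:E + cst c%:E x)).
  by apply: eq_integral => x _; rewrite -EFinM mulrC.
rewrite ge0_integralD//.
- rewrite (@ge0_integralZl _ _ _ G setT measurableT _ msq _ (fun x _ => sq0 x) h0).
  rewrite gauss_second_moment integral_cst//.
  have -> : c%:E * G setT = c%:E.
    by rewrite -[RHS]mule1; congr (_ * _); exact: gauss_measureT.
  by rewrite -EFinM -EFinD mulrC.
- by move=> x _; exact: mule_ge0.
- exact: measurable_funeM.
Qed.

Lemma tilted_gt0 (a M : R) : (0 < a)%R ->
  (forall x, (enorm x <= a)%R -> K x <= M%:E) -> 0 < \int[G]_x tilted x.
Proof.
move=> a0 KM; pose B := [set y : 'cV[R]_n | enorm (y - 0) < a]%R.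
have mB : measurable B.
  rewrite (_ : B = (fun y => enorm (y - 0)%R) @^-1` `]-oo, a[%classic).
    rewrite -[X in measurable X]setTI; apply: measurable_fun_enorm => //.
    exact: measurable_fun_addcV.
  by apply/seteqP; split => y /=; rewrite in_itv.
apply: (@lt_le_trans _ _ (\int[G]_(x in B) cst (expR (r0 - M))%:E x)).
  rewrite integral_cst//; apply: mule_gt0; first by rewrite lte_fin expR_gt0.
  exact: gauss_ball_gt0.
apply: (@le_trans _ _ (\int[G]_(x in B) tilted x)).
  apply: ge0_le_integral => //.
  - by move=> x _; rewrite lee_fin expR_ge0.
  - by apply: measurable_funTS; exact: measurable_tilted.
  move=> x; rewrite /B/= subr0 => /ltW /KM; rewrite /tilted; have := K0 x.
  case: (K x) => [q| |] // _; rewrite lee_fin => qM.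
  rewrite -EFinB /= lee_fin ler_expR.
  by have := sqr_ge0 (enorm x); lra.
apply: ge0_subset_integral => //; first exact: measurable_tilted.
by move=> x _; exact: tilted_ge0.
Qed.

Section finite_mean.
Variable s : R.
Hypothesis SK : \int[G]_x K x = s%:E.
(** The Gaussian mean of the exponent of [tilted]. *)
Let m : R := (n%:R / 2 + r0 - s)%R.
Let C : R := (expR m * s + expR m * (n%:R / 2))%R.

Let s0 : (0 <= s)%R.
Proof. by rewrite -lee_fin -SK; apply: integral_ge0. Qed.

(** [tilted] minus the tangent line of [exp] at [m]. Written so that [K] is only added, which is
    harmless where it is infinite. *)
Let excess x : \bar R := tilted x + (expR m)%:E * K x + (expR m * (n%:R / 2))%:E -
  (expR m)%:E * (enorm x ^+ 2 / 2 + (1 + s))%:E.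

Let E0 : 0 <= (expR m)%:E :> \bar R. Proof. by rewrite lee_fin expR_ge0. Qed.

(* The tangent inequality [expR t >= 1 + t] at the mean of the exponent. *)
Let excess_fin x q : K x = q%:E ->
  excess x = (expR m * (expR (enorm x ^+ 2 / 2 + r0 - q - m)
     - (1 + (enorm x ^+ 2 / 2 + r0 - q - m))))%:E.
Proof.
move=> Kq; rewrite /excess /tilted Kq -EFinB /= -?EFinM -?EFinD; congr (_%:E).
have -> : (enorm x ^+ 2 / 2 + r0 - q = m + (enorm x ^+ 2 / 2 + r0 - q - m))%R by ring.
rewrite expRD [in RHS]/m.
have -> : (m + (enorm x ^+ 2 / 2 + r0 - q - m) - m = enorm x ^+ 2 / 2 + r0 - q - m)%R by ring.
by rewrite /m; ring.
Qed.

Let excess_oo x : K x = +oo -> excess x = +oo.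
Proof.
move=> Koo; rewrite /excess Koo gt0_muley ?lte_fin ?expR_gt0//.
by rewrite addey// gt_eqF// (lt_le_trans _ (tilted_ge0 x)).
Qed.

Let excess_ge0 x : 0 <= excess x.
Proof.
have := K0 x; case Kx : (K x) => [q| |] // _; last by rewrite excess_oo.
rewrite (excess_fin Kx) lee_fin mulr_ge0 ?expR_ge0// subr_ge0.
exact: expR_ge1Dx.
Qed.

Let mquad := measurable_sqenorm (1 + s).

Let mexcess : measurable_fun setT excess.
Proof.
apply: emeasurable_funB; last exact: measurable_funeM.
apply: emeasurable_funD => //; apply: emeasurable_funD; first exact: measurable_tilted.
exact: measurable_funeM.
Qed.

(** The subtracted quadratic is moved to the other side, so that only nonnegative functions are
    integrated; the finite constant [C] is cancelled at the end. *)
Let excess_integral :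
  \int[G]_x tilted x = (expR m)%:E + \int[G]_x excess x.
Proof.
have s1 : (0 <= 1 + s)%R by rewrite addr_ge0.
have q0 x : 0 <= (enorm (x : 'cV[R]_n) ^+ 2 / 2 + (1 + s))%:E.
  by rewrite lee_fin addr_ge0// divr_ge0// sqr_ge0.
have n0 : (0 <= n%:R / 2 :> R)%R by rewrite divr_ge0.
have c0 : 0 <= (expR m * (n%:R / 2))%:E by rewrite lee_fin mulr_ge0// expR_ge0.
have EK0 x : 0 <= (expR m)%:E * K x by exact: mule_ge0.
have mEK : measurable_fun setT (fun x => (expR m)%:E * K x) by exact: measurable_funeM.
have Gcst c : \int[G]_x (cst c x) = c.
  by rewrite integral_cst// -[RHS]mule1; congr (_ * _); exact: gauss_measureT.
have mq : measurable_fun setT (fun x : 'cV[R]_n => (expR m)%:E * (enorm x ^+ 2 / 2 + (1 + s))%:E).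
  exact: measurable_funeM.
have LE : \int[G]_x (tilted x + (expR m)%:E * K x + cst (expR m * (n%:R / 2))%:E x) =
    \int[G]_x tilted x + C%:E.
  rewrite ge0_integralD//; first last.
  - by apply: emeasurable_funD => //; exact: measurable_tilted.
  - by move=> x _; rewrite adde_ge0// tilted_ge0.
  rewrite ge0_integralD//; first last.
  - exact: measurable_tilted.
  - by move=> x _; exact: tilted_ge0.
  rewrite (@ge0_integralZl _ _ _ G setT measurableT _ mK _ (fun x _ => K0 x) E0) SK Gcst.
  by rewrite -addeA -EFinM -EFinD.
have RE : \int[G]_x ((expR m)%:E * (enorm x ^+ 2 / 2 + (1 + s))%:E + excess x) =
    (expR m + C)%:E + \int[G]_x excess x.
  rewrite ge0_integralD//; last by move=> x _; exact: mule_ge0.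
  rewrite (@ge0_integralZl _ _ _ G setT measurableT _ mquad _ (fun x _ => q0 x) E0).
  rewrite integral_sqenorm// -EFinM; congr (_%:E + _).
  by rewrite /C; ring.
have : \int[G]_x tilted x + C%:E = (expR m + C)%:E + \int[G]_x excess x.
  rewrite -LE -RE; apply: eq_integral => x _ /=.
  by rewrite [RHS]addeC /excess subeK.
have I1 : 0 <= \int[G]_x tilted x by apply: integral_ge0 => x _; exact: tilted_ge0.
have I2 : 0 <= \int[G]_x excess x by apply: integral_ge0 => x _; exact: excess_ge0.
move: I1 I2.
case: (\int[G]_x tilted x) => [j| |] //; case: (\int[G]_x excess x) => [i| |] // _ _.
rewrite -!EFinD => -[H]; congr (_%:E); lra.
Qed.

Lemma jensen_le : (expR m)%:E <= \int[G]_x tilted x.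
Proof. by rewrite excess_integral leeDl//; exact: integral_ge0. Qed.

Let Q x : R := (enorm (x : 'cV[R]_n) ^+ 2 / 2 + (r0 - m))%R.

Let excess_eq0 x : excess x = 0 -> K x = (Q x)%:E.
Proof.
have := K0 x; case Kx : (K x) => [q| |] // _; last by rewrite excess_oo.
rewrite (excess_fin Kx) => -[/eqP]; rewrite mulf_eq0 gt_eqF ?expR_gt0//= subr_eq0.
have [t0 _|/expR_gt1Dx H] := eqVneq (enorm x ^+ 2 / 2 + r0 - q - m)%R 0%R.
  by rewrite /Q; congr (_%:E); lra.
by rewrite gt_eqF.
Qed.

(** The excess vanishes almost everywhere, hence [K = Q] on a dense set because balls have positive
    Gaussian measure. Lower semicontinuity gives [K <= Q] everywhere, and convexity excludes a
    strict inequality. *)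
Lemma jensen_eq : \int[G]_x tilted x = (expR m)%:E ->
  forall x, K x = (enorm x ^+ 2 / 2 + (r0 - m))%:E.
Proof.
rewrite excess_integral => H.
have I0 : \int[G]_x excess x = 0.
  move: H; case: (\int[G]_x excess x) => [i| |] //; rewrite -EFinD => -[] H.
  by congr (_%:E); lra.
have [N [mN N0 NH]] : ae_eq G setT excess (cst 0).
  apply/ae_eq_integral_abs => //; rewrite -[RHS]I0.
  by apply: eq_integral => x _; rewrite gee0_abs.
have dense x0 (d : R) : (0 < d)%R -> exists2 x, (enorm (x - x0) < d)%R & K x = (Q x)%:E.
  move=> d0; apply: contrapT => nx.
  have mball : measurable [set y : 'cV[R]_n | enorm (y - x0) < d]%R.
    rewrite (_ : mkset _ = (fun y => enorm (y - x0)%R) @^-1` `]-oo, d[%classic).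
      rewrite -[X in measurable X]setTI; apply: measurable_fun_enorm => //.
      exact: measurable_fun_addcV.
    by apply/seteqP; split => y /=; rewrite in_itv.
  have := gauss_ball_gt0 x0 d0; rewrite ltNge => /negP; apply.
  rewrite -N0; apply: le_measure; rewrite ?inE// => y /= yd.
  apply: NH => /= Hy; apply: nx; exists y => //; exact/excess_eq0/Hy.
have KleQ x0 : K x0 <= (Q x0)%:E.
  rewrite leNgt; apply/negP => lt.
  have [b [Qb bK]] : exists b : R, (Q x0 < b)%R /\ b%:E < K x0.
    move: lt; case: (K x0) => [b|_|//].
      by rewrite lte_fin => vb; exists ((Q x0 + b) / 2)%R; rewrite lte_fin; split; lra.
    by exists (Q x0 + 1)%R; rewrite ltry; split => //; lra.
  have [d d0 dK] := Cvx_nbhs CK bK.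
  (* Within distance 1 of [x0], [Q] exceeds [Q x0] by at most [l |x - x0|]. *)
  pose l := (enorm x0 + 1)%R; have l0 : (0 < l)%R by rewrite ltr_wpDl ?enorm_ge0.
  pose d' : R := Num.min d (Num.min 1%R ((b - Q x0) / l)%R).
  have d'0 : (0 < d')%R by rewrite !lt_min d0 ltr01 divr_gt0// subr_gt0.
  have [x xd xQ] := dense x0 d' d'0.
  have xd1 : (enorm (x - x0) < d)%R by apply: (lt_le_trans xd); rewrite ge_min lexx.
  have xd2 : (enorm (x - x0) < 1)%R by apply: (lt_le_trans xd); rewrite !ge_min lexx !orbT.
  have xd3 : (enorm (x - x0) * l < b - Q x0)%R.
    by rewrite -ltr_pdivlMr//; apply: (lt_le_trans xd); rewrite !ge_min lexx !orbT.
  have := dK x xd1; rewrite xQ lte_fin ltNge => /negP; apply.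
  have xx : (enorm x <= enorm (x - x0) + enorm x0)%R.
    by rewrite -{1}(subrK x0 x); exact: enormD.
  move: xd3; rewrite /Q /l; have := enorm_ge0 x; have := enorm_ge0 x0.
  have := enorm_ge0 (x - x0)%R; move: xx xd2.
  by move: (enorm x) (enorm x0) (enorm (x - x0)%R) => X Y Z *; nra.
move=> x0; have := K0 x0; have := KleQ x0.
case Kx : (K x0) => [q| |] // + _; rewrite lee_fin => qQ.
congr (_%:E); apply/eqP; rewrite eq_le; apply/andP; split; first exact: qQ.
rewrite leNgt; apply/negP => lt; rewrite -/(Q x0) in lt.
pose d : R := Num.min 1%R (Q x0 - q)%R.
have d0 : (0 < d)%R by rewrite lt_min ltr01 subr_gt0.
have d1 : (d <= 1)%R by rewrite ge_min lexx.
have dq : (d <= Q x0 - q)%R by rewrite ge_min lexx orbT.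
have [w wd wQ] := dense x0 d d0.
(* [w] is the midpoint of [x0] and [w']. Since [(Q x0 + Q w') / 2 - Q w = |w - x0|^2 / 2], convexity
   of [K] gives [Q x0 - q <= |w - x0|^2], against the choice of [d]. *)
pose w' := (2 *: w - x0)%R.
have wE : (2^-1 *: x0 + (1 - 2^-1) *: w' = w)%R.
  by apply/matrixP => i j; rewrite !mxE; field.
have := KleQ w'; have := K0 w'; case Kw' : (K w') => [q'| |] // _; rewrite lee_fin => q'Q.
have h2 : (0 < 2^-1 :> R)%R by rewrite invr_gt0.
have h3 : (2^-1 < 1 :> R)%R by rewrite invf_lt1// ltr1n.
have [cc] := Cvx_fin_comb CK Kx Kw' h2 h3.
rewrite wE wQ => -[<-] cle.
have wd2 : (enorm (w - x0) ^+ 2 < Q x0 - q)%R.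
  by have := enorm_ge0 (w - x0)%R; nra.
move: cle q'Q wd2; rewrite /Q !enorm_sqr /w' !dotp_lin !(dotpC x0 w).
lra.
Qed.

End finite_mean.

Lemma quadratic_mean q : (forall x, K x = (enorm x ^+ 2 / 2 + q)%:E) ->
  \int[G]_x K x = (n%:R / 2 + q)%:E /\ \int[G]_x tilted x = (expR (r0 - q))%:E.
Proof.
move=> KQ; have q0 : (0 <= q)%R.
  by have := K0 0%R; rewrite KQ enorm0 expr0n/= mul0r add0r lee_fin.
split.
  rewrite -integral_sqenorm//; apply: eq_integral => x _; exact: KQ.
transitivity (\int[G]_x cst (expR (r0 - q))%:E x); last first.
  by rewrite integral_cst// -[RHS]mule1; congr (_ * _); exact: gauss_measureT.
apply: eq_integral => x _; rewrite /tilted KQ -EFinB /=; congr (expR _)%:E; ring.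
Qed.

End jensen.

(** * The inequality and its equality case *)

Theorem theorem4p3 (R : realType) (n : nat) (hn : (3 <= n)%N)
  (e : 'cV[R]_n) (he : sphere e)
  (mu : probability 'cV[R]_n R)
  (mu_sphere : mu (@sphere R n) = 1%E)
  (mu_invariant : forall A : 'M[R]_n,
     special_orthogonal A -> A *m e = e ->
     forall B : set 'cV[R]_n, measurable B -> mu (mulmx A @^-1` B) = mu B)
  (mu_centered : \col_(i < n) (\int[mu]_(v in @sphere R n) v i ord0) = 0)
  (f : 'cV[R]_n -> R) (hf : LCc f) :
  let lhs : \bar R :=
    ((2 / n%:R)%:E * \int[@gauss_measure R n]_x support_fun f x)%E in
  let rhs : \bar R :=
    (1 - (2 / n%:R)%:E *
       lne (((2 * pi) `^ (n%:R / 2))^-1%:E *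
            \int[lebesgue_cV R n]_x polar (Psi e mu f) x))%E in
  (rhs <= lhs)%E /\
  (lhs = rhs <->
   exists2 c : R, 0 < c & Psi e mu f = (fun x => c * gauss_pdf x)).
Proof.
have [phi [Cphi coer fphi]] := hf.
have [k [y0 [r0 [a [M [Ck k0 a0 kM hk]]]]]] := legendre_decomposition Cphi coer.
have hE : support_fun f = (fun x => k x + (dotp x y0 - r0)%:E)%E.
  by rewrite (support_fun_exp fphi); apply/funext.
have lk : lower_semicontinuous k by case: Ck.
have mk : measurable_fun setT k by exact: lsc_measurable_cV.
pose K := circ e mu k.
have CK : Cvx K by exact: (Cvx_circ hn he mu_invariant Ck k0 a0 kM).
have K0 x : (0 <= K x)%E by exact: circ_ge0.
have KM x : enorm x <= a -> (K x <= `|M|%:E)%E.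
  move=> xa; apply: (circ_le e mu_sphere k0 lk) => // y yx.
  by apply: (@le_trans _ _ M%:E); [apply: kM; rewrite yx|rewrite lee_fin ler_norm].
have mK : measurable_fun setT K by apply: lsc_measurable_cV; case: CK.
have KK : (\int[@gauss_measure R n]_x K x = \int[@gauss_measure R n]_x k x)%E.
  exact: (integral_circ hn he mu_sphere mu_invariant k0 lk mK).
have HE : circledast e mu (support_fun f) = (fun x => K x + (- r0)%:E)%E.
  by rewrite hE (circledast_decomposition hn he mu_sphere mu_invariant mu_centered y0 r0 Ck k0 a0 kM).
set g := Psi e mu f.
have [gL gH] : LCc g /\ support_fun g = (fun x => K x + (- r0)%:E)%E.
  (* [Psi] meets its specification once one candidate exists; boundedness of [K] on a ball supplies
     it. *)
  have [g0 g0P] : exists g0, LCc g0 /\ support_fun g0 = circledast e mu (support_fun f).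
    rewrite HE; apply: (@LCc_exists _ _ _ (- r0) a (`|M| - r0)) => //.
    - exact: Cvx_addr.
    - move=> x; have := K0 x; case: (K x) => [q| |] //=; rewrite ?leey// !lee_fin; lra.
    - move=> x /KM; case: (K x) => [q| |]; last by rewrite addNye !leNye.
        by rewrite -EFinD !lee_fin; lra.
      by rewrite leye_eq.
  have := @xgetPex _ (fun=> 0) [set g : 'cV[R]_n -> R | LCc g /\
    support_fun g = circledast e mu (support_fun f)] (ex_intro _ g0 g0P).
  by case=> gL gH; split; [exact: gL|rewrite -HE; exact: gH].
move=> lhs rhs.
have n0 : (0 < n%:R :> R) by rewrite ltr0n; apply: leq_trans hn.
have [il Il] := gauss_linear y0 r0.
have lhsE : lhs = ((2 / n%:R)%:E * (\int[@gauss_measure R n]_x K x + (- r0)%:E))%E.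
  by rewrite /lhs hE (integral_ge0D_integrable measurableT mk k0 il) Il KK.
pose J := (\int[@gauss_measure R n]_x tilted K r0 x)%E.
have rhsE : rhs = (1 - (2 / n%:R)%:E * lne J)%E.
  rewrite /rhs; congr (_ - _ * lne _)%E.
  rewrite /J (ge0_integral_gaussE (measurable_tilted CK r0) (tilted_ge0 K r0)).
  have c0 : (0 <= ((2 * pi) `^ (n%:R / 2))^-1%:E :> \bar R)%E by rewrite lee_fin invr_ge0 powR_ge0.
  have mp : measurable_fun setT (polar g).
    rewrite /polar gH; apply: (measurableT_comp (@measurable_expeR R)).
    by apply: (measurableT_comp (f := -%E)) => //; exact: emeasurable_funD.
  rewrite -(@ge0_integralZl _ _ _ (lebesgue_cV R n) setT measurableT _ mp _ (fun x _ => expeR_ge0 _) c0).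
  apply: eq_integral => x _; rewrite /polar gH /tilted /gauss_pdf.
  have := K0 x; case: (K x) => [q| |] // _; last by rewrite /= mule0 mul0e.
  rewrite -!EFinD /= -!EFinM; congr (_%:E); rewrite mulrCA -expRD; congr (_ * expR _).
  by ring.
have J0 : (0 < J)%E by exact: (tilted_gt0 CK K0 r0 a0 KM).
have quadP : (exists q, forall x, K x = (enorm x ^+ 2 / 2 + q)%:E) <->
    exists2 c : R, 0 < c & g = (fun x => c * gauss_pdf x).
  have pi0 : (0 < (2 * pi) `^ (n%:R / 2) :> R) by rewrite powR_gt0// mulr_gt0// pi_gt0.
  split=> [[q KQ]|[c c0 gE]].
    exists ((2 * pi) `^ (n%:R / 2) * expR (q - r0)); first by rewrite mulr_gt0 ?expR_gt0.
    rewrite (@LCc_gauss_uniq _ _ g (q - r0))//; last first.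
      by rewrite gH; apply/funext => x; rewrite KQ -EFinD addrA.
    apply/funext => x; rewrite expRD /gauss_pdf mulrACA divff ?mul1r// gt_eqF//.
  exists (ln (c / (2 * pi) `^ (n%:R / 2)) + r0) => x.
  have : support_fun g = (fun x => (enorm x ^+ 2 / 2 + ln (c / (2 * pi) `^ (n%:R / 2)))%:E).
    rewrite -support_fun_gauss; congr support_fun; rewrite gE; apply/funext => y.
    by rewrite expRD lnK ?posrE ?divr_gt0// /gauss_pdf mulrA.
  rewrite gH => /(congr1 (fun F => F x)); case: (K x) => [q| |] //.
  by rewrite -EFinD => -[] H; congr (_%:E); lra.
have n2 : (0 < 2 / n%:R :> R) by rewrite divr_gt0.
have : (0 <= \int[@gauss_measure R n]_x K x)%E by exact: integral_ge0.
(* If the mean of [K] is infinite, so is the left-hand side. Equality would then need [J = 0], while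
   a quadratic [K] would have a finite mean, so both sides of the equivalence fail. *)
case SE : (\int[@gauss_measure R n]_x K x)%E => [s| |] // _; last first.
  have lhsoo : lhs = +oo%E by rewrite lhsE SE gt0_muley// lte_fin.
  rewrite lhsoo leey; split => //; split=> [roo|/quadP[q KQ]].
    have := J0; move: roo; rewrite rhsE; case: (J) => [j| |] //=; rewrite ?gt0_muley ?lte_fin//.
    by move=> + j0; rewrite leNgt j0.
  by have [] := quadratic_mean K0 r0 KQ; rewrite SE.
pose m := n%:R / 2 + r0 - s.
have lhsm : lhs = (1 - (2 / n%:R)%:E * m%:E)%E.
  rewrite lhsE SE -EFinD -!EFinM -EFinB; congr (_%:E); rewrite /m; field.
  by rewrite gt_eqF.
have Jm : ((expR m)%:E <= J)%E by exact: (jensen_le CK K0 r0 SE).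
have lem : (m%:E <= lne J)%E.
  move: Jm J0; case: (J) => [j| |] //; rewrite ?leey// !lee_fin lte_fin => mj j0.
  by rewrite lne_EFin// lee_fin -(expRK m) ler_ln// posrE expR_gt0.
have eqm : lhs = rhs <-> J = (expR m)%:E.
  rewrite lhsm rhsE; split=> [|->]; last by rewrite /= leNgt expR_gt0/= expRK.
  move: lem J0; case: (J) => [j| |] //; rewrite ?gt0_muley ?lte_fin//.
  move=> _ j0; rewrite lne_EFin// -!EFinM -!EFinB => -[] H.
  have -> : m = ln j by apply: (mulfI (lt0r_neq0 n2)); lra.
  by rewrite lnK.
split.
  by rewrite lhsm rhsE; apply: leeD2l; rewrite leeN2; apply: lee_wpmul2l.
rewrite eqm -quadP; split=> [JE|[q KQ]].
  by exists (r0 - m) => x; exact: (jensen_eq CK K0 SE JE).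
have [SQ JQ] := quadratic_mean K0 r0 KQ.
rewrite /J JQ; congr (expR _)%:E; move: SQ; rewrite SE => -[] sE.
by rewrite /m sE; ring.
Qed.
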